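(* Let $n\geq 1$ be an integer, $\mu\in\mathbb{R}^n$ a unit vector, $\beta\in\mathbb{R}$, $0<a<1$ and $0<s\leq 1$. Assume that $s>1-a$ if $\beta>1$, and that $s>1-a\beta$ if $\beta\leq 1$. Let $\{t_k\}_{k=1}^\infty$ be a sequence of nonnegative real numbers converging to $0$ such that $$\sum_{k=1}^{\infty}t_k^{2\left(1+\frac{s-1}{a}\right)}<\infty\ \text{ if }\beta>1,\qquad \sum_{k=1}^{\infty}t_k^{2\left(\beta+\frac{s-1}{a}\right)}<\infty\ \text{ if }\beta\leq1.$$ Let $f\in H^s(\mathbb{R}^n)$. Then $$\lim_{k\rightarrow\infty}(2\pi)^{-n}S_{t_k,a}f(x+t_k^\beta\mu)=f(x)$$ for almost every $x\in\mathbb{R}^n$.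
   Context: Fourier transform convention: $\widehat{f}(\xi)=\int_{\mathbb{R}^n}e^{-i\xi\cdot x}f(x)\,dx$. The Sobolev space $H^s(\mathbb{R}^n)$ is the set of tempered distributions $f$ with $\|f\|_{H^s(\mathbb{R}^n)}=\left(\int_{\mathbb{R}^n}(1+|\xi|^2)^s|\widehat f(\xi)|^2\,d\xi\right)^{1/2}<\infty$. For $t\geq0$, $a>0$, $\beta\in\mathbb{R}$ and a unit vector $\mu\in\mathbb{R}^n$, $$S_{t,a}f(x+t^\beta\mu)=\int_{\mathbb{R}^n}e^{i(x\cdot\xi+t^\beta\mu\cdot\xi)}e^{it|\xi|^a}\widehat f(\xi)\,d\xi,\qquad x\in\mathbb{R}^n,$$ where for general $f\in H^s(\mathbb{R}^n)$, $s\ge 0$, the integral is understood in the $L^2$ (Plancherel) sense, i.e. $x\mapsto(2\pi)^{-n}S_{t,a}f(x+t^\beta\mu)$ is the $L^2$ function whose Fourier transform is $e^{i(t^\beta\mu\cdot\xi+t|\xi|^a)}\widehat f(\xi)$. *)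

(* Defs.v *)
From HB Require Import structures.
From mathcomp Require Import all_boot all_order all_algebra.
From mathcomp Require Import all_classical all_reals all_analysis.
From mathcomp Require Import complex.

Set Implicit Arguments.
Unset Strict Implicit.
Unset Printing Implicit Defensive.

Import Order.TTheory GRing.Theory Num.Theory.
Import numFieldNormedType.Exports.

Local Open Scope classical_set_scope.
Local Open Scope ring_scope.
Local Open Scope complex_scope.

Section rV_measurable.
Context (R : realType) (n : nat).

Let coord (i : 'I_n) (x : 'rV[R]_n) : R := x ord0 i.

Let rV_set0 : g_sigma_preimage coord set0.
Proof. exact: sigma_algebra0. Qed.

Let rV_setC A : g_sigma_preimage coord A -> g_sigma_preimage coord (~` A).
Proof. exact: sigma_algebraC. Qed.

Let rV_bigcup (F : _^nat) : (forall i, g_sigma_preimage coord (F i)) ->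
  g_sigma_preimage coord (\bigcup_i (F i)).
Proof. exact: sigma_algebra_bigcup. Qed.

(* The Borel sigma-algebra of R^n, generated by the coordinate functions. *)
HB.instance Definition _ := @isMeasurable.Build default_measure_display
  ('rV[R]_n) (g_sigma_preimage coord) rV_set0 rV_setC rV_bigcup.

Lemma measurable_coord (i : 'I_n) :
  measurable_fun [set: 'rV[R]_n] (fun x : 'rV[R]_n => x ord0 i).
Proof.
move=> _ Y mY; rewrite setTI; apply: sub_sigma_algebra => /=.
rewrite -bigcup_seq/=; exists i => /=; first by rewrite mem_index_enum.
by exists Y => //; rewrite setTI.
Qed.

Lemma measurable_fun_rV d (T : measurableType d) (f : T -> 'rV[R]_n) :
  (forall i, measurable_fun [set: T] (fun x => f x ord0 i)) ->
  measurable_fun [set: T] f.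
Proof.
move=> mf _ A mA; rewrite setTI.
suff: g_sigma_preimage coord `<=` [set B | measurable (f @^-1` B)] by exact.
apply: smallest_sub.
  split=> [|B mB|F mF] /=.
  - by rewrite preimage_set0.
  - by rewrite setTD -preimage_setC; exact: measurableC.
  - by rewrite preimage_bigcup; apply: bigcup_measurable => k _; exact: mF.
move=> B; rewrite -bigcup_seq /= => -[i _ [C mC <-]] /=.
rewrite setTI -[X in measurable X]setTI; exact: mf.
Qed.

End rV_measurable.

Section lebesgue_rV.
Context (R : realType).

Definition rV_cons n (p : R * 'rV[R]_n) : 'rV[R]_n.+1 :=
  row_mx (\row_(j < 1) p.1) p.2.

Definition rV_uncons n (x : 'rV[R]_n.+1) : R * 'rV[R]_n :=
  (x ord0 ord0, \row_j x ord0 (lift ord0 j)).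

Lemma rV_consK n : cancel (@rV_cons n) (@rV_uncons n).
Proof.
move=> [a v]; rewrite /rV_uncons /rV_cons /=; congr pair.
  have -> : ord0 = lshift n ord0 :> 'I_(1 + n) by exact/val_inj.
  by rewrite [LHS](@row_mxEl _ 1 1 n) mxE.
apply/rowP => j; rewrite mxE.
have -> : lift ord0 j = rshift 1 j :> 'I_(1 + n) by exact/val_inj.
by rewrite [LHS](@row_mxEr _ 1 1 n).
Qed.

Lemma measurable_rV_cons n : measurable_fun setT (@rV_cons n).
Proof.
apply: measurable_fun_rV => i.
rewrite /rV_cons; under eq_fun do rewrite mxE.
case: (@fintype.split 1 n i) => j.
  by under eq_fun do rewrite mxE; exact: measurable_fst.
exact: (measurableT_comp (measurable_coord j) measurable_snd).
Qed.

Lemma measurable_rV_uncons n : measurable_fun setT (@rV_uncons n).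
Proof.
apply/measurable_fun_pairP; split; first exact: measurable_coord.
apply: measurable_fun_rV => i; under eq_fun do rewrite /= mxE.
exact: measurable_coord.
Qed.

Section step.
Context (n : nat) (mu : {sigma_finite_measure set 'rV[R]_n -> \bar R}).

Definition lebesgue_step : set 'rV[R]_n.+1 -> \bar R :=
  pushforward (@lebesgue_measure R \x mu)%E (@rV_cons n).

Let lebesgue_step0 : lebesgue_step set0 = 0%E.
Proof. by rewrite /lebesgue_step/pushforward preimage_set0 measure0. Qed.

Let lebesgue_step_ge0 A : (0 <= lebesgue_step A)%E.
Proof. by rewrite /lebesgue_step/pushforward measure_ge0. Qed.

Let lebesgue_step_sigma_additive : semi_sigma_additive lebesgue_step.
Proof.
move=> F mF tF mUF; rewrite /lebesgue_step/pushforward preimage_bigcup.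
apply: measure_semi_sigma_additive.
- by move=> k; rewrite -[X in measurable X]setTI; exact: measurable_rV_cons.
- apply/trivIsetP => /= i j _ _ ij; rewrite -preimage_setI.
  by move/trivIsetP : tF => /(_ _ _ _ _ ij) ->//; rewrite preimage_set0.
- by rewrite -preimage_bigcup -[X in measurable X]setTI;
     exact: measurable_rV_cons.
Qed.

HB.instance Definition _ := isMeasure.Build _ _ _ lebesgue_step
  lebesgue_step0 lebesgue_step_ge0 lebesgue_step_sigma_additive.

Let lebesgue_step_sigma_finite : sigma_finite setT lebesgue_step.
Proof.
have /sigma_finiteP[F [TF ndF Foo]] := sigma_finiteT (@lebesgue_measure R).
have /sigma_finiteP[G [TG ndG Goo]] := sigma_finiteT mu.
exists (fun k => @rV_uncons n @^-1` (F k `*` G k)).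
  apply/esym; rewrite -subTset => x _.
  have : [set: R] (rV_uncons x).1 by [].
  have : [set: 'rV[R]_n] (rV_uncons x).2 by [].
  rewrite {1}TF {1}TG => -[k _ Gk] [l _ Fl].
  exists (maxn k l) => //; split => /=.
  - by move: Fl; exact/subsetPset/ndF/leq_maxr.
  - by move: Gk; exact/subsetPset/ndG/leq_maxl.
move=> k; have [mF Fk] := Foo k; have [mG Gk] := Goo k; split.
  rewrite -[X in measurable X]setTI; apply: measurable_rV_uncons => //.
  exact: measurableX.
rewrite /lebesgue_step /pushforward -comp_preimage.
rewrite (_ : _ \o _ = id); last by apply/funext => x /=; rewrite rV_consK.
by rewrite preimage_id product_measure1E// lte_mul_pinfty// ge0_fin_numE.
Qed.

HB.instance Definition _ := Measure_isSigmaFinite.Build _ _ _ lebesgue_step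
  lebesgue_step_sigma_finite.

End step.

(* Lebesgue measure on R^n, as the iterated product measure. *)
Fixpoint lebesgue_rV (n : nat) : {sigma_finite_measure set 'rV[R]_n -> \bar R} :=
  match n with
  | 0 => \d_(0 : 'rV[R]_0)
  | m.+1 => lebesgue_step (lebesgue_rV m)
  end.

End lebesgue_rV.

Section euclidean.
Context (R : realType) (n : nat).
Implicit Types x y : 'rV[R]_n.

Definition dotp x y : R := \sum_(i < n) x ord0 i * y ord0 i.

(* The norm `|x| of the library on 'rV[R]_n is the sup norm. *)
Definition enorm x : R := Num.sqrt (dotp x x).

End euclidean.

Section complex_integral.
Context (R : realType) (n : nat).
Local Notation mu := (@lebesgue_rV R n).
Implicit Types g : 'rV[R]_n -> R[i].

Definition cmeasurable g :=
  measurable_fun setT (fun x => complex.Re (g x)) /\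
  measurable_fun setT (fun x => complex.Im (g x)).

Definition cintegrable g :=
  mu.-integrable setT (fun x => (complex.Re (g x))%:E) /\
  mu.-integrable setT (fun x => (complex.Im (g x))%:E).

Definition cintegral g : R[i] :=
  (\int[mu]_x complex.Re (g x)) +i* (\int[mu]_x complex.Im (g x)).

Definition square_integrable g :=
  cmeasurable g /\ (\int[mu]_x (Normc.normc (g x) ^+ 2)%:E < +oo)%E.

Definition expi (theta : R) : R[i] := cos theta +i* sin theta.

End complex_integral.

Section tempered_distributions.
Context (R : realType) (n : nat).
Local Notation Rn := 'rV[R]_n.
Local Notation C := R[i].

(* [:: i1; ..; ik] : seq 'I_n encodes the partial derivative D_i1 ... D_ik. *)
Definition pderiv (alpha : seq 'I_n) (f : Rn -> R) : Rn -> R :=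
  foldr (fun i h => 'D_(delta_mx ord0 i) h) f alpha.

Definition smooth (f : Rn -> R) :=
  forall (alpha : seq 'I_n) (x : Rn), differentiable (pderiv alpha f) x.

(* M bounds the Schwartz seminorm of order N of phi. *)
Definition schwartz_bound (N : nat) (phi : Rn -> C) (M : R) :=
  forall (alpha : seq 'I_n) (x : Rn), (size alpha <= N)%N ->
    (1 + enorm x) ^+ N *
    Normc.normc (pderiv alpha (fun y => complex.Re (phi y)) x +i*
                 pderiv alpha (fun y => complex.Im (phi y)) x) <= M.

Definition schwartz (phi : Rn -> C) :=
  [/\ smooth (fun y => complex.Re (phi y)),
      smooth (fun y => complex.Im (phi y)) &
      forall N : nat, exists M : R, schwartz_bound N phi M].

(* Distributions are total functions, of which only the values at Schwartz
   functions are relevant. *)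
Definition distr := (Rn -> C) -> C.

Definition tempered (u : distr) :=
  (forall (c : C) (phi psi : Rn -> C), schwartz phi -> schwartz psi ->
     u (fun x => c * phi x + psi x) = c * u phi + u psi) /\
  (exists (N : nat) (K : R), forall (phi : Rn -> C) (M : R),
     schwartz phi -> schwartz_bound N phi M ->
     Normc.normc (u phi) <= K * M).

Definition distr_of (g : Rn -> C) : distr :=
  fun phi => cintegral (fun x => g x * phi x).

Definition represents (u : distr) (g : Rn -> C) :=
  cmeasurable g /\
  forall phi, schwartz phi ->
    cintegrable (fun x => g x * phi x) /\ u phi = distr_of g phi.

Definition fourier (phi : Rn -> C) (xi : Rn) : C :=
  cintegral (fun x => expi (- dotp xi x) * phi x).

Definition distr_fourier (u : distr) : distr :=
  fun phi => u (fourier phi).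

Definition sobolev_norm (s : R) (uhat : Rn -> C) : \bar R :=
  ((\int[@lebesgue_rV R n]_xi
     ((1 + enorm xi ^+ 2) `^ s * Normc.normc (uhat xi) ^+ 2)%:E) `^ 2^-1)%E.

Definition sobolev (s : R) (u : distr) :=
  tempered u /\
  exists2 uhat, represents (distr_fourier u) uhat &
                (sobolev_norm s uhat < +oo)%E.

(* Sf is (a version of) the function x |-> S_{t,a} u (x + t^beta mu), which is
   determined up to a null set. *)
Definition propagated (t a beta : R) (mu : Rn) (u : distr)
    (Sf : Rn -> C) :=
  let g x := ((2 * pi) ^- n)%:C * Sf x in
  square_integrable g /\
  exists2 uhat, represents (distr_fourier u) uhat &
    represents (distr_fourier (distr_of g))
      (fun xi => expi (t `^ beta * dotp mu xi + t * enorm xi `^ a) * uhat xi).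

End tempered_distributions.

(* Main.v *)
(* The function w_k = (2 pi)^-n S_{t_k} f (. + t_k^beta mu) - f has Fourier transform
   (e^(i theta_k) - 1) fhat, and splitting frequencies at |xi| ~ t^(-1/a) gives
   |e^(i theta_k) - 1|^2 <= 4 t_k^(2 sigma) (1 + |xi|^2)^s, where 2 sigma is the
   exponent of the summability hypothesis. Hence the L^2 norms of the transforms of
   the w_k are square summable, and the weak L^2 inequality, Chebyshev and
   Borel-Cantelli give w_k -> 0 almost everywhere.

   Instead of Plancherel's theorem, only the inequality
     gaussian measure of {|w| >= lam} <= C * ||hat w||_2^2 / lam^2
   is used. It is obtained by duality: for a set A, the integral of w over A against
   a Gaussian weight is the limit of the integrals of the Gaussian regularizations of
   w, which are paired through hat w with the Fourier transform of a function bounded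
   by a Gaussian; the L^2 norm of the latter is controlled by the explicit Gaussian
   integrals alone. *)

Require Import Defs.
From mathcomp Require Import all_boot all_order all_algebra.
From mathcomp Require Import all_classical all_reals all_analysis.
From mathcomp Require Import measurable_realfun.
From mathcomp Require Import complex.
From mathcomp Require Import ring lra.
Import Order.TTheory GRing.Theory Num.Theory.
Import numFieldNormedType.Exports.
Local Open Scope classical_set_scope.
Local Open Scope ring_scope.
Local Open Scope complex_scope.

Set Implicit Arguments.
Unset Strict Implicit.
Unset Printing Implicit Defensive.

(** * Gaussian integrals on R^n *)

(** The obstacle is that f and its propagations are tied to their transforms only through pairings
    with Schwartz functions, and that f is a priori known only to be integrable against such
    functions. The test functions are therefore modulated Gaussians, whose transforms and integrals
    are explicit; pairing with them produces Gaussian averages of w. The estimate is stated for a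
    Gaussian measure because w is integrable against that weight, and nothing is lost since Gaussian
    and Lebesgue null sets agree. The duality bound has the shape tau * D + B * nu A / tau with tau
    free. This is Cauchy-Schwarz in a form linear in the measure nu A, hence a uniform absolute
    continuity, and it allows the regularization to be removed set by set: on a pi-system of rays
    with null boundary, then by a Dynkin argument, in place of Lebesgue's differentiation theorem.
    The constants do not depend on the scale of the regularization because the masses of a Gaussian
    and of its dual Gaussian multiply to (2 pi)^n at every scale. *)

Section lebesgue_rV_integral.
Context {R : realType}.
Local Notation leb := (@lebesgue_rV R).
Local Notation mu1 := (@lebesgue_measure R).

Let m1 : {sigma_finite_measure set (measurableTypeR R) -> \bar R} := mu1.
Let lebx n : {measure set (measurableTypeR R * 'rV[R]_n) -> \bar R} :=
  (m1 \x leb n)%E.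

Let mcons n : measurable_fun [set: measurableTypeR R * 'rV[R]_n]
  (@rV_cons R n : measurableTypeR R * 'rV[R]_n -> 'rV[R]_n.+1).
Proof. exact: measurable_rV_cons. Qed.

(** The measure on R^(n+1) is by construction the image of a product under [rV_cons], so a change of
    variables followed by Tonelli peels off the first coordinate. This and the signed version below
    drive the inductions on the dimension for Gaussian integrals. *)
Lemma ge0_integral_rV_cons n (f : 'rV[R]_n.+1 -> \bar R) :
  measurable_fun setT f -> (forall x, 0 <= f x)%E ->
  (\int[leb n.+1]_x f x = \int[mu1]_a \int[leb n]_v f (rV_cons (a, v)))%E.
Proof.
move=> mf f0.
transitivity (\int[lebx n]_x f (rV_cons x))%E.
  have := @ge0_integral_pushforward _ _ _ _ _ _ (@mcons n) (lebx n) setT f.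
  by apply.
apply: (@fubini_tonelli1 _ _ _ _ _ m1 (leb n) (f \o @rV_cons R n)) => //=.
exact: measurableT_comp mf (@measurable_rV_cons R n).
Qed.

Lemma integral_rV_cons n (f : 'rV[R]_n.+1 -> \bar R) :
  (leb n.+1).-integrable setT f ->
  (\int[leb n.+1]_x f x = \int[mu1]_a \int[leb n]_v f (rV_cons (a, v)))%E.
Proof.
move=> fi; have mf := measurable_int _ fi.
have fi2 : (lebx n).-integrable setT (f \o @rV_cons R n).
  apply/integrableP; split.
    exact: measurableT_comp mf (@mcons n).
  move/integrableP : fi => [_]; apply: le_lt_trans.
  rewrite le_eqVlt; apply/orP; left; apply/eqP/esym.
  have := @ge0_integral_pushforward _ _ _ _ _ _ (@mcons n) (lebx n) setT
    (abse \o f).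
  apply => //; first exact: measurableT_comp.
  by move=> y _ /=; exact: abse_ge0.
transitivity (\int[lebx n]_x f (rV_cons x))%E.
  have := @integral_pushforward _ _ _ _ _ _ (@mcons n) (lebx n) setT f mf fi2.
  by apply.
exact/esym/(@integral12_prod_meas1 _ _ _ _ _ m1 (leb n) _ fi2).
Qed.

Lemma rV_cons0 n (p : R * 'rV[R]_n) k : rV_cons p k ord0 = p.1.
Proof. by rewrite (ord1 k) -[in RHS](rV_consK p). Qed.

Lemma rV_consS n (p : R * 'rV[R]_n) k j :
  rV_cons p k (lift ord0 j) = p.2 ord0 j.
Proof. by rewrite (ord1 k) -[in RHS](rV_consK p) /= mxE. Qed.

Lemma rV_unconsK n : cancel (@rV_uncons R n) (@rV_cons R n).
Proof.
move=> x; apply/rowP => i; case: (unliftP ord0 i) => [j ->|->].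
  by rewrite rV_consS mxE.
by rewrite rV_cons0.
Qed.

Lemma dotp_rV_cons n (p q : R * 'rV[R]_n) :
  dotp (rV_cons p) (rV_cons q) = p.1 * q.1 + dotp p.2 q.2.
Proof.
rewrite /dotp big_ord_recl !rV_cons0; congr (_ + _).
by apply: eq_bigr => i _; rewrite !rV_consS.
Qed.

Lemma rV_consB n (p q : R * 'rV[R]_n) :
  rV_cons p - rV_cons q = rV_cons (p.1 - q.1, p.2 - q.2).
Proof.
apply: (can_inj (@rV_unconsK n)); rewrite rV_consK /rV_uncons.
congr pair; first by rewrite mxE [X in _ + X]mxE !rV_cons0.
by apply/rowP => i; rewrite mxE [in LHS]mxE [X in _ + X]mxE [RHS]mxE [X in _ = _ + X]mxE !rV_consS.
Qed.

Lemma measurable_fun_dotp d (T : measurableType d) n (f g : T -> 'rV[R]_n) :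
  measurable_fun setT f -> measurable_fun setT g ->
  measurable_fun setT (fun x => dotp (f x) (g x)).
Proof.
move=> mf mg; apply: measurable_sum => i.
by apply: measurable_funM; exact: (measurableT_comp (measurable_coord i)).
Qed.

Lemma measurable_fun_subrV d (T : measurableType d) n (f g : T -> 'rV[R]_n) :
  measurable_fun setT f -> measurable_fun setT g ->
  measurable_fun setT (fun x => f x - g x).
Proof.
move=> mf mg; apply: measurable_fun_rV => i.
under eq_fun do rewrite !mxE.
by apply: measurable_funB; exact: (measurableT_comp (measurable_coord i)).
Qed.

Lemma integral_gaussian1 (a m : R) : 0 < a ->
  (\int[mu1]_x (expR (- a * (x - m) ^+ 2))%:E = (Num.sqrt (pi / a))%:E)%E.
Proof.
(* The normal density of variance 1 / (2 a) has exponent - a (x - m)^2 and peak the inverse of sqrt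
   (pi / a), so its total mass one gives the value. *)
move=> a0; pose s := Num.sqrt (2 * a)^-1.
have s2 : s ^+ 2 = (2 * a)^-1 by rewrite sqr_sqrtr// invr_ge0 mulr_ge0// ltW.
have s0 : s != 0 by rewrite gt_eqF// sqrtr_gt0 invr_gt0 mulr_gt0.
have := integral_normal_pdf m s.
have E : s ^+ 2 * pi *+ 2 = pi / a by rewrite s2; field; rewrite gt_eqF.
have E2 x : - ((x - m) ^+ 2) / (s ^+ 2 *+ 2) = - a * (x - m) ^+ 2.
  by rewrite s2; field; rewrite gt_eqF.
rewrite normal_pdfE// /normal_peak /normal_fun E.
under eq_integral do rewrite E2 EFinM.
rewrite ge0_integralZl//; last first.
  apply/measurable_EFinP/measurableT_comp => //; apply: measurable_funM => //.
  by apply: measurable_funX; exact: measurable_funB.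
move=> /(congr1 (fun x => (Num.sqrt (pi / a))%:E * x)%E).
rewrite muleA -EFinM mulfV ?mul1e ?mule1//.
by rewrite gt_eqF// sqrtr_gt0 divr_gt0// pi_gt0.
Qed.

Definition gaussian n (a : R) (x : 'rV[R]_n) := expR (- a * dotp x x).

Lemma gaussian_ge0 n a (x : 'rV[R]_n) : 0 <= gaussian a x.
Proof. exact: expR_ge0. Qed.

Lemma measurable_gaussian d (T : measurableType d) n a (f : T -> 'rV[R]_n) :
  measurable_fun setT f -> measurable_fun setT (fun x => gaussian a (f x)).
Proof.
move=> mf; rewrite /gaussian; apply: measurableT_comp => //.
apply: measurable_funM => //; exact: measurable_fun_dotp.
Qed.

Lemma measurable_gaussianB n a (m : 'rV[R]_n) :
  measurable_fun setT (fun x : 'rV[R]_n => gaussian a (x - m)).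
Proof. by apply: measurable_gaussian; exact: measurable_fun_subrV. Qed.

Lemma integral_gaussian n (a : R) (m : 'rV[R]_n) : 0 < a ->
  (\int[leb n]_x (gaussian a (x - m))%:E = (Num.sqrt (pi / a) ^+ n)%:E)%E.
Proof.
move=> a0; elim: n m => [|n IH] m.
  rewrite /= integral_dirac//=; last first.
    by apply/measurable_EFinP; exact: measurable_gaussianB.
  rewrite diracE in_setT mul1e.
  by rewrite /gaussian /dotp big_ord0 mulr0 expR0.
rewrite ge0_integral_rV_cons//; last 2 first.
- by apply/measurable_EFinP; exact: measurable_gaussianB.
- by move=> x; rewrite lee_fin gaussian_ge0.
rewrite -(rV_unconsK m); set p := rV_uncons m.
have E x v : gaussian a (rV_cons (x, v) - rV_cons p) =
    expR (- a * (x - p.1) ^+ 2) * gaussian a (v - p.2).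
  by rewrite /gaussian rV_consB dotp_rV_cons/= mulrDr expRD expr2.
have inner x : (\int[leb n]_v (gaussian a (rV_cons (x, v) - rV_cons p))%:E =
    (expR (- a * (x - p.1) ^+ 2))%:E * (Num.sqrt (pi / a) ^+ n)%:E)%E.
  under eq_integral do rewrite E EFinM.
  rewrite ge0_integralZl//.
  - by rewrite IH.
  - by apply/measurable_EFinP; exact: measurable_gaussianB.
  - by move=> v _; rewrite lee_fin gaussian_ge0.
under eq_integral do rewrite inner.
rewrite ge0_integralZr//; last first.
  apply/measurable_EFinP/measurableT_comp => //; apply: measurable_funM => //.
  by apply: measurable_funX; exact: measurable_funB.
by rewrite integral_gaussian1// -EFinM -exprS.
Qed.

Lemma integrable_gaussian n (a : R) (m : 'rV[R]_n) : 0 < a ->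
  (leb n).-integrable setT (fun x => (gaussian a (x - m))%:E).
Proof.
move=> a0; apply/integrableP; split.
  by apply/measurable_EFinP; exact: measurable_gaussianB.
under eq_integral do rewrite gee0_abs ?lee_fin ?gaussian_ge0//.
by rewrite integral_gaussian// ltry.
Qed.

Lemma Rintegral_gaussian n (a : R) (m : 'rV[R]_n) : 0 < a ->
  \int[leb n]_x gaussian a (x - m) = Num.sqrt (pi / a) ^+ n.
Proof. by move=> a0; rewrite /Rintegral integral_gaussian. Qed.

Lemma measurable_hyperplane n (i : 'I_n) (c : R) :
  measurable [set x : 'rV[R]_n | x ord0 i = c].
Proof.
rewrite -[X in measurable X]setTI.
exact: (measurable_coord i measurableT (measurable_set1 c)).
Qed.

(** In the product the set is either R times a hyperplane of lower dimension, or a point times R^n.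
    Hyperplanes carry the boundaries of the rays used later as test sets. *)
Lemma hyperplane_null n (i : 'I_n) (c : R) :
  leb n [set x | x ord0 i = c] = 0%E.
Proof.
elim: n i => [[]//|n IH] i.
rewrite [LHS]/=/lebesgue_step/pushforward.
have [j ->|->] := unliftP ord0 i.
  rewrite (_ : _ @^-1` _ = [set: R] `*` [set x : 'rV[R]_n | x ord0 j = c]).
    rewrite product_measure1E//.
      by rewrite [X in (_ * X)%E](IH j) mule0.
    exact: measurable_hyperplane.
  by apply/seteqP; split=> [x|x []] /=; rewrite rV_consS.
rewrite (_ : _ @^-1` _ = [set c] `*` [set: 'rV[R]_n]).
  transitivity (mu1 [set c] * leb n setT)%E; first exact: product_measure1E.
  by rewrite lebesgue_measure_set1 mul0e.
by apply/seteqP; split=> [x|x []] /=; rewrite rV_cons0.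
Qed.

End lebesgue_rV_integral.

(** * Domination for real-valued integrals *)

Section real_integrals.
Context d (T : measurableType d) (R : realType).
Variable mu : {measure set T -> \bar R}.

Lemma le_integrableR (f g : T -> R) :
  measurable_fun setT f -> (forall x, `|f x| <= g x) ->
  mu.-integrable setT (EFin \o g) -> mu.-integrable setT (EFin \o f).
Proof.
move=> mf fg; apply: le_integrable => //; first exact/measurable_EFinP.
by move=> x _ /=; rewrite lee_fin (le_trans (fg x))// ler_norm.
Qed.

Lemma dominated_cvg_Rintegral (f_ : nat -> T -> R) (f g : T -> R) :
  (forall n, measurable_fun setT (f_ n)) -> measurable_fun setT f ->
  {ae mu, forall x, f_ ^~ x @ \oo --> f x} ->
  mu.-integrable setT (EFin \o g) -> (forall n x, `|f_ n x| <= g x) ->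
  \int[mu]_x f_ n x @[n --> \oo] --> \int[mu]_x f x.
Proof.
move=> mf_ mf f_f ig fg.
have [] := @dominated_convergence _ _ _ mu setT measurableT
  (fun n x => (f_ n x)%:E) (EFin \o f) (EFin \o g).
- by move=> n; exact/measurable_EFinP.
- exact/measurable_EFinP.
- apply: filterS f_f => x fx _ /=; apply/fine_cvgP; split => //=.
  exact: nearW.
- exact: ig.
- by apply/aeW => x n _ /=; rewrite lee_fin.
move=> if_ _ fc; apply: fine_cvg; rewrite fineK//.
exact: integrable_fin_num.
Qed.

Lemma Rintegral_indic (A : set T) (f : T -> R) :
  \int[mu]_(x in A) f x = \int[mu]_x (\1_A x * f x).
Proof.
rewrite Rintegral_mkcond; apply: eq_Rintegral => x _.
by rewrite patchE indicE; case: ifPn; rewrite ?mul1r ?mul0r.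
Qed.

End real_integrals.

(** * Fourier transform of a Gaussian *)

Section fourier_gaussian.
Context {R : realType}.
Local Notation leb := (@lebesgue_rV R).
Local Notation mu1 := (@lebesgue_measure R).

Lemma dominated_cvg_Rintegral1 (f_ : nat -> R -> R) (f g : R -> R) :
  (forall n, measurable_fun setT (f_ n)) -> measurable_fun setT f ->
  (forall x, f_ ^~ x @ \oo --> f x) ->
  mu1.-integrable setT (EFin \o g) -> (forall n x, `|f_ n x| <= g x) ->
  \int[mu1]_x f_ n x @[n --> \oo] --> \int[mu1]_x f x.
Proof.
move=> mf_ mf f_f ig fg.
by apply: (@dominated_cvg_Rintegral _ (measurableTypeR R) R mu1 f_ f g) => //;
  exact: aeW.
Qed.

(** The fundamental theorem of calculus on growing symmetric intervals leaves boundary terms that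
    tend to 0, while dominated convergence identifies the limit of the truncated integrals. It
    serves as integration by parts without boundary terms. *)
Lemma Rintegral_derive1_eq0 (g : R -> R) :
  (forall x, derivable g x 1) -> continuous (derive1 g) ->
  mu1.-integrable setT (EFin \o (derive1 g)) ->
  g x @[x --> +oo] --> (0 : R) -> g x @[x --> -oo] --> (0 : R) ->
  \int[mu1]_x (derive1 g) x = 0.
Proof.
move=> dg cg ig goo gNoo.
(* The radius is [n.+1] and not [n]: the fundamental theorem needs an interval with distinct
   endpoints. *)
pose f_ (n : nat) := ((derive1 g) \_ `[(- n.+1%:R), n.+1%:R] : R -> R).
have f_E n : \int[mu1]_x f_ n x = g n.+1%:R - g (- n.+1%:R).
  have /(congr1 fine) /= <- : (\int[mu1]_(x in `[(- n.+1%:R)%R, (n.+1%:R)%R]) (derive1 g x)%:E =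
      (g n.+1%:R)%:E - (g (- n.+1%:R))%:E)%E.
    apply: continuous_FTC2.
    - by rewrite gtrN.
    - by apply: continuous_subspaceT => x; exact: cg.
    - split.
      + by move=> x _; exact: dg.
      + apply: cvg_at_right_filter.
        exact/differentiable_continuous/derivable1_diffP.
      + apply: cvg_at_left_filter.
        exact/differentiable_continuous/derivable1_diffP.
    - by [].
  by rewrite /f_ -Rintegral_mkcond.
have mg : measurable_fun setT (derive1 g) by exact: continuous_measurable_fun.
have h1 : \int[mu1]_x f_ n x @[n --> \oo] --> \int[mu1]_x (derive1 g) x.
  apply: (@dominated_cvg_Rintegral1 f_ (derive1 g) (fun x => `|derive1 g x|)).
  - by move=> n; apply/measurable_restrict => //; exact: measurable_funS mg.
  - exact: mg.
  - move=> x; apply: cvg_near_cst.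
    exists (Num.truncn `|x|) => // n /= xn.
    rewrite /f_ patchE mem_set//= in_itv/= -ler_norml.
    by rewrite (le_trans (ltW (truncnS_gt _)))// ler_nat ltnS.
  - have := integrable_abse ig; by apply: eq_integrable.
  - move=> n x; rewrite /f_ patchE; case: ifPn => _ //.
    by rewrite normr0.
have h2 : \int[mu1]_x f_ n x @[n --> \oo] --> (0 : R).
  rewrite (_ : (fun n => _) = (fun n => g n.+1%:R - g (- n.+1%:R))); last first.
    by apply/funext => n; exact: f_E.
  rewrite -(subrr (0 : R)); apply: cvgB.
    have /cvg_pinftyP := goo; apply.
    by apply/cvgryPge => A; exists (Num.truncn A) => // n /= An;
      rewrite (le_trans (ltW (truncnS_gt _)))// ler_nat ltnS.
  have /cvgNy_compNP /cvg_pinftyP := gNoo.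
  apply.
  by apply/cvgryPge => A; exists (Num.truncn A) => // n /= An;
    rewrite (le_trans (ltW (truncnS_gt _)))// ler_nat ltnS.
exact: (cvg_unique _ h1 h2).
Qed.

Lemma le_integrable1 (f g : R -> R) :
  measurable_fun setT f -> (forall x, `|f x| <= g x) ->
  mu1.-integrable setT (EFin \o g) -> mu1.-integrable setT (EFin \o f).
Proof.
move=> mf fg; apply: (@le_integrableR _ (measurableTypeR R) R mu1 f g) => //.
Qed.

Lemma measurable_gaussian1 (a : R) :
  measurable_fun setT (fun x : R => expR (- a * x ^+ 2)).
Proof.
apply: measurableT_comp => //; apply: measurable_funM => //.
Qed.

Lemma integrable_gaussian1 (a : R) : 0 < a ->
  mu1.-integrable setT (fun x => (expR (- a * x ^+ 2))%:E).
Proof.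
move=> a0; apply/integrableP; split.
  by apply/measurable_EFinP; exact: measurable_gaussian1.
under eq_integral do rewrite gee0_abs ?lee_fin ?expR_ge0//.
have := integral_gaussian1 0 a0.
under [in X in X -> _]eq_integral do rewrite subr0.
by move=> ->; rewrite ltry.
Qed.

(** Half of the exponent absorbs the factor |x|: it is worth at least 1 + a x^2 / 2, and 1 + 2 / a
    is chosen so that (1 + 2 / a) (1 + a x^2 / 2) dominates 1 + x^2, hence |x|. *)
Lemma normr_gaussian1_le (a x : R) : 0 < a ->
  `|x| * expR (- a * x ^+ 2) <= (1 + 2 / a) * expR (- (a / 2) * x ^+ 2).
Proof.
move=> a0.
have -> : - a * x ^+ 2 = - (a / 2) * x ^+ 2 - a / 2 * x ^+ 2 by field.
rewrite expRD mulrCA mulrC ler_wpM2r ?expR_ge0// expRN ler_pdivrMr ?expR_gt0//.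
have h : 1 + a / 2 * x ^+ 2 <= expR (a / 2 * x ^+ 2) by exact: expR_ge1Dx.
have h2 : `|x| <= 1 + x ^+ 2.
  by rewrite -(ger0_norm (sqr_ge0 x)) normrX; have := normr_ge0 x; nra.
have a2 : 0 < 1 + 2 / a by rewrite addr_gt0// divr_gt0.
apply: le_trans (ler_wpM2l (ltW a2) h).
apply: le_trans h2 _.
have -> : (1 + 2 / a) * (1 + a / 2 * x ^+ 2) =
  1 + x ^+ 2 + 2 / a + a / 2 * x ^+ 2 by field; rewrite gt_eqF.
rewrite -addrA lerDl addr_ge0// ?divr_ge0// ?(ltW a0)//.
by rewrite mulr_ge0 ?sqr_ge0// divr_ge0// ltW.
Qed.

Lemma integrable_normr_gaussian1 (a : R) : 0 < a ->
  mu1.-integrable setT (fun x => (`|x| * expR (- a * x ^+ 2))%:E).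
Proof.
move=> a0.
apply: (@le_integrable1 (fun x => `|x| * expR (- a * x ^+ 2))
  (fun x => (1 + 2 / a) * expR (- (a / 2) * x ^+ 2))).
- by apply: measurable_funM; [exact: normr_measurable|exact: measurable_gaussian1].
- move=> x; rewrite ger0_norm ?mulr_ge0 ?expR_ge0//.
  exact: normr_gaussian1_le.
- under [X in _.-integrable _ X]eq_fun do rewrite /= EFinM.
  by apply: integrableZl => //; apply: integrable_gaussian1; rewrite divr_gt0.
Qed.

Section phase.
Variables (a th : R).
Hypothesis a0 : 0 < a.

(** The cosine integral F is found from a differential equation in the frequency, F' = - y / (2 a)
    F, obtained by differentiating under the integral and integrating by parts. The phase th treats
    cosines and sines together and absorbs the remaining coordinates in higher dimension. *)
Let f (y x : R) := expR (- a * x ^+ 2) * cos (y * x + th).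
Let F y := \int[mu1]_x f y x.
Let h (y x : R) := expR (- a * x ^+ 2) * sin (y * x + th).

Let is_derive_lin (c y : R) : is_derive y (1:R) (fun y => y * c + th) c.
Proof.
have := is_deriveD (is_deriveM (is_derive_id y (1 : R)) (is_derive_cst c y (1:R)))
  (is_derive_cst th y (1:R)).
by rewrite scaler0 add0r addr0 [c *: _]mulr1.
Qed.

Let is_derive_gauss (x : R) :
  is_derive x (1:R) (fun x => expR (- a * x ^+ 2)) (- (2 * a) * x * expR (- a * x ^+ 2)).
Proof.
have h1 : is_derive x (1:R) (fun x => - a * x ^+ 2) (- (2 * a) * x).
  have := is_deriveM (is_derive_cst (- a) x (1:R)) (is_deriveX 2 (is_derive_id x (1 : R))).
  rewrite /= scaler0 addr0 => H; apply: is_derive_eq.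
  by rewrite /GRing.scale /=; ring.
have := is_derive1_comp (g := fun x => - a * x ^+ 2) (is_derive_expR (- a * x ^+ 2)) h1.
by move=> H; apply: is_derive_eq; rewrite /GRing.scale /=; ring.
Qed.

Let is_derive_f (x y : R) : is_derive y (1:R) (f ^~ x) (- (x * h y x)).
Proof.
have := is_deriveM (is_derive_cst (expR (- a * x ^+ 2)) y (1:R))
  (is_derive1_comp (g := fun y => y * x + th) (is_derive_cos (y * x + th)) (is_derive_lin x y)).
by move=> H; apply: is_derive_eq; rewrite /h /GRing.scale /=; ring.
Qed.

Let is_derive_h (y x : R) :
  is_derive x (1:R) (h y) (- (2 * a) * (x * h y x) + y * f y x).
Proof.
have H1 : is_derive x (1:R) (fun x => sin (y * x + th)) (y * cos (y * x + th)).
  have := is_derive1_comp (g := fun x => x * y + th) (is_derive_sin (x * y + th)) (is_derive_lin y x).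
  rewrite (_ : sin \o _ = (fun x => sin (y * x + th))); last first.
    by apply/funext => z /=; rewrite mulrC.
  by move=> H; apply: is_derive_eq; rewrite mulrC [x * y]mulrC.
have := is_deriveM (is_derive_gauss x) H1.
by move=> H; apply: is_derive_eq; rewrite /h /f /GRing.scale /=; ring.
Qed.

Let mf y : measurable_fun setT (f y).
Proof.
apply: measurable_funM; first exact: measurable_gaussian1.
apply: (@measurableT_comp _ _ _ _ _ _ (@cos R)).
  by apply: continuous_measurable_fun; exact: continuous_cos.
by apply: measurable_funD => //; exact: measurable_funM.
Qed.

Let mh y : measurable_fun setT (h y).
Proof.
apply: measurable_funM; first exact: measurable_gaussian1.
apply: (@measurableT_comp _ _ _ _ _ _ (@sin R)).
  by apply: continuous_measurable_fun; exact: continuous_sin.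
by apply: measurable_funD => //; exact: measurable_funM.
Qed.

Let normr_h y x : `|h y x| <= expR (- a * x ^+ 2).
Proof.
by rewrite normrM ger0_norm ?expR_ge0// ler_piMr ?expR_ge0// ler_norml sin_geN1 sin_le1.
Qed.

Let normr_f y x : `|f y x| <= expR (- a * x ^+ 2).
Proof.
by rewrite normrM ger0_norm ?expR_ge0// ler_piMr ?expR_ge0// ler_norml cos_geN1 cos_le1.
Qed.

Let intf y : mu1.-integrable setT (EFin \o f y).
Proof.
apply: (le_integrable1 (mf y) (normr_f y)); exact: integrable_gaussian1.
Qed.

Let intxh y : mu1.-integrable setT (EFin \o (fun x => x * h y x)).
Proof.
apply: (@le_integrable1 (fun x => x * h y x) (fun x => `|x| * expR (- a * x ^+ 2))).
- exact: measurable_funM.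
- by move=> x; rewrite normrM ler_wpM2l.
- exact: integrable_normr_gaussian1.
Qed.

Let derive1_h y : derive1 (h y) = (fun x => - (2 * a) * (x * h y x) + y * f y x).
Proof. by apply/funext => x; rewrite derive1E (@derive_val _ _ _ _ _ _ _ (is_derive_h y x)). Qed.

Let cf y : continuous (f y).
Proof.
move=> x; apply: cvgM.
  have : {for x, continuous (fun x : R => expR (- a * x ^+ 2) : R)}; last by [].
  apply/differentiable_continuous/derivable1_diffP.
  exact: (@ex_derive _ _ _ _ _ _ _ (is_derive_gauss x)).
apply: continuous_comp; last exact: continuous_cos.
by apply: cvgD; [apply: cvgM; [exact: cvg_cst|exact: cvg_id]|exact: cvg_cst].
Qed.

Let ch y : continuous (h y).
Proof.
move=> x; apply/differentiable_continuous/derivable1_diffP.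
exact: (@ex_derive _ _ _ _ _ _ _ (is_derive_h y x)).
Qed.

Let h_small y e : 0 < e -> exists M, forall x, M < `|x| -> `|h y x| < e.
Proof.
(* As expR u >= 1 + u, the Gaussian is below e once a x^2 exceeds 1 / e; for |x| > 1 this already
   follows from a |x| > 1 / e. *)
move=> e0; exists (Num.max 1 (a * e)^-1) => x; rewrite gt_max => /andP[x1 xM].
apply: le_lt_trans (normr_h _ _) _.
rewrite mulNr expRN -[ltRHS]invrK ltf_pV2 ?posrE ?expR_gt0 ?invr_gt0//.
apply: lt_le_trans (expR_ge1Dx _); rewrite -[x ^+ 2]ger0_norm ?sqr_ge0// normrX.
apply: (@lt_trans _ _ (a * `|x|)).
  by rewrite -ltr_pdivrMl// -invfM.
apply: (@le_lt_trans _ _ (a * `|x| ^+ 2)); last by rewrite ltrDr.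
by rewrite ler_pM2l// expr2 ler_peMr// ltW.
Qed.

(** The derivative of [h y], which vanishes at both ends, integrates to zero; it is the sum of - 2 a
    times the left-hand integrand and y times the integrand of F. *)
Let by_parts y : \int[mu1]_x (x * h y x) = y / (2 * a) * F y.
Proof.
have i1 : mu1.-integrable setT (EFin \o (fun x => - (2 * a) * (x * h y x))).
  under [X in _.-integrable _ X]eq_fun do rewrite /= EFinM.
  by apply: integrableZl => //; exact: intxh.
have i2 : mu1.-integrable setT (EFin \o (fun x => y * f y x)).
  under [X in _.-integrable _ X]eq_fun do rewrite /= EFinM.
  by apply: integrableZl => //; exact: intf.
have : \int[mu1]_x derive1 (h y) x = 0.
  apply: Rintegral_derive1_eq0.
  - by move=> x; exact: (@ex_derive _ _ _ _ _ _ _ (is_derive_h y x)).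
  - rewrite derive1_h => x; apply: cvgD; apply: cvgM; try exact: cvg_cst; last exact: cf.
    by apply: cvgM; [exact: cvg_id|exact: ch].
  - rewrite derive1_h; have := integrableD measurableT i1 i2.
    by apply: eq_integrable.
  - apply/cvgr0Pnorm_lt => e /(h_small y)[M HM].
    near=> x; apply: HM; rewrite (lt_le_trans _ (ler_norm _))//.
    by near: x; apply: nbhs_pinfty_gt; exact: num_real.
  - apply/cvgr0Pnorm_lt => e /(h_small y)[M HM].
    near=> x; apply: HM; rewrite -normrN (lt_le_trans _ (ler_norm _))// ltrNr.
    by near: x; apply: nbhs_ninfty_lt; exact: num_real.
rewrite derive1_h RintegralD// !RintegralZl//.
rewrite -/(F y) => /eqP; rewrite addr_eq0 => /eqP E.
apply: (@mulfI _ (- (2 * a))); first by rewrite oppr_eq0 mulf_neq0// gt_eqF.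
by rewrite E; field; rewrite gt_eqF.
Unshelve. all: by end_near. Qed.

Let is_derive_F y : is_derive y (1:R) F (- (y / (2 * a)) * F y).
Proof.
(* The majorant |x| expR (- a x^2) is valid for all frequencies at once, so any bounded open
   interval around y serves. *)
have Iy : `](y - 1), (y + 1)[%classic y by rewrite /= in_itv/= ltrBlDr ltrDl ltr01.
have df (z x : R) : derivable (f ^~ x) z 1.
  exact: (@ex_derive _ _ _ _ _ _ _ (is_derive_f x z)).
have d1 z x : partial1of2 f z x = - (x * h z x).
  by rewrite partial1of2E (@derive_val _ _ _ _ _ _ _ (is_derive_f x z)).
have ub z x : `|partial1of2 f z x| <= `|x| * expR (- a * x ^+ 2).
  by rewrite d1 normrN normrM ler_wpM2l.
have g0 (x : R) : 0 <= `|x| * expR (- a * x ^+ 2) by rewrite mulr_ge0// expR_ge0.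
have D1 := @derivable_under_integral R _ _ mu1 f setT measurableT y (y - 1) (y + 1)
  Iy (fun x _ => intf x) (fun z x _ _ => df z x) _ g0 (integrable_normr_gaussian1 a0)
  (fun z x _ _ => ub z x).
have D2 := @differentiation_under_integral R _ _ mu1 f setT measurableT y (y - 1) (y + 1)
  Iy (fun x _ => intf x) (fun z x _ _ => df z x) _ g0 (integrable_normr_gaussian1 a0)
  (fun z x _ _ => ub z x).
apply: DeriveDef; first exact: D1.
rewrite -derive1E; apply: (etrans D2).
under eq_Rintegral do rewrite d1 -mulN1r.
rewrite RintegralZl//.
by rewrite by_parts mulN1r mulNr.
Qed.

(** The integrating factor expR (z^2 / (4 a)) turns F into a function with zero derivative, whose
    value at z = 0 is cos th times the Gaussian integral. *)
Lemma Rintegral_gaussian1_cos y : \int[mu1]_x (expR (- a * x ^+ 2) * cos (y * x + th)) =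
  cos th * Num.sqrt (pi / a) * expR (- y ^+ 2 / (4 * a)).
Proof.
pose G z := F z * expR (z ^+ 2 / (4 * a)).
have dG z : is_derive z (1:R) G 0.
  have h1 : is_derive z (1:R) (fun z => (4 * a)^-1 * z ^+ 2) (z / (2 * a)).
    have := is_deriveM (is_derive_cst (4 * a)^-1 z (1:R))
      (is_deriveX 2 (is_derive_id z (1 : R))).
    rewrite /= scaler0 addr0 => H; apply: is_derive_eq.
    by rewrite /GRing.scale /=; field; rewrite gt_eqF.
  have h2 := is_derive1_comp (g := fun z => (4 * a)^-1 * z ^+ 2)
    (is_derive_expR ((4 * a)^-1 * z ^+ 2)) h1.
  have := is_deriveM (is_derive_F z) h2.
  rewrite (_ : F * _ = G); last first.
    by apply/funext => w; rewrite /G [w ^+ 2 / _]mulrC.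
  move=> H; apply: is_derive_eq.
  by rewrite /GRing.scale /=; ring.
have := is_derive_0_is_cst y 0 dG.
rewrite /G expr0n/= mul0r expR0 mulr1.
have -> : F 0 = cos th * Num.sqrt (pi / a).
  rewrite /F /f; under eq_Rintegral do rewrite mul0r add0r.
  rewrite RintegralZr//; last exact: integrable_gaussian1.
  rewrite mulrC; congr (_ * _); rewrite /Rintegral.
  have := integral_gaussian1 0 a0.
  by under [in X in X -> _]eq_integral do rewrite subr0; move=> ->.
rewrite -/(F y) => <-.
by rewrite -mulrA -expRD mulNr subrr expR0 mulr1.
Qed.

End phase.


Lemma Rintegral_gaussian_cos n (a th : R) (y : 'rV[R]_n) : 0 < a ->
  \int[leb n]_x (gaussian a x * cos (dotp y x + th)) =
  cos th * Num.sqrt (pi / a) ^+ n * gaussian (4 * a)^-1 y.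
Proof.
move=> a0.
have mx : forall n, measurable_fun setT (@id 'rV[R]_n) by [].
have mf m (z : 'rV[R]_m) t : measurable_fun setT (fun x => gaussian a x * cos (dotp z x + t)).
  apply: measurable_funM; first exact: measurable_gaussian.
  apply: (@measurableT_comp _ _ _ _ _ _ (@cos R)).
    by apply: continuous_measurable_fun; exact: continuous_cos.
  by apply: measurable_funD => //; exact: measurable_fun_dotp.
have fi m (z : 'rV[R]_m) t : (leb m).-integrable setT
    (EFin \o (fun x => gaussian a x * cos (dotp z x + t))).
  apply: (@le_integrableR _ _ _ (leb m) (fun x => gaussian a x * cos (dotp z x + t)) (fun x => gaussian a (x - 0))).
  - exact: mf.
  - move=> x; rewrite subr0 normrM ger0_norm ?gaussian_ge0// ler_piMr ?gaussian_ge0//.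
    by rewrite ler_norml cos_geN1 cos_le1.
  - exact: integrable_gaussian.
(* The phase is generalized in the induction: integrating out the last coordinates at fixed first
   coordinate x adds p.1 * x to it. *)
elim: n y th => [|n IH] y th.
  rewrite /Rintegral /= integral_dirac//=; last by apply/measurable_EFinP; exact: mf.
  by rewrite indicT mul1r /gaussian /dotp !big_ord0 !mulr0 expR0 add0r mul1r !mulr1.
rewrite -(rV_unconsK y); set p := rV_uncons y.
rewrite {1}/Rintegral integral_rV_cons; last exact: fi.
under eq_integral => x _.
  have -> : (\int[leb n]_v (gaussian a (rV_cons (x, v)) *
      cos (dotp (rV_cons p) (rV_cons (x, v)) + th))%:E)%E =
    ((Num.sqrt (pi / a) ^+ n * gaussian (4 * a)^-1 p.2) *
      (expR (- a * x ^+ 2) * cos (p.1 * x + th)))%:E.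
    have E v : gaussian a (rV_cons (x, v)) * cos (dotp (rV_cons p) (rV_cons (x, v)) + th) =
        expR (- a * x ^+ 2) * (gaussian a v * cos (dotp p.2 v + (p.1 * x + th))).
      rewrite /gaussian !dotp_rV_cons/= mulrDr expRD expr2 -!mulrA.
      by congr (_ * (_ * cos _)); ring.
    under eq_integral do rewrite E.
    have := RintegralZl (mu := leb n) (expR (- a * x ^+ 2)) measurableT (fi n p.2 (p.1 * x + th)).
    rewrite IH => H.
    have E2 : Num.sqrt (pi / a) ^+ n * gaussian (4 * a)^-1 p.2 *
        (expR (- a * x ^+ 2) * cos (p.1 * x + th)) =
        expR (- a * x ^+ 2) * (cos (p.1 * x + th) * Num.sqrt (pi / a) ^+ n *
        gaussian (4 * a)^-1 p.2) by ring.
    rewrite E2 -H /Rintegral fineK//; apply: integrable_fin_num => //.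
    under [X in _.-integrable _ X]eq_fun do rewrite /= EFinM.
    by apply: integrableZl => //; exact: fi.
  over.
rewrite -[LHS]/(\int[mu1]_x ((Num.sqrt (pi / a) ^+ n * gaussian (4 * a)^-1 p.2) *
      (expR (- a * x ^+ 2) * cos (p.1 * x + th)))).
rewrite RintegralZl//; last first.
  apply: (@le_integrable1 _ (fun x => expR (- a * x ^+ 2))).
  - apply: measurable_funM; first exact: measurable_gaussian1.
    apply: (@measurableT_comp _ _ _ _ _ _ (@cos R)).
      by apply: continuous_measurable_fun; exact: continuous_cos.
    by apply: measurable_funD => //; exact: measurable_funM.
  - move=> x; rewrite normrM ger0_norm ?expR_ge0// ler_piMr ?expR_ge0//.
    by rewrite ler_norml cos_geN1 cos_le1.
  - exact: integrable_gaussian1.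
rewrite Rintegral_gaussian1_cos// /gaussian dotp_rV_cons mulrDr expRD (exprS (Num.sqrt _)).
have -> : - (4 * a)^-1 * (p.1 * p.1) = - p.1 ^+ 2 / (4 * a) by rewrite expr2; ring.
ring.
Qed.

End fourier_gaussian.

(** * Recovering a function from its Gaussian regularizations *)

Section weak_convergence.
Context d (T : measurableType d) (R : realType).
Variable mu : {measure set T -> \bar R}.

Lemma cvg_Rintegral_bigcup (f : T -> R) (F : (set T)^nat) :
  mu.-integrable setT (EFin \o f) -> (forall n, measurable (F n)) ->
  \int[mu]_(x in \bigcup_(k < n) F k) f x @[n --> \oo] -->
  \int[mu]_(x in \bigcup_k F k) f x.
Proof.
move=> fi mF; have mf : measurable_fun setT f.
  by apply/measurable_EFinP; exact: measurable_int fi.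
have mU : measurable (\bigcup_k F k) by exact: bigcup_measurable.
have mUn n : measurable (\bigcup_(k < n) F k) by exact: bigcup_measurable.
rewrite Rintegral_mkcond.
rewrite (_ : (fun n => _) = (fun n => \int[mu]_x (f \_ (\bigcup_(k < n) F k)) x)); last first.
  by apply/funext => n; rewrite Rintegral_mkcond.
apply: (@dominated_cvg_Rintegral _ _ _ mu _ _ (fun x => `|f x|)).
- move=> n; apply/(measurable_restrictT _ (mUn n)).1; exact: measurable_funS mf.
- apply/(measurable_restrictT _ mU).1; exact: measurable_funS mf.
- apply: aeW => x; have [[k _ Fkx]|nFx] := pselect ((\bigcup_k F k) x).
    apply: cvg_near_cst; exists k.+1 => // n /= kn.
    by rewrite !patchE !mem_set//; [exists k|exists k].
  apply: cvg_near_cst; apply: nearW => n.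
  rewrite !patchE !memNset// => -[k _ Fkx]; apply: nFx; exists k => //.
- by have := integrable_abse fi; apply: eq_integrable.
- by move=> n x; rewrite patchE; case: ifPn => // _; rewrite normr0.
Qed.

Variables (g_ : nat -> T -> R) (g w : T -> R) (D B : R) (G : set (set T)).
Hypothesis ig_ : forall j, mu.-integrable setT (EFin \o g_ j).
Hypothesis ig : mu.-integrable setT (EFin \o g).
Hypothesis iw : mu.-integrable setT (EFin \o w).
Hypothesis D0 : 0 <= D.
Hypothesis B0 : 0 <= B.
Hypothesis w0 : forall x, 0 <= w x.
Hypothesis g_le : forall j A tau, measurable A -> 0 < tau ->
  `|\int[mu]_(x in A) g_ j x| <= tau * D + tau^-1 * (B * \int[mu]_(x in A) w x).
Hypothesis GE : @measurable _ T = <<s G >>.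
Hypothesis GI : setI_closed G.
Hypothesis GT : G setT.
Hypothesis Gcvg : forall A, G A ->
  \int[mu]_(x in A) g_ j x @[j --> \oo] --> \int[mu]_(x in A) g x.

Let integral_setD A f : measurable A -> mu.-integrable setT (EFin \o f) ->
  \int[mu]_(x in ~` A) f x = \int[mu]_x f x - \int[mu]_(x in A) f x.
Proof.
move=> mA fi; apply/eqP; rewrite eq_sym subr_eq addrC; apply/eqP.
rewrite -Rintegral_setU//; first by rewrite setUv.
- exact: measurableC.
- by rewrite setUv.
- by rewrite disj_set2E setICr.
Qed.

(* The set functions A |-> int_A g_ j are uniformly absolutely continuous with
   respect to w by [g_le], so convergence extends from the pi-system G to the
   sigma-algebra it generates. *)
Lemma cvg_set_Rintegral A : measurable A ->
  \int[mu]_(x in A) g_ j x @[j --> \oo] --> \int[mu]_(x in A) g x.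
Proof.
move=> mA; have : <<s G >> A by rewrite -GE.
apply: (dynkin_induction (P := fun A =>
  \int[mu]_(x in A) g_ j x @[j --> \oo] --> \int[mu]_(x in A) g x)) => //.
- exact: Gcvg.
- move=> S mS cS; rewrite integral_setD//.
  rewrite (_ : (fun j => _) = (fun j => \int[mu]_x g_ j x - \int[mu]_(x in S) g_ j x)); last first.
    by apply/funext => j; exact: integral_setD.
  by apply: cvgB => //; exact: Gcvg.
- move=> F mF tF cF; set U := \bigcup_k F k.
  have mU : measurable U by exact: bigcup_measurable.
  pose V n := \bigcup_(k < n) F k.
  have mV n : measurable (V n) by exact: bigcup_measurable.
  have VU n : V n `<=` U by move=> x [k _ Fx]; exists k.
  have splitU n f : mu.-integrable setT (EFin \o f) ->
      \int[mu]_(x in U) f x = \int[mu]_(x in V n) f x + \int[mu]_(x in U `\` V n) f x.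
    move=> fi; rewrite -Rintegral_setU//.
    - by rewrite setDUK.
    - exact: measurableD.
    - by apply: integrableS fi => //; apply: measurableU => //; exact: measurableD.
    - by rewrite disj_set2E setDIK.
  have cV n : \int[mu]_(x in V n) g_ j x @[j --> \oo] --> \int[mu]_(x in V n) g x.
    elim: n => [|n IH].
      rewrite /V bigcup_mkord big_ord0 Rintegral_set0.
      by under eq_fun do rewrite Rintegral_set0; exact: cvg_cst.
    have VS f : mu.-integrable setT (EFin \o f) ->
        \int[mu]_(x in V n.+1) f x = \int[mu]_(x in V n) f x + \int[mu]_(x in F n) f x.
      move=> fi; rewrite /V !bigcup_mkord big_ord_recr/= -bigcup_mkord Rintegral_setU//.
      - exact: mV.
      - apply: integrableS fi => //; apply: measurableU => //; exact: mV.
      - rewrite disj_set2E; apply/eqP/seteqP; split => // x [[k /= kn Fkx] Fnx].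
        have /trivIsetP/(_ k n I I) := tF; rewrite ltn_eqF// => /(_ isT)/seteqP[+ _].
        by move=> /(_ x); apply.
    rewrite VS// (_ : (fun j => _) = (fun j => \int[mu]_(x in V n) g_ j x +
      \int[mu]_(x in F n) g_ j x)); last by apply/funext => j; exact: VS.
    by apply: cvgD.
  have w_tail : \int[mu]_(x in U `\` V n) w x @[n --> \oo] --> (0 : R).
    rewrite (_ : (fun n => _) = (fun n => \int[mu]_(x in U) w x - \int[mu]_(x in V n) w x)).
      rewrite -(subrr (\int[mu]_(x in U) w x)); apply: cvgB; first exact: cvg_cst.
      exact: cvg_Rintegral_bigcup.
    by apply/funext => n; rewrite (splitU n)// addrAC subrr add0r.
  have g_tail : \int[mu]_(x in U `\` V n) g x @[n --> \oo] --> (0 : R).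
    rewrite (_ : (fun n => _) = (fun n => \int[mu]_(x in U) g x - \int[mu]_(x in V n) g x)).
      rewrite -(subrr (\int[mu]_(x in U) g x)); apply: cvgB; first exact: cvg_cst.
      exact: cvg_Rintegral_bigcup.
    by apply/funext => n; rewrite (splitU n)// addrAC subrr add0r.
  apply/cvgrPdist_le => e e0.
  (* The order of choices matters: tau makes tau * D at most e / 4, then n makes the w-mass of the
     tail small enough for the term in tau^-1, uniformly in j, and only then j is taken large on V
     n. The summands 1 in D + 1 and B + 1 guard against vanishing constants. *)
  pose tau := e / (4 * (D + 1)).
  have D1 : 0 < D + 1 by rewrite ltr_wpDl.
  have tau0 : 0 < tau by rewrite divr_gt0// mulr_gt0.
  have B1 : 0 < B + 1 by rewrite ltr_wpDl.
  pose dl := tau * (e / 4) / (B + 1).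
  have dl0 : 0 < dl by rewrite divr_gt0// mulr_gt0// divr_gt0.
  have e4 : 0 < e / 4 by rewrite divr_gt0.
  near \oo => n.
  have wn : `|\int[mu]_(x in U `\` V n) w x| <= dl.
    by near: n; move/cvgr0Pnorm_le : w_tail; apply.
  have gn : `|\int[mu]_(x in U `\` V n) g x| <= e / 4.
    by near: n; move/cvgr0Pnorm_le : g_tail; apply.
  have gjn j : `|\int[mu]_(x in U `\` V n) g_ j x| <= e / 2.
    apply: le_trans (g_le j _ tau0) _; first exact: measurableD.
    have h1 : tau * D <= e / 4.
      rewrite /tau -mulrA ler_pM2l//; rewrite ler_pdivrMl ?mulr_gt0//.
      by rewrite mulrAC mulfV// mul1r lerDl.
    have h2 : tau^-1 * (B * \int[mu]_(x in U `\` V n) w x) <= e / 4.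
      rewrite ler_pdivrMl//.
      apply: (@le_trans _ _ ((B + 1) * dl)); last first.
        by rewrite /dl mulrC divfK// gt_eqF.
      apply: (@le_trans _ _ (B * dl)).
        by rewrite ler_wpM2l// (le_trans (ler_norm _)).
      by rewrite ler_wpM2r// ?ltW// ltrDl.
    by apply: le_trans (lerD h1 h2) _; lra.
  near=> j.
  rewrite (splitU n g)// (splitU n (g_ j))//.
  have h3 : `|\int[mu]_(x in V n) g x - \int[mu]_(x in V n) g_ j x| <= e / 4.
    by near: j; move/cvgrPdist_le : (cV n); apply.
  rewrite opprD addrACA (le_trans (ler_normD _ _))//.
  have h4 := ler_normB (\int[mu]_(x in U `\` V n) g x) (\int[mu]_(x in U `\` V n) g_ j x).
  have := gjn j; lra.
Unshelve. all: by end_near. Qed.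

Lemma weak_limit_le A tau : measurable A -> 0 < tau ->
  `|\int[mu]_(x in A) g x| <= tau * D + tau^-1 * (B * \int[mu]_(x in A) w x).
Proof.
move=> mA t0; have c : `|\int[mu]_(x in A) g_ j x| @[j --> \oo] --> `|\int[mu]_(x in A) g x|.
  by apply: cvg_norm; exact: cvg_set_Rintegral.
rewrite -(cvg_lim _ c)//; apply: limr_le; first exact: cvgP c.
by apply: nearW => j; exact: g_le.
Qed.

End weak_convergence.

(** * Open orthants as a pi-system generating the Borel sets *)

Section rays.
Context {R : realType} (n : nat).
Local Notation leb := (@lebesgue_rV R).

(** The bounds are extended reals: the value -oo leaves a coordinate free, so half-spaces and the
    whole space belong to a family that is still closed under intersection. *)
Definition ray (c : 'I_n -> \bar R) := [set x : 'rV[R]_n | forall i, (c i < (x ord0 i)%:E)%E].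

Lemma measurable_ray c : measurable (ray c).
Proof.
rewrite (_ : ray c = \bigcap_(i in [set: 'I_n]) [set x | (c i < (x ord0 i)%:E)%E]); last first.
  by apply/seteqP; split => [x h i _|x h i]; apply: h.
apply: fin_bigcap_measurable => // i _.
have m : measurable_fun [set: 'rV[R]_n] (fun x : 'rV[R]_n => (x ord0 i)%:E).
  by apply/measurable_EFinP; exact: measurable_coord.
have := m measurableT `]c i, +oo[%classic (emeasurable_itv _).
rewrite setTI; congr measurable; apply/seteqP; split => x /=; by rewrite in_itv/= andbT.
Qed.

Lemma setI_closed_ray : setI_closed (range ray).
Proof.
move=> _ _ [c _ <-] [c' _ <-]; exists (fun i => maxe (c i) (c' i)) => //.
apply/seteqP; split => x /=.
  by move=> h; split => i; have := h i; rewrite gt_max => /andP[].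
by move=> [h1 h2] i; rewrite gt_max h1 h2.
Qed.

(** Open right half-lines generate the Borel sets of the line, and the preimage of such a half-line
    under a coordinate is a ray with a single finite bound. *)
Lemma measurable_rVE : @measurable _ 'rV[R]_n = <<s range ray >>.
Proof.
apply/seteqP; split; last first.
  apply: smallest_sub; first exact: sigma_algebra_measurable.
  by move=> _ [c _ <-]; exact: measurable_ray.
apply: smallest_sub; first exact: smallest_sigma_algebra.
move=> A; rewrite -bigcup_seq /= => -[i _ [C mC <-]]; rewrite setTI.
have E : @measurable _ R = <<s @RGenOInfty.G R >> := RGenOInfty.measurableE R.
have : <<s @RGenOInfty.G R >> C by rewrite -E.
suff : <<s @RGenOInfty.G R >> `<=`
    [set C | <<s range ray >> ((fun x : 'rV[R]_n => x ord0 i) @^-1` C)] by apply.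
apply: smallest_sub.
  split=> [|X mX|F mF] /=.
  - by rewrite preimage_set0; exact: sigma_algebra0.
  - by rewrite setTD -preimage_setC -setTD; exact: sigma_algebraCD.
  - by rewrite preimage_bigcup; apply: sigma_algebra_bigcup => k; exact: mF.
move=> _ [r ->]; apply: sub_sigma_algebra.
exists (fun j => if j == i then r%:E else -oo%E) => //.
apply/seteqP; split => x /=; rewrite in_itv/= andbT.
  by move=> /(_ i); rewrite eqxx lte_fin.
by move=> h j; case: eqP => [->|_]; rewrite ?lte_fin// ltNyr.
Qed.

Lemma ray_setT : ray (fun=> -oo%E) = setT.
Proof. by apply/seteqP; split => // x _ i; rewrite ltNyr. Qed.

Lemma ae_ray_boundary (c : 'I_n -> \bar R) :
  {ae leb n, forall x : 'rV[R]_n, forall i, c i != (x ord0 i)%:E}.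
Proof.
apply: filter_forall => i.
(* For an infinite bound [fine] gives the default 0; the exceptional set is then empty, and this
   null hyperplane covers it trivially. *)
exists [set x : 'rV[R]_n | x ord0 i = fine (c i)]; split.
- exact: measurable_hyperplane.
- exact: hyperplane_null.
- by move=> x /= /negP; rewrite negbK => /eqP ->.
Qed.

(** Off the boundary hyperplanes, a change of the indicator forces some coordinate to move by at
    least its distance to a finite bound, so a suitable multiple of the squared distance exceeds 1.
    The modulus is quadratic because second moments of Gaussians are what the regularization can
    integrate. *)
Lemma indic_ray_dist (c : 'I_n -> \bar R) (y : 'rV[R]_n) :
  (forall i, c i != (y ord0 i)%:E) ->
  exists C, forall x, `|\1_(ray c) x - \1_(ray c) y| <= C * dotp (x - y) (x - y) :> R.
Proof.
move=> cy.
have Ci i : exists C : R, 0 <= C /\ forall x : 'rV[R]_n,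
    ((c i < (x ord0 i)%:E)%E = (c i < (y ord0 i)%:E)%E) \/
    1 <= C * (x ord0 i - y ord0 i) ^+ 2.
  have := cy i; case: (c i) => [r||] ri.
  - have ry : r - y ord0 i != 0 by rewrite subr_eq0; apply: contra ri => /eqP ->.
    exists ((r - y ord0 i) ^+ 2)^-1; split; first by rewrite invr_ge0 sqr_ge0.
    move=> x; rewrite !lte_fin.
    have : 0 < (r - y ord0 i) ^+ 2 by rewrite exprn_even_gt0.
    move=> h; case: (ltP r (x ord0 i)) => h1; case: (ltP r (y ord0 i)) => h2; try by left.
    + by right; rewrite ler_pdivlMl// mulr1; nra.
    + by right; rewrite ler_pdivlMl// mulr1; nra.
  - by exists 0; split => // x; left.
  - by exists 0; split => // x; left; rewrite !ltNyr.
have {Ci} [C /all_and2 [C0 HC]] := choice Ci.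
exists (\sum_i C i) => x.
have dge i : (x ord0 i - y ord0 i) ^+ 2 <= dotp (x - y) (x - y).
  rewrite /dotp (bigD1 i)//= !mxE expr2 lerDl.
  by apply: sumr_ge0 => j _; rewrite -expr2 sqr_ge0.
have d0 : 0 <= dotp (x - y) (x - y) by apply: sumr_ge0 => j _; rewrite -expr2 sqr_ge0.
have C00 : 0 <= \sum_i C i by apply: sumr_ge0.
have [E|] := pselect (forall i, (c i < (x ord0 i)%:E)%E = (c i < (y ord0 i)%:E)%E).
  rewrite !indicE (_ : (x \in ray c) = (y \in ray c)); first by rewrite subrr normr0 mulr_ge0.
  by apply/idP/idP; rewrite !inE => h i; [rewrite -E|rewrite E]; exact: h.
move=> /existsNP[i Ei].
have [//|h1] := HC i x.
apply: (@le_trans _ _ 1).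
  by rewrite !indicE; case: (_ \in _); case: (_ \in _); rewrite ?subrr ?subr0 ?sub0r ?normrN ?normr0 ?normr1.
apply: le_trans h1 _; apply: ler_pM => //; first by rewrite sqr_ge0.
by rewrite (bigD1 i)//= lerDl sumr_ge0.
Qed.

End rays.

(** * Fubini's theorem for kernels dominated by a product p x * q y *)

Section tensor_fubini.
Context d1 d2 (T1 : measurableType d1) (T2 : measurableType d2) (R : realType).
Variables (m1 : {sigma_finite_measure set T1 -> \bar R}).
Variables (m2 : {sigma_finite_measure set T2 -> \bar R}).
Variables (f : T1 * T2 -> R) (p : T1 -> R) (q : T2 -> R).
Hypothesis mf : measurable_fun setT f.
Hypothesis ip : m1.-integrable setT (EFin \o p).
Hypothesis iq : m2.-integrable setT (EFin \o q).
Hypothesis p0 : forall x, 0 <= p x.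
Hypothesis q0 : forall y, 0 <= q y.
Hypothesis fpq : forall x y, `|f (x, y)| <= p x * q y.

Lemma tensor_integrable1 x : m2.-integrable setT (fun y => (f (x, y))%:E).
Proof.
apply: (@le_integrableR _ _ _ m2 (fun y => f (x, y)) (fun y => p x * q y)) => //.
- exact: measurableT_comp.
- under [X in _.-integrable _ X]eq_fun do rewrite /= EFinM.
  by apply: integrableZl.
Qed.

Lemma tensor_integrable2 y : m1.-integrable setT (fun x => (f (x, y))%:E).
Proof.
apply: (@le_integrableR _ _ _ m1 (fun x => f (x, y)) (fun x => p x * q y)) => //.
- exact: measurableT_comp.
- under [X in _.-integrable _ X]eq_fun do rewrite /= EFinM.
  by apply: integrableZr.
Qed.

Let mp : measurable_fun setT p.
Proof. by apply/measurable_EFinP; exact: measurable_int ip. Qed.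

Let mq : measurable_fun setT q.
Proof. by apply/measurable_EFinP; exact: measurable_int iq. Qed.

Let if_ : (m1 \x m2)%E.-integrable setT (EFin \o f).
Proof.
have mpq : measurable_fun setT (fun z : T1 * T2 => p z.1 * q z.2).
  by apply: measurable_funM; exact: measurableT_comp.
apply: (@le_integrableR _ _ _ (m1 \x m2)%E f (fun z => p z.1 * q z.2)) => //.
  by move=> [x y]; exact: fpq.
apply/integrable12ltyP; first exact/measurable_EFinP.
have inner x : (\int[m2]_y `|(p x * q y)%:E| = (p x)%:E * \int[m2]_y (q y)%:E)%E.
  under eq_integral => y _ do rewrite gee0_abs ?lee_fin ?mulr_ge0//= EFinM.
  rewrite ge0_integralZl//.
  - exact/measurable_EFinP.
  - by move=> y _; rewrite lee_fin.
  - by rewrite lee_fin.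
under eq_integral do rewrite inner.
have q00 : (0 <= \int[m2]_y (q y)%:E)%E by apply: integral_ge0 => y _; rewrite lee_fin.
rewrite ge0_integralZr//; first last.
- by move=> y _; rewrite lee_fin.
- exact/measurable_EFinP.
have := integrable_fin_num measurableT ip; have := integrable_fin_num measurableT iq.
by move=> a b; rewrite lte_mul_pinfty// ?ltey_eq ?a// integral_ge0// => x _; rewrite lee_fin.
Qed.

Let F1E x : (\int[m2]_y (f (x, y))%:E = (\int[m2]_y f (x, y))%:E)%E.
Proof. by rewrite fineK//; exact: integrable_fin_num (tensor_integrable1 x). Qed.

Let F2E y : (\int[m1]_x (f (x, y))%:E = (\int[m1]_x f (x, y))%:E)%E.
Proof. by rewrite fineK//; exact: integrable_fin_num (tensor_integrable2 y). Qed.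

Lemma tensor_integrable_F : m1.-integrable setT (fun x => (\int[m2]_y f (x, y))%:E).
Proof.
have := integrable_fubini_F if_; apply: eq_integrable => // x _.
exact: F1E.
Qed.

Lemma tensor_integrable_G : m2.-integrable setT (fun y => (\int[m1]_x f (x, y))%:E).
Proof.
apply: (@le_integrableR _ _ _ m2 (fun y => \int[m1]_x f (x, y))
  (fun y => \int[m1]_x p x * q y)).
- apply/measurable_EFinP; have := measurable_fubini_G if_.
  by apply: eq_measurable_fun => y _; exact: F2E.
- move=> y; rewrite (le_trans (le_normr_Rintegral measurableT (tensor_integrable2 y)))//.
  rewrite -RintegralZr//; apply: le_Rintegral => //.
  + by have := integrable_abse (tensor_integrable2 y); apply: eq_integrable.
  + under [X in _.-integrable _ X]eq_fun do rewrite /= EFinM.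
    by apply: integrableZr.
- under [X in _.-integrable _ X]eq_fun do rewrite /= EFinM.
  by apply: integrableZl.
Qed.

Lemma tensor_fubini :
  \int[m1]_x \int[m2]_y f (x, y) = \int[m2]_y \int[m1]_x f (x, y).
Proof.
have := Fubini if_; rewrite /comp => E.
rewrite [LHS]/Rintegral [RHS]/Rintegral; congr fine.
under eq_integral do rewrite -F1E.
by rewrite E; apply: eq_integral => y _; rewrite F2E.
Qed.

End tensor_fubini.

(** * Gaussian approximate identity *)

Section gaussian_regularization.
Context {R : realType} (n : nat).
Local Notation leb := (@lebesgue_rV R).
Implicit Types (x y : 'rV[R]_n) (a : R) (psi W : 'rV[R]_n -> R).

(** The factor that turns [gaussian a] into a probability density. *)
Definition peak a := Num.sqrt (a / pi) ^+ n.

Lemma peak_ge0 a : 0 <= peak a.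
Proof. by rewrite exprn_ge0// sqrtr_ge0. Qed.

Lemma peak_mul1 a : 0 < a -> peak a * Num.sqrt (pi / a) ^+ n = 1.
Proof.
move=> a0; rewrite /peak -exprMn -sqrtrM ?divr_ge0 ?pi_ge0 ?ltW//.
rewrite (_ : a / pi * _ = 1) ?sqrtr1 ?expr1n//.
have pn0 : pi != 0 :> R by rewrite gt_eqF// pi_gt0.
have an0 : a != 0 by rewrite gt_eqF.
by rewrite mulrA divfK// mulfV.
Qed.

(** Halving the exponent of a normalized Gaussian multiplies its mass by 2^(n/2), whatever a is; the
    bounds on regularizations are uniform in a for this reason. *)
Lemma peak_mul2 a : 0 < a -> peak a * Num.sqrt (pi / (a / 2)) ^+ n = Num.sqrt 2 ^+ n.
Proof.
move=> a0; rewrite /peak -exprMn -sqrtrM ?divr_ge0 ?pi_ge0 ?ltW//.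
rewrite (_ : a / pi * _ = 2)//.
have pn0 : pi != 0 :> R by rewrite gt_eqF// pi_gt0.
have an0 : a != 0 by rewrite gt_eqF.
by rewrite mulrA divfK// invf_div mulrCA mulfV// mulr1.
Qed.

Lemma dotp_ge0 x : 0 <= dotp x x.
Proof. by apply: sumr_ge0 => i _; rewrite -expr2 sqr_ge0. Qed.

(** Cauchy-Schwarz: the polynomial u^2 (x . x) - 2 u (x . y) + y . y is nonnegative, in particular
    at its minimizer. When x . x = 0 it is affine in u, and a suitable u contradicts nonnegativity
    unless x . y = 0. *)
Lemma dotp_sqr_le x y : dotp x y ^+ 2 <= dotp x x * dotp y y.
Proof.
have CS u : 2 * u * dotp x y <= u ^+ 2 * dotp x x + dotp y y.
  rewrite /dotp !mulr_sumr -big_split/=; apply: ler_sum => i _.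
  by set p := x _ _; set q := y _ _; have := sqr_ge0 (u * p - q); nra.
have := dotp_ge0 x; have := dotp_ge0 y; move: CS.
move: (dotp x x) (dotp y y) (dotp x y) => X Y b CS Y0.
rewrite le_eqVlt => /predU1P[X0|X0]; last first.
  have := CS (b / X).
  rewrite -subr_ge0 => h; rewrite -subr_ge0.
  have -> : X * Y - b ^+ 2 = X * ((b / X) ^+ 2 * X + Y - 2 * (b / X) * b).
    by field; rewrite gt_eqF.
  by rewrite mulr_ge0// ltW.
rewrite -X0 mul0r; have [->|b0] := eqVneq b 0; first by rewrite expr0n.
have := CS ((Y + 1) / b); rewrite -X0 mulr0 add0r -mulrA divfK//.
by move=> h; exfalso; lra.
Qed.

Lemma gaussian_le1 a x : 0 <= a -> gaussian a x <= 1.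
Proof. by move=> a0; rewrite /gaussian -expR0 ler_expR mulNr oppr_le0 mulr_ge0// dotp_ge0. Qed.

Lemma gaussianBC a x y : gaussian a (x - y) = gaussian a (y - x).
Proof.
rewrite /gaussian; congr (expR (_ * _)); apply: eq_bigr => i _.
by rewrite !mxE; ring.
Qed.

Lemma dotp_splitl x y : dotp y y / 2 <= dotp x x + dotp (x - y) (x - y).
Proof.
rewrite /dotp mulr_suml -big_split/=; apply: ler_sum => i _; rewrite !mxE.
set u := x _ _; set v := y _ _; have := sqr_ge0 (2 * u - v); nra.
Qed.

Lemma dotp_splitr x y :
  dotp y y / 2 + dotp x x / 4 <= dotp x x + 2 * dotp (x - y) (x - y).
Proof.
rewrite /dotp !mulr_suml mulr_sumr -!big_split/=; apply: ler_sum => i _; rewrite !mxE.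
(* Coordinatewise, the difference of the two sides is (11 u - 8 v)^2 / 44 + v^2 / 22. *)
set u := x _ _; set v := y _ _; have := sqr_ge0 (11 * u - 8 * v); nra.
Qed.

(** Half of the exponent of the kernel moves the weight from x to y, where 2^-1 is left of it; the
    other half remains a kernel that can be integrated in x against [peak] uniformly in a. *)
Lemma gaussian_split1 a x y : 2 <= a ->
  gaussian 1 x * gaussian a (x - y) <= gaussian 2^-1 y * gaussian (a / 2) (x - y).
Proof.
move=> a2; rewrite /gaussian -!expRD ler_expR.
have := dotp_splitl x y; have := dotp_ge0 (x - y).
by move: (dotp (x - y) (x - y)) (dotp x x) (dotp y y) => u v w; nra.
Qed.

(** Here the kernel is used up entirely, and the majorant is a product of a function of x and a
    function of y that is free of a: the form required to exchange integrals. *)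
Lemma gaussian_split2 a x y : 2 <= a ->
  gaussian 1 x * gaussian a (x - y) <= gaussian 4^-1 x * gaussian 2^-1 y.
Proof.
move=> a2; rewrite /gaussian -!expRD ler_expR.
have := dotp_splitr x y; have := dotp_ge0 (x - y).
by move: (dotp (x - y) (x - y)) (dotp x x) (dotp y y) => u v w; nra.
Qed.

(** The inequality v <= expR v at v = (a / 2) (x . x) trades the quadratic factor for half of the
    exponent, with a gain 2 / a that makes second moments vanish as a grows. *)
Lemma dotp_gaussian_le a x : 0 < a ->
  dotp x x * gaussian a x <= 2 / a * gaussian (a / 2) x.
Proof.
move=> a0; have -> : gaussian a x = gaussian (a / 2) x * gaussian (a / 2) x.
  by rewrite /gaussian -expRD; congr expR; field.
rewrite mulrA ler_wpM2r ?gaussian_ge0// /gaussian mulNr expRN.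
rewrite ler_pdivrMr ?expR_gt0// mulrC -ler_pdivrMr; last first.
  by rewrite divr_gt0.
apply: le_trans (expR_ge1Dx _); rewrite invf_div mulrC.
by rewrite ler_wpDl.
Qed.

Lemma integrable_bounded_gaussian psi M a m : 0 < a ->
  measurable_fun setT psi -> (forall x, `|psi x| <= M) ->
  (leb n).-integrable setT (EFin \o (fun x => psi x * gaussian a (x - m))).
Proof.
move=> a0 mpsi bpsi.
apply: (@le_integrableR _ _ _ (leb n) (fun x => psi x * gaussian a (x - m)) (fun x => M * gaussian a (x - m))).
- by apply: measurable_funM => //; exact: measurable_gaussianB.
- by move=> x; rewrite normrM (ger0_norm (gaussian_ge0 _ _)) ler_wpM2r// gaussian_ge0.
- under [X in _.-integrable _ X]eq_fun do rewrite /= EFinM.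
  by apply: integrableZl => //; exact: integrable_gaussian.
Qed.

Definition regularize a psi y := peak a * \int[leb n]_x (psi x * gaussian a (x - y)).

(** A normalized Gaussian has second moment of order 1 / a, so the modulus eta + C |x - y|^2 leaves
    an error eta + O(1 / a). Allowing an arbitrary eta makes this quadratic modulus available for
    merely continuous behaviour at y. *)
Lemma cvg_regularize psi y :
  measurable_fun setT psi -> (forall x, `|psi x| <= 1) ->
  (forall eta, 0 < eta -> exists2 C, 0 <= C &
     forall x, `|psi x - psi y| <= eta + C * dotp (x - y) (x - y)) ->
  regularize (j%:R + 4) psi y @[j --> \oo] --> psi y.
Proof.
move=> mpsi bpsi modpsi; apply/cvgrPdist_le => e e0.
have e2 : 0 < e / 2 by rewrite divr_gt0.
have [C C0 HC] := modpsi _ e2.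
pose S := Num.sqrt 2 ^+ n : R.
near=> j.
pose a : R := j%:R + 4.
have a0 : 0 < a by rewrite ltr_wpDl.
have ig b : 0 < b -> (leb n).-integrable setT (fun x => (gaussian b (x - y))%:E).
  by move=> b0; exact: integrable_gaussian.
have i1 : (leb n).-integrable setT (EFin \o (fun x => psi x * gaussian a (x - y))).
  exact: integrable_bounded_gaussian bpsi.
have i2 : (leb n).-integrable setT (EFin \o (fun x => psi y * gaussian a (x - y))).
  exact: (integrable_bounded_gaussian _ _ (M := `|psi y|)).
have bd x : `|psi y - psi x| <= 2.
  by rewrite (le_trans (ler_normB _ _))//; have := bpsi x; have := bpsi y; lra.
have i3 : (leb n).-integrable setT (EFin \o (fun x => (psi y - psi x) * gaussian a (x - y))).
  by apply: integrable_bounded_gaussian bd => //; exact: measurable_funB.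
have a20 : 0 < a / 2 by rewrite divr_gt0.
have i4 : (leb n).-integrable setT (EFin \o (fun x => e / 2 * gaussian a (x - y))).
  by apply: (integrable_bounded_gaussian _ _ (M := `|e / 2|)).
have i5 : (leb n).-integrable setT (EFin \o (fun x => C * (2 / a) * gaussian (a / 2) (x - y))).
  by apply: (integrable_bounded_gaussian _ _ (M := `|C * (2 / a)|)).
have -> : psi y - regularize (j%:R + 4) psi y =
    peak a * \int[leb n]_x ((psi y - psi x) * gaussian a (x - y)).
  under eq_Rintegral do rewrite mulrBl.
  rewrite RintegralB// mulrBr; congr (_ - _).
  rewrite RintegralZl ?Rintegral_gaussian//; last exact: ig.
  by rewrite mulrCA peak_mul1// mulr1.
rewrite normrM (ger0_norm (peak_ge0 _)).
apply: (@le_trans _ _ (peak a * \int[leb n]_x (e / 2 * gaussian a (x - y) + C * (2 / a) * gaussian (a / 2) (x - y)))).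
  rewrite ler_wpM2l ?peak_ge0//.
  apply: le_trans (le_normr_Rintegral measurableT i3) _.
  apply: le_Rintegral => //.
  - by have := integrable_abse i3; apply: eq_integrable.
  - by have := integrableD measurableT i4 i5; apply: eq_integrable.
  - move=> x _; rewrite normrM (ger0_norm (gaussian_ge0 _ _)).
    rewrite distrC (le_trans (ler_wpM2r (gaussian_ge0 _ _) (HC x)))//.
    by rewrite mulrDl lerD2l -(mulrA C) -(mulrA C) ler_wpM2l// dotp_gaussian_le.
rewrite RintegralD// !RintegralZl ?ig// !Rintegral_gaussian//.
rewrite mulrDr mulrCA peak_mul1// mulr1 mulrCA peak_mul2//.
suff : C * (2 / a) * S <= e / 2 by rewrite -/S; lra.
have : C * 2 * S / (e / 2) <= a.
  rewrite (@le_trans _ _ j%:R)// ?lerDl//.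
  by near: j; apply: nbhs_infty_ger.
rewrite ler_pdivrMr// => h.
have -> : C * (2 / a) * S = C * 2 * S / a by ring.
by rewrite ler_pdivrMr// [e / 2 * a]mulrC.
Unshelve. all: by end_near. Qed.

(** The variation is split by the product rule. The indicator has a quadratic modulus off the
    boundary; the Gaussian is 1-Lipschitz in x . x, which differs from y . y by |x - y|^2 + 2 y . (x
    - y), and the linear term is split by Young's inequality with parameter eta. *)
Lemma regularize_ray_mod (c : 'I_n -> \bar R) y : (forall i, c i != (y ord0 i)%:E) ->
  forall eta, 0 < eta -> exists2 C, 0 <= C &
    forall x, `|\1_(ray c) x * gaussian 1 x - \1_(ray c) y * gaussian 1 y| <=
      eta + C * dotp (x - y) (x - y).
Proof.
move=> cy eta eta0; have [C1 HC1] := indic_ray_dist cy.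
have N0 := dotp_ge0 y.
exists (`|C1| + 1 + dotp y y / eta) => [|x].
  by rewrite !addr_ge0// divr_ge0// ltW.
have g1 (z : 'rV[R]_n) : `|gaussian 1 z| <= 1 by rewrite ger0_norm ?gaussian_ge0// gaussian_le1.
have i1 z : `|\1_(ray c) z : R| <= 1.
  by rewrite indicE; case: (_ \in _); rewrite ?normr1 ?normr0.
have -> : \1_(ray c) x * gaussian 1 x - \1_(ray c) y * gaussian 1 y =
  (\1_(ray c) x - \1_(ray c) y) * gaussian 1 x + \1_(ray c) y * (gaussian 1 x - gaussian 1 y).
  by ring.
apply: le_trans (ler_normD _ _) _; rewrite !normrM.
have h1 : `|\1_(ray c) x - \1_(ray c) y| * `|gaussian 1 x| <= `|C1| * dotp (x - y) (x - y).
  apply: le_trans (ler_piMr _ (g1 x)) _ => //.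
  by apply: le_trans (HC1 x) _; rewrite ler_wpM2r ?dotp_ge0// ler_norm.
have h2 : `|gaussian 1 x - gaussian 1 y| <= eta + (1 + dotp y y / eta) * dotp (x - y) (x - y).
  have d0 := dotp_ge0 (x - y).
  have key : `|dotp x x - dotp y y| <= eta + (1 + dotp y y / eta) * dotp (x - y) (x - y).
    have E : dotp x x - dotp y y = dotp (x - y) (x - y) + 2 * dotp y (x - y).
      rewrite /dotp mulr_sumr -sumrB -big_split/=; apply: eq_bigr => i _.
      by rewrite !mxE; ring.
    have CS := dotp_sqr_le y (x - y).
    have h : 2 * `|dotp y (x - y)| <= eta + dotp y y / eta * dotp (x - y) (x - y).
      move: CS; rewrite -real_normK ?num_real//.
      move: `|_| (normr_ge0 (dotp y (x - y))) => b b0 CS.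
      have -> : dotp y y / eta * dotp (x - y) (x - y) = dotp y y * dotp (x - y) (x - y) / eta.
        by ring.
      rewrite -lerBlDl ler_pdivlMr//; have := sqr_ge0 (eta - b); nra.
    rewrite E; apply: le_trans (ler_normD _ _) _.
    by rewrite normrM (ger0_norm d0) (ger0_norm (ler0n _ 2)) mulrDl mul1r; lra.
  have expL (p q : R) : 0 <= p -> 0 <= q -> `|expR (- 1 * p) - expR (- 1 * q)| <= `|p - q|.
    wlog pq : p q / p <= q.
      move=> H p0 q0; have [/H|/ltW/H] := leP p q; first exact.
      by move=> /(_ q0 p0); rewrite distrC (distrC q).
    move=> p0 q0; rewrite !mulN1r ger0_norm ?subr_ge0 ?ler_expR ?lerN2//.
    rewrite distrC ger0_norm ?subr_ge0//.
    have -> : expR (- p) - expR (- q) = expR (- p) * (1 - expR (- (q - p))).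
      by rewrite mulrBr mulr1 -expRD; congr (_ - expR _); ring.
    have a1 : expR (- p) <= 1 by rewrite -expR0 ler_expR oppr_le0.
    have a2 := expR_ge1Dx (- (q - p)).
    have a3 := expR_ge0 (- p).
    have a4 : expR (- (q - p)) <= 1 by rewrite -expR0 ler_expR oppr_le0 subr_ge0.
    by nra.
  by apply: le_trans (expL _ _ (dotp_ge0 x) (dotp_ge0 y)) key.
have h3 : `|\1_(ray c) y : R| * `|gaussian 1 x - gaussian 1 y| <=
    eta + (1 + dotp y y / eta) * dotp (x - y) (x - y).
  by apply: le_trans h2; rewrite ler_piMl.
apply: le_trans (lerD h1 h3) _.
by rewrite !mulrDl; lra.
Qed.

Section regularized_bound.
Variables (W : 'rV[R]_n -> R) (D B : R).
Hypothesis mW : measurable_fun setT W.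
Hypothesis iW : (leb n).-integrable setT (fun x => (W x * gaussian 2^-1 x)%:E).
Hypothesis D0 : 0 <= D.
Hypothesis B0 : 0 <= B.

(** Starting at 4 satisfies the condition a >= 2 of the splitting inequalities, and also a >= 4,
    under which the frequency-side estimate is later supplied. *)
Let a_ (j : nat) : R := j%:R + 4.
Let a2 j : 2 <= a_ j.
Proof. by rewrite /a_; have : 0 <= j%:R :> R by []; lra. Qed.
Let a0 j : 0 < a_ j. Proof. exact: lt_le_trans (a2 j). Qed.
Let g_ j x := gaussian 1 x * (peak (a_ j) * \int[leb n]_y (W y * gaussian (a_ j) (x - y))).

Hypothesis g_le : forall j A tau, measurable A -> 0 < tau ->
  `|\int[leb n]_(x in A) g_ j x| <=
     tau * D + tau^-1 * (B * \int[leb n]_(x in A) gaussian 1 x).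

Let H A j (z : 'rV[R]_n * 'rV[R]_n) : R :=
  \1_A z.1 * (gaussian 1 z.1 * (W z.2 * gaussian (a_ j) (z.1 - z.2))).

Let mg1 : measurable_fun setT (fun x : 'rV[R]_n => gaussian 1 x).
Proof. exact: measurable_gaussian. Qed.

Let mH A j : measurable A -> measurable_fun setT (H A j).
Proof.
move=> mA; apply: measurable_funM.
  by apply: (measurableT_comp (measurable_indic mA)).
apply: measurable_funM.
  by apply: measurable_gaussian; exact: measurable_fst.
apply: measurable_funM; first exact: measurableT_comp.
by apply: measurable_gaussian; apply: measurable_fun_subrV.
Qed.

Let p x : R := gaussian 4^-1 x.
Let q y := `|W y * gaussian 2^-1 y|.

Let ip : (leb n).-integrable setT (EFin \o p).
Proof.
have := @integrable_gaussian R n 4^-1 0 ltac:(by rewrite invr_gt0).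
by apply: eq_integrable => // x _ /=; rewrite subr0.
Qed.

Let iq : (leb n).-integrable setT (EFin \o q).
Proof. by have := integrable_abse iW; apply: eq_integrable. Qed.

Let indic01 A (x : 'rV[R]_n) : (\1_A x : R) = 0 \/ (\1_A x : R) = 1.
Proof. by rewrite indicE; case: (_ \in _); [right|left]. Qed.

Let H_le A j x y : `|H A j (x, y)| <= p x * q y.
Proof.
apply: (@le_trans _ _ (gaussian 1 x * (`|W y| * gaussian (a_ j) (x - y)))).
  rewrite /H /= !normrM (ger0_norm (gaussian_ge0 _ x)) (ger0_norm (gaussian_ge0 _ (x - y))).
  by case: (indic01 A x) => ->; rewrite ?normr0 ?normr1 ?mul0r ?mul1r// !mulr_ge0// gaussian_ge0.
rewrite /p /q normrM (ger0_norm (gaussian_ge0 _ y)) mulrCA [leRHS]mulrCA ler_wpM2l//.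
exact: gaussian_split2.
Qed.

Let psi A x : R := \1_A x * gaussian 1 x.

Let mpsi A : measurable A -> measurable_fun setT (psi A).
Proof. by move=> mA; apply: measurable_funM => //; exact: measurable_indic. Qed.

Let psi_bd A x : `|psi A x| <= 1.
Proof.
rewrite /psi normrM (ger0_norm (gaussian_ge0 _ x)).
by case: (indic01 A x) => ->; rewrite ?normr0 ?mul0r// normr1 mul1r gaussian_le1.
Qed.

Let iWg j x : (leb n).-integrable setT (fun y => (W y * gaussian (a_ j) (x - y))%:E).
Proof.
apply: (@le_integrableR _ _ _ (leb n) (fun y => W y * gaussian (a_ j) (x - y))
  (fun y => (gaussian 1 x)^-1 * p x * q y)).
- apply: measurable_funM => //; apply: measurable_gaussian.
  exact: measurable_fun_subrV.
- move=> y; rewrite -mulrA ler_pdivlMl ?expR_gt0//.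
  have := H_le setT j x y; rewrite /H /= indicT mul1r normrM.
  by rewrite (ger0_norm (gaussian_ge0 _ x)).
- under [X in _.-integrable _ X]eq_fun do rewrite /= EFinM.
  by apply: integrableZl.
Qed.

(** Fubini moves the regularization from W, of which only Gaussian-weighted integrability is known,
    onto the bounded function [psi A], where pointwise convergence is available. *)
Let swap A j : measurable A ->
  \int[leb n]_(x in A) g_ j x = \int[leb n]_y (W y * regularize (a_ j) (psi A) y).
Proof.
move=> mA; rewrite Rintegral_indic.
have F := tensor_fubini (mH j mA) ip iq (fun x => gaussian_ge0 _ x) (fun y => normr_ge0 _)
  (H_le A j).
transitivity (peak (a_ j) * \int[leb n]_x \int[leb n]_y H A j (x, y)).
  rewrite -(RintegralZl _ measurableT (tensor_integrable_F (mH j mA) ip iq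
    (fun x => gaussian_ge0 _ x) (fun y => normr_ge0 _) (H_le A j))).
  apply: eq_Rintegral => x _; rewrite /g_ /H /=.
  have iy := iWg j x.
  have -> : \int[leb n]_y (\1_A x * (gaussian 1 x * (W y * gaussian (a_ j) (x - y)))) =
      (\1_A x * gaussian 1 x) * \int[leb n]_y (W y * gaussian (a_ j) (x - y)).
    rewrite -(RintegralZl _ measurableT iy); apply: eq_Rintegral => y _; ring.
  ring.
rewrite F -(RintegralZl _ measurableT (tensor_integrable_G (mH j mA) ip iq
    (fun x => gaussian_ge0 _ x) (fun y => normr_ge0 _) (H_le A j))).
apply: eq_Rintegral => y _; rewrite /regularize mulrCA; congr (_ * _).
have ipsi : (leb n).-integrable setT (EFin \o (fun x => psi A x * gaussian (a_ j) (x - y))).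
  exact: (@integrable_bounded_gaussian (psi A) 1 (a_ j) y (a0 j) (mpsi mA) (psi_bd A)).
rewrite -(RintegralZl _ measurableT ipsi).
by apply: eq_Rintegral => x _; rewrite /H /psi /=; ring.
Qed.

(** The majorant is free of j and W is integrable against it, so it provides the domination in the
    limit j -> oo. *)
Let reg_le A j y : measurable A ->
  `|regularize (a_ j) (psi A) y| <= Num.sqrt 2 ^+ n * gaussian 2^-1 y.
Proof.
move=> mA; rewrite /regularize normrM (ger0_norm (peak_ge0 _)) -(peak_mul2 (a0 j)) -mulrA.
rewrite ler_wpM2l ?peak_ge0//.
have ia : (leb n).-integrable setT (EFin \o (fun x => psi A x * gaussian (a_ j) (x - y))).
  exact: (@integrable_bounded_gaussian (psi A) 1 (a_ j) y (a0 j) (mpsi mA) (psi_bd A)).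
apply: le_trans (le_normr_Rintegral measurableT ia) _.
have aj2 : 0 < a_ j / 2 by rewrite divr_gt0.
rewrite -(Rintegral_gaussian y aj2) -RintegralZr//; last exact: integrable_gaussian.
apply: le_Rintegral => //.
- by have := integrable_abse ia; apply: eq_integrable.
- under [X in _.-integrable _ X]eq_fun do rewrite /= EFinM.
  by apply: integrableZr => //; exact: integrable_gaussian.
- move=> x _; rewrite [leRHS]mulrC; apply: le_trans (gaussian_split1 _ _ (a2 j)).
  rewrite normrM (ger0_norm (gaussian_ge0 _ (x - y))) ler_wpM2r ?gaussian_ge0//.
  rewrite /psi normrM (ger0_norm (gaussian_ge0 _ x)).
  by case: (indic01 A x) => ->; rewrite ?normr0 ?normr1 ?mul0r ?mul1r// gaussian_ge0.
Qed.

Let measurable_regularize A j : measurable A ->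
  measurable_fun setT (regularize (a_ j) (psi A)).
Proof.
move=> mA; apply: measurable_funM => //.
have i2 : (leb n).-integrable setT (EFin \o (fun y => gaussian 2^-1 y)).
  have := @integrable_gaussian R n 2^-1 0 ltac:(by rewrite invr_gt0).
  by apply: eq_integrable => // x _ /=; rewrite subr0.
have mf : measurable_fun setT (fun z : 'rV[R]_n * 'rV[R]_n => psi A z.1 * gaussian (a_ j) (z.1 - z.2)).
  apply: measurable_funM; first exact: (measurableT_comp (mpsi mA)).
  by apply: measurable_gaussian; apply: measurable_fun_subrV.
have le x y : `|psi A x * gaussian (a_ j) (x - y)| <= p x * gaussian 2^-1 y.
  apply: le_trans (gaussian_split2 x y (a2 j)).
  rewrite normrM (ger0_norm (gaussian_ge0 _ (x - y))) ler_wpM2r ?gaussian_ge0//.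
  rewrite /psi normrM (ger0_norm (gaussian_ge0 _ x)).
  by case: (indic01 A x) => ->; rewrite ?normr0 ?normr1 ?mul0r ?mul1r// gaussian_ge0.
have := tensor_integrable_G mf ip i2 (fun x => gaussian_ge0 _ x) (fun x => gaussian_ge0 _ x) le.
by move=> /measurable_int /measurable_EFinP.
Qed.

Let ig : (leb n).-integrable setT (EFin \o (fun x => gaussian 1 x * W x)).
Proof.
apply: (@le_integrableR _ _ _ (leb n) (fun x => gaussian 1 x * W x) q) => //.
  exact: measurable_funM.
move=> x; rewrite mulrC /q !normrM ler_wpM2l// !(ger0_norm (gaussian_ge0 _ _)).
by rewrite /gaussian ler_expR; have := dotp_ge0 x; lra.
Qed.

(** By [weak_limit_le] it is enough to identify the limit on rays; there, after [swap], the
    regularized function converges off finitely many hyperplanes and dominated convergence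
    applies. *)
Lemma regularization_le A tau : measurable A -> 0 < tau ->
  `|\int[leb n]_(x in A) (gaussian 1 x * W x)| <=
     tau * D + tau^-1 * (B * \int[leb n]_(x in A) gaussian 1 x).
Proof.
have := @weak_limit_le _ _ R (leb n) g_ (fun x => gaussian 1 x * W x)
  (fun x => gaussian 1 x) D B (range (@ray R n)); apply => //.
- move=> j.
  rewrite (_ : EFin \o _ = fun x => ((peak (a_ j))%:E *
      (\int[leb n]_y H setT j (x, y))%:E)%E).
    apply: integrableZl => //.
    exact: (tensor_integrable_F (mH j measurableT) ip iq (fun x => gaussian_ge0 _ x)
      (fun y => normr_ge0 _) (H_le setT j)).
  apply/funext => x; rewrite -EFinM /g_ /H /=; congr EFin.
  under [in RHS]eq_Rintegral do rewrite indicT mul1r.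
  by rewrite (RintegralZl _ measurableT (iWg j x)) mulrCA.
- have := @integrable_gaussian R n 1 0 ltac:(by []).
  by apply: eq_integrable => // x _ /=; rewrite subr0.
- exact: measurable_rVE.
- exact: setI_closed_ray.
- by exists (fun=> -oo%E) => //; exact: ray_setT.
move=> _ [c _ <-]; have mc := measurable_ray c.
rewrite (_ : (fun j => _) = (fun j => \int[leb n]_y (W y * regularize (a_ j) (psi (ray c)) y))); last first.
  by apply/funext => j; exact: swap.
rewrite Rintegral_indic.
apply: (@dominated_cvg_Rintegral _ _ _ (leb n) _ _ (fun y => Num.sqrt 2 ^+ n * q y)).
- move=> j; apply: measurable_funM => //.
  exact: measurable_regularize.
- by apply: measurable_funM; [exact: measurable_indic|exact: measurable_funM].
- have := ae_ray_boundary c; apply: filterS => y cy.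
  rewrite (_ : \1_(ray c) y * (gaussian 1 y * W y) = W y * psi (ray c) y); last first.
    by rewrite /psi; ring.
  apply: cvgM; first exact: cvg_cst.
  apply: cvg_regularize.
  + exact: mpsi.
  + exact: psi_bd.
  + exact: regularize_ray_mod.
- under [X in _.-integrable _ X]eq_fun do rewrite /= EFinM.
  by apply: integrableZl.
- move=> j y; rewrite [leLHS]normrM /q (normrM (W y)) (ger0_norm (gaussian_ge0 _ y)).
  rewrite mulrCA ler_wpM2l//.
  exact: reg_le.
Qed.

End regularized_bound.

End gaussian_regularization.

(** * The weak-type inequality *)

Section bessel.
Context {R : realType} (n : nat).
Local Notation leb := (@lebesgue_rV R).
Implicit Types (x y xi : 'rV[R]_n).

Lemma dotpBl x y xi : dotp (x - y) xi = dotp x xi - dotp y xi.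
Proof. by rewrite /dotp -sumrB; apply: eq_bigr => i _; rewrite !mxE mulrBl. Qed.

Lemma gaussianM (a b : R) x : gaussian a x * gaussian b x = gaussian (a + b) x.
Proof. by rewrite /gaussian -expRD; congr expR; ring. Qed.

Lemma integrable_gaussian0 (a : R) : 0 < a ->
  (leb n).-integrable setT (EFin \o (fun x => gaussian a x)).
Proof.
move=> a0; have := integrable_gaussian (0 : 'rV[R]_n) a0.
by apply: eq_integrable => // x _ /=; rewrite subr0.
Qed.

Lemma measurable_cos_dotp d (T : measurableType d) (f g : T -> 'rV[R]_n) :
  measurable_fun setT f -> measurable_fun setT g ->
  measurable_fun setT (fun w => cos (dotp (f w) (g w))).
Proof.
move=> mf mg; apply: (@measurableT_comp _ _ _ _ _ _ (@cos R)).
  by apply: continuous_measurable_fun; exact: continuous_cos.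
exact: measurable_fun_dotp.
Qed.

Lemma measurable_sin_dotp d (T : measurableType d) (f g : T -> 'rV[R]_n) :
  measurable_fun setT f -> measurable_fun setT g ->
  measurable_fun setT (fun w => sin (dotp (f w) (g w))).
Proof.
move=> mf mg; apply: (@measurableT_comp _ _ _ _ _ _ (@sin R)).
  by apply: continuous_measurable_fun; exact: continuous_sin.
exact: measurable_fun_dotp.
Qed.

Lemma ler_sqr_norm (u v : R) : `|u| <= v -> u ^+ 2 <= v ^+ 2.
Proof.
rewrite -[u ^+ 2]real_normK ?num_real//; move: `|u| (normr_ge0 u) => w w0 wv; nra.
Qed.

Lemma young (t u v : R) : 0 < t -> `|u * v| <= t * u ^+ 2 + t^-1 * v ^+ 2.
Proof.
move=> t0; have t0' : 0 < t^-1 by rewrite invr_gt0.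
rewrite -[u ^+ 2]real_normK ?num_real// -[v ^+ 2]real_normK ?num_real// normrM.
move: `|u| `|v| (normr_ge0 u) (normr_ge0 v) => x y x0 y0.
have : 0 <= t^-1 * (t * x - y) ^+ 2 by rewrite mulr_ge0 ?sqr_ge0// ltW.
have -> : t^-1 * (t * x - y) ^+ 2 = t * x ^+ 2 + t^-1 * y ^+ 2 - 2 * (x * y).
  by field; rewrite gt_eqF.
have : 0 <= x * y by exact: mulr_ge0.
lra.
Qed.

(** All of the factor e is put on the side of (c, s): its square e * e becomes the Gaussian weight
    of the Bessel-type inequality, and (p, q) enters without weight. *)
Lemma young2 (t e p q c s : R) : 0 < t ->
  `|e * (p * c + q * s)| <= t * (p ^+ 2 + q ^+ 2) + t^-1 * (e * e * (c ^+ 2 + s ^+ 2)).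
Proof.
move=> t0; have -> : e * (p * c + q * s) = p * (e * c) + q * (e * s) by ring.
apply: le_trans (ler_normD _ _) _.
apply: le_trans (lerD (young p (e * c) t0) (young q (e * s) t0)) _.
by rewrite le_eqVlt; apply/orP; left; apply/eqP; ring.
Qed.

Lemma normr_cos (t : R) : `|cos t| <= 1.
Proof. by rewrite ler_norml cos_geN1 cos_le1. Qed.

Lemma normr_sin (t : R) : `|sin t| <= 1.
Proof. by rewrite ler_norml sin_geN1 sin_le1. Qed.

Lemma integrable_le_gaussian (a : R) (f : 'rV[R]_n -> R) : 0 < a ->
  measurable_fun setT f -> (forall x, `|f x| <= gaussian a x) ->
  (leb n).-integrable setT (EFin \o f).
Proof. by move=> a0 mf lf; apply: (le_integrableR mf lf); exact: integrable_gaussian0. Qed.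

Variables (psi : 'rV[R]_n -> R).
Hypothesis mpsi : measurable_fun setT psi.
Hypothesis psi_le : forall x, `|psi x| <= gaussian 1 x.

(** The real part of the Fourier transform of psi and, up to sign, its imaginary part. *)
Definition cos_transform xi := \int[leb n]_x (psi x * cos (dotp x xi)).
Definition sin_transform xi := \int[leb n]_x (psi x * sin (dotp x xi)).
Local Notation C := cos_transform.
Local Notation S := sin_transform.

Let M := \int[leb n]_x gaussian 1 x.
Let ig1 := @integrable_gaussian0 1 ltac:(by []).

Let le_bd (k : 'rV[R]_n -> R) x : (forall x, `|k x| <= 1) -> `|psi x * k x| <= gaussian 1 x.
Proof.
move=> k1; rewrite normrM; apply: le_trans (psi_le x).
by rewrite ler_piMr.
Qed.

Let i_bd (k : 'rV[R]_n -> R) : measurable_fun setT k -> (forall x, `|k x| <= 1) ->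
  (leb n).-integrable setT (EFin \o (fun x => psi x * k x)).
Proof.
move=> mk k1; apply: (@integrable_le_gaussian 1) => //; first exact: measurable_funM.
by move=> x; exact: le_bd.
Qed.

Let mid : measurable_fun setT (@id 'rV[R]_n). Proof. by []. Qed.

Let icos xi : (leb n).-integrable setT (EFin \o (fun x => psi x * cos (dotp x xi))).
Proof. by apply: i_bd => [|x]; [exact: measurable_cos_dotp|exact: normr_cos]. Qed.

Let isin xi : (leb n).-integrable setT (EFin \o (fun x => psi x * sin (dotp x xi))).
Proof. by apply: i_bd => [|x]; [exact: measurable_sin_dotp|exact: normr_sin]. Qed.

Let M_bd (k : 'rV[R]_n -> R) : measurable_fun setT k -> (forall x, `|k x| <= 1) ->
  `|\int[leb n]_x (psi x * k x)| <= M.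
Proof.
move=> mk k1; have ik := i_bd mk k1.
apply: le_trans (le_normr_Rintegral measurableT ik) _; apply: le_Rintegral => //.
- by have := integrable_abse ik; apply: eq_integrable.
- by move=> x _; exact: le_bd.
Qed.

Let ipsi : (leb n).-integrable setT (EFin \o psi).
Proof. exact: (@integrable_le_gaussian 1). Qed.

(** A Gaussian weight in xi makes the kernel integrable in both variables, so Fubini yields the
    measurability of the weighted transform; the weight never vanishes and is divided out. *)
Lemma measurable_cos_transform : measurable_fun setT C.
Proof.
have mf : measurable_fun setT (fun z : 'rV[R]_n * 'rV[R]_n =>
    gaussian 1 z.2 * (psi z.1 * cos (dotp z.1 z.2))).
  apply: measurable_funM; first by apply: measurable_gaussian; exact: measurable_snd.
  by apply: measurable_funM; [exact: measurableT_comp|exact: measurable_cos_dotp].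
have le x y : `|gaussian 1 y * (psi x * cos (dotp x y))| <= gaussian 1 x * gaussian 1 y.
  rewrite normrM (ger0_norm (gaussian_ge0 _ _)) mulrC ler_wpM2r ?gaussian_ge0//.
  by apply: (@le_bd (fun x => cos (dotp x y))) => z; exact: normr_cos.
have := tensor_integrable_G mf ig1 ig1 (fun x => gaussian_ge0 _ x) (fun x => gaussian_ge0 _ x) le.
move=> /measurable_int /measurable_EFinP mG.
have E xi : C xi = (gaussian 1 xi)^-1 * \int[leb n]_x (gaussian 1 xi * (psi x * cos (dotp x xi))).
  rewrite (RintegralZl _ measurableT (icos xi)) mulKf// gt_eqF// expR_gt0//.
rewrite (_ : C = fun xi => (gaussian 1 xi)^-1 * \int[leb n]_x (gaussian 1 xi * (psi x * cos (dotp x xi)))); last by apply/funext.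
apply: measurable_funM mG.
have -> : (fun xi : 'rV[R]_n => (gaussian 1 xi)^-1) = (fun xi => gaussian (-1) xi).
  by apply/funext => xi; rewrite /gaussian -expRN; congr expR; ring.
exact: measurable_gaussian.
Qed.

Lemma measurable_sin_transform : measurable_fun setT S.
Proof.
have mf : measurable_fun setT (fun z : 'rV[R]_n * 'rV[R]_n =>
    gaussian 1 z.2 * (psi z.1 * sin (dotp z.1 z.2))).
  apply: measurable_funM; first by apply: measurable_gaussian; exact: measurable_snd.
  by apply: measurable_funM; [exact: measurableT_comp|exact: measurable_sin_dotp].
have le x y : `|gaussian 1 y * (psi x * sin (dotp x y))| <= gaussian 1 x * gaussian 1 y.
  rewrite normrM (ger0_norm (gaussian_ge0 _ _)) mulrC ler_wpM2r ?gaussian_ge0//.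
  by apply: (@le_bd (fun x => sin (dotp x y))) => z; exact: normr_sin.
have := tensor_integrable_G mf ig1 ig1 (fun x => gaussian_ge0 _ x) (fun x => gaussian_ge0 _ x) le.
move=> /measurable_int /measurable_EFinP mG.
have E xi : S xi = (gaussian 1 xi)^-1 * \int[leb n]_x (gaussian 1 xi * (psi x * sin (dotp x xi))).
  rewrite (RintegralZl _ measurableT (isin xi)) mulKf// gt_eqF// expR_gt0//.
rewrite (_ : S = fun xi => (gaussian 1 xi)^-1 * \int[leb n]_x (gaussian 1 xi * (psi x * sin (dotp x xi)))); last by apply/funext.
apply: measurable_funM mG.
have -> : (fun xi : 'rV[R]_n => (gaussian 1 xi)^-1) = (fun xi => gaussian (-1) xi).
  by apply/funext => xi; rewrite /gaussian -expRN; congr expR; ring.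
exact: measurable_gaussian.
Qed.

Lemma cos_transform_le xi : `|C xi| <= M.
Proof. by apply: M_bd => [|x]; [exact: measurable_cos_dotp|exact: normr_cos]. Qed.

Lemma sin_transform_le xi : `|S xi| <= M.
Proof. by apply: M_bd => [|x]; [exact: measurable_sin_dotp|exact: normr_sin]. Qed.

(** Writing the squared modulus of the transform as a double integral produces the kernel cos ((x -
    x') . xi); L is the inner integral, and it separates by the addition formula. *)
Let L x xi := \int[leb n]_x' (psi x' * cos (dotp (x - x') xi)).

Let LE x xi : L x xi = cos (dotp x xi) * C xi + sin (dotp x xi) * S xi.
Proof.
rewrite -(RintegralZl _ measurableT (icos xi)) -(RintegralZl _ measurableT (isin xi)).
rewrite -RintegralD//; first last.
- under [X in _.-integrable _ X]eq_fun do rewrite /= EFinM.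
  exact: (integrableZl measurableT _ (isin _)).
- under [X in _.-integrable _ X]eq_fun do rewrite /= EFinM.
  exact: (integrableZl measurableT _ (icos _)).
by apply: eq_Rintegral => y _; rewrite dotpBl cosB; ring.
Qed.

Let L_le x xi : `|L x xi| <= M.
Proof.
apply: M_bd => [|y]; last exact: normr_cos.
by apply: measurable_cos_dotp => //; exact: measurable_fun_subrV.
Qed.

Let sqr_transform xi : C xi ^+ 2 + S xi ^+ 2 = \int[leb n]_x (psi x * L x xi).
Proof.
rewrite !expr2 -{1}(RintegralZl _ measurableT (icos xi)) -{1}(RintegralZl _ measurableT (isin xi)).
rewrite -RintegralD//; first last.
- under [X in _.-integrable _ X]eq_fun do rewrite /= EFinM.
  exact: (integrableZl measurableT _ (isin _)).
- under [X in _.-integrable _ X]eq_fun do rewrite /= EFinM.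
  exact: (integrableZl measurableT _ (icos _)).
by apply: eq_Rintegral => y _; rewrite LE; ring.
Qed.

Variable b : R.
Hypothesis b0 : 0 < b.
Hypothesis b2 : 2 <= (4 * b)^-1.
(** The masses of [gaussian b] and of the dual kernel g; their product is (2 pi)^n for every b,
    which makes the final inequality uniform in b. *)
Let ka := Num.sqrt (pi / b) ^+ n.
Let g x := gaussian (4 * b)^-1 x.
Let ka' := Num.sqrt (pi / (4 * b)^-1) ^+ n.
Let a0 : 0 < (4 * b)^-1. Proof. by rewrite invr_gt0 mulr_gt0. Qed.

Let inner x : \int[leb n]_xi (gaussian b xi * L x xi) =
  \int[leb n]_y (psi y * (ka * g (x - y))).
Proof.
have mf : measurable_fun setT (fun z : 'rV[R]_n * 'rV[R]_n =>
    gaussian b z.1 * (psi z.2 * cos (dotp (x - z.2) z.1))).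
  apply: measurable_funM; first by apply: measurable_gaussian; exact: measurable_fst.
  apply: measurable_funM; first exact: measurableT_comp.
  by apply: measurable_cos_dotp => //; apply: measurable_fun_subrV.
have le xi y : `|gaussian b xi * (psi y * cos (dotp (x - y) xi))| <= gaussian b xi * gaussian 1 y.
  rewrite normrM (ger0_norm (gaussian_ge0 _ _)) ler_wpM2l ?gaussian_ge0//.
  by apply: (@le_bd (fun y => cos (dotp (x - y) xi))) => z; exact: normr_cos.
have F := tensor_fubini mf (integrable_gaussian0 b0) ig1 (fun x => gaussian_ge0 _ x)
  (fun x => gaussian_ge0 _ x) le.
transitivity (\int[leb n]_xi \int[leb n]_y (gaussian b xi * (psi y * cos (dotp (x - y) xi)))).
  apply: eq_Rintegral => xi _; rewrite /L.
  have ic : (leb n).-integrable setT (EFin \o (fun y => psi y * cos (dotp (x - y) xi))).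
    apply: i_bd => [|y]; last exact: normr_cos.
    by apply: measurable_cos_dotp => //; exact: measurable_fun_subrV.
  by rewrite -(RintegralZl _ measurableT ic).
rewrite F; apply: eq_Rintegral => y _.
have := Rintegral_gaussian_cos 0 (x - y) b0; rewrite cos0 mul1r -/ka -/(g _) => <-.
under [in RHS]eq_Rintegral do rewrite addr0.
have ic : (leb n).-integrable setT (EFin \o (fun xi => gaussian b xi * cos (dotp (x - y) xi))).
  apply: (integrable_le_gaussian b0).
    by apply: measurable_funM; [exact: measurable_gaussian|exact: measurable_cos_dotp].
  by move=> z; rewrite normrM (ger0_norm (gaussian_ge0 _ _)) ler_piMr ?gaussian_ge0 ?normr_cos.
rewrite -(RintegralZl _ measurableT ic).
by apply: eq_Rintegral => xi _; rewrite mulrCA.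
Qed.

Let N x := \int[leb n]_y (psi y ^+ 2 * g (x - y)).

Let psi1 x : `|psi x| <= 1.
Proof. by apply: le_trans (psi_le x) _; exact: gaussian_le1. Qed.

Let psi2_le x : psi x ^+ 2 <= gaussian 1 x.
Proof.
apply: le_trans (psi_le x); rewrite -real_normK ?num_real// expr2.
by rewrite ler_piMr.
Qed.

Let mN : measurable_fun setT (fun z : 'rV[R]_n * 'rV[R]_n => psi z.2 ^+ 2 * g (z.1 - z.2)).
Proof.
apply: measurable_funM; first by apply: measurable_funX; exact: measurableT_comp.
by apply: measurable_gaussian; exact: measurable_fun_subrV.
Qed.

Let N_le x y : `|psi y ^+ 2 * g (x - y)| <= gaussian 2^-1 x * gaussian 4^-1 y.
Proof.
rewrite ger0_norm; last by rewrite mulr_ge0 ?sqr_ge0 ?gaussian_ge0.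
rewrite [leRHS]mulrC.
apply: le_trans (gaussian_split2 y x b2).
by rewrite /g gaussianBC ler_wpM2r ?gaussian_ge0.
Qed.

Let i4 := @integrable_gaussian0 4^-1 ltac:(by rewrite invr_gt0).
Let i2 := @integrable_gaussian0 2^-1 ltac:(by rewrite invr_gt0).

Let iN : (leb n).-integrable setT (EFin \o N).
Proof.
exact: (tensor_integrable_F mN i2 i4 (fun x => gaussian_ge0 _ x) (fun x => gaussian_ge0 _ x) N_le).
Qed.

Let ipsi2 : (leb n).-integrable setT (EFin \o (fun x => psi x ^+ 2)).
Proof.
apply: (@integrable_le_gaussian 1) => //; first exact: measurable_funX.
by move=> x; rewrite ger0_norm ?sqr_ge0.
Qed.

Let intN : \int[leb n]_x N x = ka' * \int[leb n]_x (psi x ^+ 2).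
Proof.
rewrite (tensor_fubini mN i2 i4 (fun x => gaussian_ge0 _ x) (fun x => gaussian_ge0 _ x) N_le).
rewrite -(RintegralZl _ measurableT ipsi2); apply: eq_Rintegral => y _ /=.
by rewrite (RintegralZl _ measurableT (integrable_gaussian y a0)) Rintegral_gaussian// mulrC.
Qed.

Let igx x : (leb n).-integrable setT (EFin \o (fun y => g (x - y))).
Proof.
have := integrable_gaussian x a0.
by apply: eq_integrable => // y _ /=; rewrite gaussianBC.
Qed.

Let intg x : \int[leb n]_y g (x - y) = ka'.
Proof.
rewrite /ka' -(Rintegral_gaussian x a0); apply: eq_Rintegral => y _.
by rewrite /g gaussianBC.
Qed.

Let ka_ge0 : 0 <= ka. Proof. by rewrite exprn_ge0// sqrtr_ge0. Qed.

(** Schur's test in pointwise form: psi x * psi y is at most half the sum of the squares, and the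
    kernel g is nonnegative with mass ka'. *)
Let quad x : psi x * \int[leb n]_y (psi y * (ka * g (x - y))) <=
  ka / 2 * (ka' * psi x ^+ 2 + N x).
Proof.
have mgx : measurable_fun setT (fun y => g (x - y)).
  by apply: measurable_gaussian; exact: measurable_fun_subrV.
have ix : (leb n).-integrable setT (EFin \o (fun y => psi y * (ka * g (x - y)))).
  apply: (@le_integrableR _ _ _ (leb n) (fun y => psi y * (ka * g (x - y))) (fun y => ka * g (x - y))).
  - by apply: measurable_funM => //; exact: measurable_funM.
  - move=> y; rewrite normrM (ger0_norm (mulr_ge0 ka_ge0 (gaussian_ge0 _ _))).
    by rewrite ler_piMl// mulr_ge0// gaussian_ge0.
  - under [X in _.-integrable _ X]eq_fun do rewrite /= EFinM.
    exact: (integrableZl measurableT _ (igx _)).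
have ip2 : (leb n).-integrable setT (EFin \o (fun y => psi y ^+ 2 * g (x - y))).
  exact: (tensor_integrable1 mN i4 N_le x).
have ip1 : (leb n).-integrable setT (EFin \o (fun y => psi x ^+ 2 * g (x - y))).
  under [X in _.-integrable _ X]eq_fun do rewrite /= EFinM.
  exact: (integrableZl measurableT _ (igx _)).
have ips : (leb n).-integrable setT
    (EFin \o (fun y => psi x ^+ 2 * g (x - y) + psi y ^+ 2 * g (x - y))).
  by have := integrableD measurableT ip1 ip2; apply: eq_integrable.
rewrite -(RintegralZl _ measurableT ix).
apply: (@le_trans _ _ (\int[leb n]_y (ka / 2 * (psi x ^+ 2 * g (x - y) + psi y ^+ 2 * g (x - y))))).
  apply: le_Rintegral => //.
  - under [X in _.-integrable _ X]eq_fun do rewrite /= EFinM.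
    by apply: integrableZl.
  - under [X in _.-integrable _ X]eq_fun do rewrite /= EFinM.
    by apply: integrableZl.
  - move=> y _; have h := mulr_ge0 (mulr_ge0 ka_ge0 (gaussian_ge0 (4 * b)^-1 (x - y))) (sqr_ge0 (psi x - psi y)).
    move: h; rewrite -/(g _); nra.
rewrite (RintegralZl _ measurableT ips) (RintegralD measurableT ip1 ip2).
by rewrite (RintegralZl _ measurableT (igx x)) intg [ka' * _]mulrC.
Qed.

(* |hat psi|^2 is expanded as a double integral; integrating out xi leaves the
   positive kernel g (x - y), which Schur's test bounds on L^2. *)
Lemma gaussian_bessel : \int[leb n]_xi (gaussian b xi * (C xi ^+ 2 + S xi ^+ 2)) <=
  ka * ka' * \int[leb n]_x (psi x ^+ 2).
Proof.
have M0 : 0 <= M by apply: Rintegral_ge0 => x _; exact: gaussian_ge0.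
have mL : measurable_fun setT (fun z : 'rV[R]_n * 'rV[R]_n => L z.2 z.1).
  under eq_fun do rewrite LE.
  apply: measurable_funD; apply: measurable_funM.
  - by apply: measurable_cos_dotp; [exact: measurable_snd|exact: measurable_fst].
  - exact: (measurableT_comp measurable_cos_transform).
  - by apply: measurable_sin_dotp; [exact: measurable_snd|exact: measurable_fst].
  - exact: (measurableT_comp measurable_sin_transform).
have mf : measurable_fun setT (fun z : 'rV[R]_n * 'rV[R]_n =>
    gaussian b z.1 * (psi z.2 * L z.2 z.1)).
  apply: measurable_funM; first by apply: measurable_gaussian; exact: measurable_fst.
  by apply: measurable_funM; first exact: measurableT_comp.
have le xi x : `|gaussian b xi * (psi x * L x xi)| <= gaussian b xi * (M * gaussian 1 x).
  rewrite normrM (ger0_norm (gaussian_ge0 _ _)) ler_wpM2l ?gaussian_ge0//.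
  by rewrite normrM mulrC ler_pM.
have iM : (leb n).-integrable setT (EFin \o (fun x => M * gaussian 1 x)).
  under [X in _.-integrable _ X]eq_fun do rewrite /= EFinM.
  exact: (integrableZl measurableT _ ig1).
have F := tensor_fubini mf (integrable_gaussian0 b0) iM (fun x => gaussian_ge0 _ x)
  (fun x => mulr_ge0 M0 (gaussian_ge0 _ x)) le.
have -> : \int[leb n]_xi (gaussian b xi * (C xi ^+ 2 + S xi ^+ 2)) =
  \int[leb n]_xi \int[leb n]_x (gaussian b xi * (psi x * L x xi)).
  apply: eq_Rintegral => xi _; rewrite sqr_transform.
  have ic : (leb n).-integrable setT (EFin \o (fun x => psi x * L x xi)).
    apply: (@le_integrableR _ _ _ (leb n) (fun x => psi x * L x xi) (fun x => M * gaussian 1 x)).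
    - apply: measurable_funM; first exact: mpsi.
      exact: (measurableT_comp mL (pair1_measurable xi)).
    - by move=> x; rewrite normrM mulrC; apply: ler_pM; [exact: normr_ge0|exact: normr_ge0|exact: L_le|exact: psi_le].
    - exact: iM.
  by rewrite -(RintegralZl _ measurableT ic).
rewrite F.
have E x : \int[leb n]_xi (gaussian b xi * (psi x * L x xi)) =
    psi x * \int[leb n]_y (psi y * (ka * g (x - y))).
  rewrite -inner.
  suff ic : (leb n).-integrable setT (EFin \o (fun xi => gaussian b xi * L x xi)).
    by rewrite -(RintegralZl _ measurableT ic); apply: eq_Rintegral => xi _; rewrite mulrCA.
  apply: (@le_integrableR _ _ _ (leb n) (fun xi => gaussian b xi * L x xi) (fun xi => M * gaussian b xi)).
  - apply: measurable_funM; first exact: measurable_gaussian.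
    exact: (measurableT_comp mL (pair2_measurable x)).
  - by move=> xi; rewrite normrM (ger0_norm (gaussian_ge0 _ _)) mulrC ler_wpM2r ?gaussian_ge0.
  - under [X in _.-integrable _ X]eq_fun do rewrite /= EFinM.
    exact: (integrableZl measurableT _ (integrable_gaussian0 b0)).
under eq_Rintegral do rewrite E.
have i1 : (leb n).-integrable setT (EFin \o (fun x => ka' * psi x ^+ 2)).
  under [X in _.-integrable _ X]eq_fun do rewrite /= EFinM.
  exact: (integrableZl measurableT _ ipsi2).
have isum : (leb n).-integrable setT (EFin \o (fun x => ka' * psi x ^+ 2 + N x)).
  by have := integrableD measurableT i1 iN; apply: eq_integrable.
apply: (@le_trans _ _ (\int[leb n]_x (ka / 2 * (ka' * psi x ^+ 2 + N x)))).
  apply: le_Rintegral; [exact: measurableT| | |by move=> x _; exact: quad].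
  - have := tensor_integrable_G mf (integrable_gaussian0 b0) iM (fun x => gaussian_ge0 _ x)
      (fun x => mulr_ge0 M0 (gaussian_ge0 _ x)) le.
    by apply: eq_integrable; [exact: measurableT|move=> x _; rewrite /= E].
  - under [X in _.-integrable _ X]eq_fun do rewrite /= EFinM.
    exact: (integrableZl measurableT _ isum).
rewrite (RintegralZl _ measurableT isum) (RintegralD measurableT i1 iN).
rewrite (RintegralZl _ measurableT ipsi2) intN.
by rewrite le_eqVlt; apply/orP; left; apply/eqP; field.
Qed.

End bessel.

(** * From transforms to superlevel sets *)

Section weak_type.
Context {R : realType} (n : nat).
Local Notation leb := (@lebesgue_rV R).
Variables (W p q : 'rV[R]_n -> R) (c : R).
Hypothesis mW : measurable_fun setT W.
Hypothesis iW : (leb n).-integrable setT (fun x => (W x * gaussian 2^-1 x)%:E).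
Hypothesis mp : measurable_fun setT p.
Hypothesis mq : measurable_fun setT q.
Hypothesis ip2 : (leb n).-integrable setT (fun x => (p x ^+ 2)%:E).
Hypothesis iq2 : (leb n).-integrable setT (fun x => (q x ^+ 2)%:E).
Hypothesis c0 : 0 <= c.
Hypothesis Wpq : forall a x, 4 <= a ->
  peak n a * \int[leb n]_y (W y * gaussian a (x - y)) =
  c * \int[leb n]_xi (gaussian (4 * a)^-1 xi *
        (p xi * cos (dotp x xi) + q xi * sin (dotp x xi))).

Let D := c * (\int[leb n]_x (p x ^+ 2) + \int[leb n]_x (q x ^+ 2)).
(** Equal to (2 pi)^n, the constant in Plancherel's identity for this normalization of the
    transform. *)
Let K : R := Num.sqrt (4 * pi ^+ 2) ^+ n.
Let B := c * K.

Let D0 : 0 <= D.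
Proof.
by rewrite mulr_ge0// addr_ge0//; apply: Rintegral_ge0 => x _; exact: sqr_ge0.
Qed.

Let B0 : 0 <= B.
Proof. by rewrite mulr_ge0// exprn_ge0// sqrtr_ge0. Qed.

Let int_sqr_gaussian b (h : 'rV[R]_n -> R) : 0 < b -> measurable_fun setT h ->
  (leb n).-integrable setT (fun x => (h x ^+ 2)%:E) ->
  (leb n).-integrable setT (EFin \o (fun x => gaussian b x * `|h x|)).
Proof.
move=> b0 mh ih2.
have b20 : 0 < b + b by rewrite addr_gt0.
apply: (@le_integrableR _ _ _ (leb n) (fun x => gaussian b x * `|h x|)
  (fun x => gaussian (b + b) x + h x ^+ 2)).
- apply: measurable_funM; first exact: measurable_gaussian.
  by apply: (measurableT_comp (@normr_measurable R setT)).
- move=> x; rewrite -gaussianM normrM normr_id (ger0_norm (gaussian_ge0 _ _)).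
  rewrite -[h x ^+ 2]real_normK ?num_real//.
  have := gaussian_ge0 b x; have := normr_ge0 (h x).
  move: (gaussian b x) `|h x| => u v v0 u0; have := sqr_ge0 (u - v); nra.
- have := integrableD measurableT (integrable_gaussian0 n b20) ih2.
  by apply: eq_integrable.
Qed.

(* By Fubini the left-hand side pairs (p, q) with the cosine and sine transforms of
   1_A * gaussian 1; Young's inequality and [gaussian_bessel] conclude. *)
Lemma transference_le (j : nat) A tau : measurable A -> 0 < tau ->
  `|\int[leb n]_(x in A) (gaussian 1 x * (peak n (j%:R + 4) *
     \int[leb n]_y (W y * gaussian (j%:R + 4) (x - y))))| <=
  tau * D + tau^-1 * (B * \int[leb n]_(x in A) gaussian 1 x).
Proof.
move=> mA tau0; set a : R := j%:R + 4.
have a4 : 4 <= a by rewrite /a; have : 0 <= j%:R :> R by []; lra.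
have a0 : 0 < a by lra.
have e0 : 0 < (4 * a)^-1 by rewrite invr_gt0 mulr_gt0.
(* The frequency weight e has exponent (4 a)^-1 and Young's inequality squares it, so the
   Bessel-type inequality is used with b = (2 a)^-1. Its condition 2 <= (4 b)^-1 reads a >= 4, hence
   the shift by 4. *)
have b0 : 0 < (2 * a)^-1 by rewrite invr_gt0 mulr_gt0.
have b2 : 2 <= (4 * (2 * a)^-1)^-1.
  rewrite (_ : (4 * (2 * a)^-1)^-1 = a / 2); first lra.
  by field; rewrite gt_eqF.
have E2 : (4 * a)^-1 + (4 * a)^-1 = (2 * a)^-1 by field; rewrite gt_eqF.
have KE : Num.sqrt (pi / (2 * a)^-1) ^+ n * Num.sqrt (pi / (4 * (2 * a)^-1)^-1) ^+ n = K.
  rewrite -exprMn -sqrtrM; last by rewrite divr_ge0 ?pi_ge0// ltW.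
  congr (Num.sqrt _ ^+ n); rewrite !invrK; field; by rewrite gt_eqF.
pose psi x : R := \1_A x * gaussian 1 x.
have mpsi : measurable_fun setT psi.
  by apply: measurable_funM; [exact: measurable_indic|exact: measurable_gaussian].
have psi01 x : 0 <= psi x <= gaussian 1 x.
  by rewrite /psi indicE; case: (_ \in _); rewrite ?mul1r ?mul0r ?lexx gaussian_ge0.
have psi_le x : `|psi x| <= gaussian 1 x.
  by have /andP[h1 h2] := psi01 x; rewrite ger0_norm.
pose C := cos_transform psi; pose S := sin_transform psi.
pose e xi : R := @gaussian R n (4 * a)^-1 xi.
have e_ge0 xi : 0 <= e xi by exact: gaussian_ge0.
have me : measurable_fun setT e by exact: measurable_gaussian.
have mid : measurable_fun setT (@id 'rV[R]_n) by [].
pose h (z : 'rV[R]_n * 'rV[R]_n) : R :=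
  p z.2 * cos (dotp z.1 z.2) + q z.2 * sin (dotp z.1 z.2).
have mh : measurable_fun setT h.
  apply: measurable_funD; apply: measurable_funM.
  - exact: (measurableT_comp mp).
  - by apply: measurable_cos_dotp; [exact: measurable_fst|exact: measurable_snd].
  - exact: (measurableT_comp mq).
  - by apply: measurable_sin_dotp; [exact: measurable_fst|exact: measurable_snd].
have h_le x xi : `|h (x, xi)| <= `|p xi| + `|q xi|.
  rewrite /h (le_trans (ler_normD _ _))// !normrM lerD//= ler_piMr//.
    exact: normr_cos.
  exact: normr_sin.
have ipq : (leb n).-integrable setT (EFin \o (fun xi => e xi * (`|p xi| + `|q xi|))).
  have := integrableD measurableT (int_sqr_gaussian e0 mp ip2) (int_sqr_gaussian e0 mq iq2).
  by apply: eq_integrable => // xi _; rewrite /= -EFinD -mulrDr.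
have pq0 xi : 0 <= e xi * (`|p xi| + `|q xi|) by rewrite mulr_ge0// addr_ge0.
have mf : measurable_fun setT (fun z : 'rV[R]_n * 'rV[R]_n => psi z.1 * (e z.2 * h z)).
  apply: measurable_funM; first exact: (measurableT_comp mpsi).
  by apply: measurable_funM => //; exact: (measurableT_comp me).
have f_le x xi : `|psi x * (e xi * h (x, xi))| <= gaussian 1 x * (e xi * (`|p xi| + `|q xi|)).
  rewrite normrM ler_pM// normrM (ger0_norm (e_ge0 _)) ler_wpM2l//.
have ig1 := integrable_gaussian0 n (@ltr01 R).
have F := tensor_fubini mf ig1 ipq (fun x => gaussian_ge0 _ x) pq0 f_le.
have ieh x : (leb n).-integrable setT (EFin \o (fun xi => e xi * h (x, xi))).
  apply: (@le_integrableR _ _ _ (leb n) (fun xi => e xi * h (x, xi)) (fun xi => e xi * (`|p xi| + `|q xi|))).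
  - apply: measurable_funM; first exact: me.
    exact: (measurableT_comp mh (pair1_measurable x)).
  - by move=> xi; rewrite normrM (ger0_norm (e_ge0 _)) ler_wpM2l.
  - exact: ipq.
have bd (k : 'rV[R]_n -> R) : measurable_fun setT k -> (forall x, `|k x| <= 1) ->
    (leb n).-integrable setT (EFin \o (fun x => psi x * k x)).
  move=> mk k1; apply: (integrable_le_gaussian (@ltr01 R)); first exact: measurable_funM.
  by move=> x; rewrite normrM; apply: le_trans (psi_le x); apply: ler_piMr; [exact: normr_ge0|exact: k1].
have icos xi : (leb n).-integrable setT (EFin \o (fun x => psi x * cos (dotp x xi))).
  by apply: bd => [|x]; [exact: measurable_cos_dotp|exact: normr_cos].
have isin xi : (leb n).-integrable setT (EFin \o (fun x => psi x * sin (dotp x xi))).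
  by apply: bd => [|x]; [exact: measurable_sin_dotp|exact: normr_sin].
have swapped : \int[leb n]_(x in A) (gaussian 1 x * (peak n a *
     \int[leb n]_y (W y * gaussian a (x - y)))) =
    c * \int[leb n]_xi (e xi * (p xi * C xi + q xi * S xi)).
  rewrite Rintegral_indic.
  transitivity (c * \int[leb n]_x \int[leb n]_xi (psi x * (e xi * h (x, xi)))).
    rewrite -(RintegralZl _ measurableT (tensor_integrable_F mf ig1 ipq
      (fun x => gaussian_ge0 _ x) pq0 f_le)).
    apply: eq_Rintegral => x _; rewrite (Wpq x a4).
    have -> : \int[leb n]_y (psi (x, y).1 * (e (x, y).2 * h (x, y))) =
        psi x * \int[leb n]_y (e y * h (x, y)) by rewrite -(RintegralZl _ measurableT (ieh x)).
    by rewrite /psi /h /e /=; ring.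
  rewrite F; congr (c * _); apply: eq_Rintegral => xi _.
  rewrite /C /S /cos_transform /sin_transform.
  have j1 : (leb n).-integrable setT (EFin \o (fun x => (e xi * p xi) * (psi x * cos (dotp x xi)))).
    under [X in _.-integrable _ X]eq_fun do rewrite /= EFinM.
    exact: (integrableZl measurableT _ (icos xi)).
  have j2 : (leb n).-integrable setT (EFin \o (fun x => (e xi * q xi) * (psi x * sin (dotp x xi)))).
    under [X in _.-integrable _ X]eq_fun do rewrite /= EFinM.
    exact: (integrableZl measurableT _ (isin xi)).
  rewrite mulrDr !mulrA -(RintegralZl _ measurableT (icos xi)) -(RintegralZl _ measurableT (isin xi)).
  rewrite -(RintegralD measurableT j1 j2); apply: eq_Rintegral => x _.
  by rewrite /h /=; ring.
rewrite swapped normrM (ger0_norm c0).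
have mC : measurable_fun setT C by exact: measurable_cos_transform.
have mS : measurable_fun setT S by exact: measurable_sin_transform.
set M := \int[leb n]_x @gaussian R n 1 x.
have C_le xi : `|C xi| <= M by exact: cos_transform_le.
have S_le xi : `|S xi| <= M by exact: sin_transform_le.
have bess := gaussian_bessel mpsi psi_le b0 b2.
rewrite -/C -/S in bess.
clearbody C S M.
have iCS : (leb n).-integrable setT (EFin \o (fun xi => gaussian (2 * a)^-1 xi * (C xi ^+ 2 + S xi ^+ 2))).
  apply: (@le_integrableR _ _ _ (leb n) (fun xi => gaussian (2 * a)^-1 xi * (C xi ^+ 2 + S xi ^+ 2)) (fun xi => (2 * M ^+ 2) * gaussian (2 * a)^-1 xi)).
  - apply: measurable_funM; first exact: measurable_gaussian.
    by apply: measurable_funD; apply: measurable_funX.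
  - move=> xi; rewrite ger0_norm; last by rewrite mulr_ge0 ?gaussian_ge0 ?addr_ge0 ?sqr_ge0.
    rewrite mulrC; apply: ler_wpM2r; first exact: gaussian_ge0.
    have -> : 2 * M ^+ 2 = M ^+ 2 + M ^+ 2 by ring.
    by apply: lerD; apply: ler_sqr_norm; [exact: C_le|exact: S_le].
  - under [X in _.-integrable _ X]eq_fun do rewrite /= EFinM.
    exact: (integrableZl measurableT _ (integrable_gaussian0 n b0)).
have ipq2 : (leb n).-integrable setT (EFin \o (fun xi => p xi ^+ 2 + q xi ^+ 2)).
  by have := integrableD measurableT ip2 iq2; apply: eq_integrable.
have it1 : (leb n).-integrable setT (EFin \o (fun xi => tau * (p xi ^+ 2 + q xi ^+ 2))).
  under [X in _.-integrable _ X]eq_fun do rewrite /= EFinM.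
  exact: (integrableZl measurableT _ ipq2).
have it2 : (leb n).-integrable setT (EFin \o (fun xi => tau^-1 * (gaussian (2 * a)^-1 xi * (C xi ^+ 2 + S xi ^+ 2)))).
  under [X in _.-integrable _ X]eq_fun do rewrite /= EFinM.
  exact: (integrableZl measurableT _ iCS).
have it12 : (leb n).-integrable setT (EFin \o (fun xi => tau * (p xi ^+ 2 + q xi ^+ 2) +
    tau^-1 * (gaussian (2 * a)^-1 xi * (C xi ^+ 2 + S xi ^+ 2)))).
  by have := integrableD measurableT it1 it2; apply: eq_integrable.
have pt xi : `|e xi * (p xi * C xi + q xi * S xi)| <= tau * (p xi ^+ 2 + q xi ^+ 2) +
    tau^-1 * (gaussian (2 * a)^-1 xi * (C xi ^+ 2 + S xi ^+ 2)).
  by rewrite -E2 -gaussianM; exact: young2.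
have iint : (leb n).-integrable setT (EFin \o (fun xi => e xi * (p xi * C xi + q xi * S xi))).
  apply: (@le_integrableR _ _ _ (leb n) _ _ _ pt it12).
  apply: measurable_funM; first exact: me.
  by apply: measurable_funD; apply: measurable_funM; [exact: mp|exact: mC|exact: mq|exact: mS].
apply: (@le_trans _ _ (c * (tau * \int[leb n]_x (p x ^+ 2 + q x ^+ 2) +
    tau^-1 * \int[leb n]_xi (gaussian (2 * a)^-1 xi * (C xi ^+ 2 + S xi ^+ 2))))).
  apply: ler_wpM2l; first exact: c0.
  apply: le_trans (le_normr_Rintegral measurableT iint) _.
  rewrite -(RintegralZl _ measurableT ipq2) -(RintegralZl _ measurableT iCS).
  rewrite -(RintegralD measurableT it1 it2); apply: le_Rintegral.
  - exact: measurableT.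
  - by have := integrable_abse iint; apply: eq_integrable.
  - exact: it12.
  - by move=> xi _; exact: pt.
rewrite (RintegralD measurableT ip2 iq2) mulrDr [c * (tau * _)]mulrCA -/D lerD2l.
rewrite [c * (_ * _)]mulrCA; apply: ler_wpM2l; first by rewrite invr_ge0 (ltW tau0).
rewrite /B -mulrA; apply: ler_wpM2l; first exact: c0.
apply: le_trans bess _.
rewrite KE; apply: ler_wpM2l; first by rewrite exprn_ge0 ?sqrtr_ge0.
(* The values of psi lie in the unit interval, so its square is at most psi and the bound becomes
   linear in the Gaussian measure of A. *)
rewrite [leRHS]Rintegral_indic.
apply: le_Rintegral.
- exact: measurableT.
- apply: (integrable_le_gaussian (@ltr01 R)); first exact: (measurable_funX 2 mpsi).
  move=> x; have /andP[h1 h2] := psi01 x; rewrite ger0_norm ?sqr_ge0// expr2.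
  apply: le_trans (h2); apply: ler_piMr; first exact: h1.
  by apply: le_trans h2 _; exact: gaussian_le1.
- exact: (integrable_le_gaussian (@ltr01 R) mpsi psi_le).
- move=> x _; have /andP[h1 h2] := psi01 x; rewrite expr2.
  rewrite -/(psi x); apply: ler_piMr; first exact: h1.
  by apply: le_trans h2 _; exact: gaussian_le1.
Qed.

(* The bound tau * D + B * nu A / tau on |int_A W dnu|, for A a superlevel set of W
   and the optimal tau of order 1 / lam, is Chebyshev's inequality. *)
Lemma weak_type lam : 0 < lam ->
  \int[leb n]_(x in [set x | lam <= `|W x|]) gaussian 1 x <= 8 * (B + 1) * D / lam ^+ 2.
Proof.
move=> lam0.
have iWs A : measurable A -> (leb n).-integrable A (EFin \o (fun x => gaussian 1 x * W x)).
  move=> mA; apply: (@integrableS _ _ _ _ setT) => //.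
  apply: (@le_integrableR _ _ _ (leb n) (fun x => gaussian 1 x * W x) (fun x => `|W x * gaussian 2^-1 x|)).
  - by apply: measurable_funM => //; exact: measurable_gaussian.
  - move=> x; rewrite mulrC !normrM ler_wpM2l// !(ger0_norm (gaussian_ge0 _ _)).
    by rewrite /gaussian ler_expR; have := dotp_ge0 x; lra.
  - by have := integrable_abse iW; apply: eq_integrable.
have igs (A : set 'rV[R]_n) : measurable A -> (leb n).-integrable A (EFin \o (fun x => lam * gaussian 1 x)).
  move=> mA; apply: (@integrableS _ _ _ _ setT) => //.
  under [X in _.-integrable _ X]eq_fun do rewrite /= EFinM.
  exact: (integrableZl measurableT _ (integrable_gaussian0 n (@ltr01 R))).
have ig (A : set 'rV[R]_n) : measurable A -> (leb n).-integrable A (EFin \o (fun x => gaussian 1 x)).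
  move=> mA; apply: (@integrableS _ _ _ _ setT) => //.
  exact: (integrable_gaussian0 n (@ltr01 R)).
have reg A tau := @regularization_le R n W D B mW iW D0 B0 transference_le A tau.
have half (A : set 'rV[R]_n) : measurable A ->
    lam * \int[leb n]_(x in A) gaussian 1 x <= `|\int[leb n]_(x in A) (gaussian 1 x * W x)| ->
    \int[leb n]_(x in A) gaussian 1 x <= 4 * (B + 1) * D / lam ^+ 2.
  move=> mA hA; set nu := \int[leb n]_(x in A) gaussian 1 x.
  have nu0 : 0 <= nu by apply: Rintegral_ge0 => x _; exact: gaussian_ge0.
  have B1 : 0 < B + 1 by rewrite ltr_wpDl.
  (* With tau = 2 (B + 1) / lam the second term is at most half of lam * nu and is absorbed on the
     left; B + 1 keeps tau positive even if B vanishes. *)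
  have tau0 : 0 < 2 * (B + 1) / lam by rewrite divr_gt0// mulr_gt0.
  have := le_trans hA (reg A _ mA tau0); rewrite -/nu.
  have -> : (2 * (B + 1) / lam)^-1 * (B * nu) = lam * nu / 2 * (B / (B + 1)).
    by field; rewrite !gt_eqF.
  have h1 : lam * nu / 2 * (B / (B + 1)) <= lam * nu / 2.
    rewrite ler_piMr//; first by rewrite divr_ge0// mulr_ge0// ltW.
    by rewrite ler_pdivrMr// mul1r lerDl.
  move=> h2; rewrite ler_pdivlMr ?exprn_gt0//.
  have h3 : lam * nu / 2 <= 2 * (B + 1) / lam * D by lra.
  have h4 : lam * nu / 2 * (2 * lam) <= 2 * (B + 1) / lam * D * (2 * lam).
    by rewrite ler_wpM2r// mulr_ge0// ltW.
  have -> : nu * lam ^+ 2 = lam * nu / 2 * (2 * lam) by field.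
  have -> : 4 * (B + 1) * D = 2 * (B + 1) / lam * D * (2 * lam) by field; rewrite gt_eqF.
  exact: h4.
(* On each of the two sets W has a constant sign, so its integral shows no cancellation; adding the
   two bounds with 4 gives the constant 8. *)
pose A1 := [set x : 'rV[R]_n | lam <= W x]; pose A2 := [set x : 'rV[R]_n | W x <= - lam].
have mA1 : measurable A1.
  have -> : A1 = W @^-1` `[lam, +oo[.
    by apply/seteqP; split => x /=; rewrite in_itv/= andbT.
  by rewrite -[X in measurable X]setTI; apply: mW => //; exact: measurable_itv.
have mA2 : measurable A2.
  have -> : A2 = W @^-1` `]-oo, (- lam)].
    by apply/seteqP; split => x /=; rewrite in_itv/=.
  by rewrite -[X in measurable X]setTI; apply: mW => //; exact: measurable_itv.
have D12 : [disjoint A1 & A2].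
  rewrite disj_set2E; apply/eqP/seteqP; split => // x [].
  by rewrite /A1 /A2 /= => h1 h2; exfalso; move: h1 h2; lra.
have -> : [set x | lam <= `|W x|] = A1 `|` A2.
  apply/seteqP; split => x /=; rewrite ler_normr.
    by move=> /orP[h|h]; [left|right; rewrite /A2/= lerNr].
  by move=> [h|h]; apply/orP; [left|right; rewrite lerNr].
rewrite Rintegral_setU//; last by apply: ig; exact: measurableU.
have h1 : \int[leb n]_(x in A1) gaussian 1 x <= 4 * (B + 1) * D / lam ^+ 2.
  apply: half => //; apply: le_trans (ler_norm _).
  rewrite -RintegralZl ?ig//; apply: le_Rintegral; [by []|exact: igs|exact: iWs|].
  by move=> x /= h; rewrite mulrC ler_wpM2l ?gaussian_ge0.
have h2 : \int[leb n]_(x in A2) gaussian 1 x <= 4 * (B + 1) * D / lam ^+ 2.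
  apply: half => //; rewrite -normrN; apply: le_trans (ler_norm _).
  rewrite lerNr -mulNr -RintegralZl ?ig//; apply: le_Rintegral; [by []|exact: iWs| |].
  - by have := integrableN (igs _ mA2); apply: eq_integrable => // x _; rewrite /= mulNr.
  - by move=> x /= h; rewrite mulrC ler_wpM2r ?gaussian_ge0.
apply: le_trans (lerD h1 h2) _.
by rewrite -mulrDl -mulrDl -mulrDl -natrD.
Qed.

End weak_type.

(** * Gaussian test functions *)

Section gaussian_class.
Context {R : realType} (n : nat).
Local Notation leb := (@lebesgue_rV R).
Local Notation V := 'rV[R]_n.
Implicit Types (x y m : V) (f g : V -> R).

(* A class of Schwartz functions that contains the modulated Gaussians and is
   closed under partial derivatives; the phase th makes sines cosines. *)
Inductive gaussian_class : (V -> R) -> Prop :=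
| GaussianCos b m x th of 0 < b :
    gaussian_class (fun y => gaussian b (y - m) * cos (dotp x y + th))
| GaussianCoord i f of gaussian_class f : gaussian_class (fun y => y ord0 i * f y)
| GaussianAdd f g of gaussian_class f & gaussian_class g :
    gaussian_class (fun y => f y + g y)
| GaussianScale c f of gaussian_class f : gaussian_class (fun y => c * f y).

Let e i : V := delta_mx ord0 i.

(** Differentiability and the values of the partial derivatives are bundled so that the sum, product
    and chain rules propagate both at once. *)
Definition has_partials f (df : 'I_n -> V -> R) :=
  forall y, differentiable f y /\ forall i, 'D_(e i) f y = df i y.

Lemma has_partials_coord j : has_partials (fun y => y ord0 j) (fun i _ => (j == i)%:R).
Proof.
move=> y; split; first exact: differentiable_coord.
move=> i; rewrite deriveE; last exact: differentiable_coord.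
(* The coordinate is repackaged as a linear map, whose differential is itself. *)
have @F : {linear V -> R}.
  by exists (fun N : V => N ord0 j); do 2![eexists]; do ?[constructor];
     rewrite ?mxE// => ? *; rewrite ?mxE//; move=> ?; rewrite !mxE.
rewrite (_ : (fun y : V => y ord0 j) = F)//.
rewrite diff_lin; last exact: coord_continuous.
by rewrite /F /= /e mxE eqxx.
Qed.

Lemma has_partials_add f g df dg : has_partials f df -> has_partials g dg ->
  has_partials (fun y => f y + g y) (fun i y => df i y + dg i y).
Proof.
move=> hf hg y; have [f1 f2] := hf y; have [g1 g2] := hg y; split.
  exact: differentiableD.
move=> i; rewrite -f2 -g2; apply: deriveD; exact: diff_derivable.
Qed.

Lemma has_partials_mul f g df dg : has_partials f df -> has_partials g dg ->
  has_partials (fun y => f y * g y) (fun i y => f y * dg i y + g y * df i y).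
Proof.
move=> hf hg y; have [f1 f2] := hf y; have [g1 g2] := hg y; split.
  exact: differentiableM.
move=> i; rewrite -f2 -g2; apply: deriveM; exact: diff_derivable.
Qed.

Lemma has_partials_cst c : has_partials (fun=> c) (fun _ _ => 0).
Proof.
move=> y; split; first exact: differentiable_cst.
by move=> i; rewrite derive_cst.
Qed.

Lemma has_partials_sum k (F : 'I_k -> V -> R) dF : (forall j, has_partials (F j) (dF j)) ->
  has_partials (fun y => \sum_j F j y) (fun i y => \sum_j dF j i y).
Proof.
move=> H; elim: k F dF H => [|k IH] F dF H.
  have -> : (fun y : V => \sum_(j < 0) F j y) = (fun=> 0).
    by apply/funext => y; rewrite big_ord0.
  have -> : (fun i (y : V) => \sum_(j < 0) dF j i y) = (fun _ _ => 0).
    by apply/funext => i; apply/funext => y; rewrite big_ord0.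
  exact: has_partials_cst.
have -> : (fun y : V => \sum_(j < k.+1) F j y) = (fun y => F ord0 y + \sum_j F (lift ord0 j) y).
  by apply/funext => y; rewrite big_ord_recl.
have -> : (fun i (y : V) => \sum_(j < k.+1) dF j i y) =
    (fun i y => dF ord0 i y + \sum_j dF (lift ord0 j) i y).
  by apply/funext => i; apply/funext => y; rewrite big_ord_recl.
by apply: has_partials_add => //; apply: IH.
Qed.

Lemma has_partials_comp (h h' : R -> R) f df : (forall t, is_derive t (1:R) h (h' t)) ->
  has_partials f df -> has_partials (fun y => h (f y)) (fun i y => h' (f y) * df i y).
Proof.
move=> hh hf y; have [f1 f2] := hf y.
have dh : differentiable h (f y).
  by apply/derivable1_diffP; exact: (@ex_derive _ _ _ _ _ _ _ (hh (f y))).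
split; first exact: differentiable_comp.
move=> i; rewrite deriveE; last exact: differentiable_comp.
rewrite (_ : (fun y => h (f y)) = h \o f)// diff_comp//= -(deriveE (e i) f1) f2.
have -> : 'd h (f y) (df i y) = df i y *: 'd h (f y) 1.
  by rewrite -linearZ /= /GRing.scale /= mulr1.
by rewrite -deriveE// (@derive_val _ _ _ _ _ _ _ (hh (f y))) /GRing.scale /= mulrC.
Qed.

Lemma has_partials_eq f df dg : has_partials f df -> (forall i y, df i y = dg i y) ->
  has_partials f dg.
Proof. by move=> hf E y; have [f1 f2] := hf y; split=> // i; rewrite f2. Qed.

Lemma has_partials_dotp x : has_partials (fun y => dotp x y) (fun i _ => x ord0 i).
Proof.
apply: has_partials_eq.
  apply: has_partials_sum => j; apply: has_partials_mul.
    exact: has_partials_cst.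
  exact: has_partials_coord.
move=> i y /=; rewrite (bigD1 i)//= eqxx mulr1 mulr0 addr0 big1 ?addr0// => j /negPf ji.
by rewrite ji !mulr0 addr0.
Qed.

Lemma has_partials_gaussian b m :
  has_partials (fun y => gaussian b (y - m))
    (fun i y => - (2 * b) * (y ord0 i - m ord0 i) * gaussian b (y - m)).
Proof.
have E : (fun y : V => gaussian b (y - m)) =
    (fun y => expR (- b * (\sum_j (y ord0 j + - m ord0 j) * (y ord0 j + - m ord0 j)))).
  by apply/funext => y; rewrite /gaussian /dotp; congr (expR (_ * _));
     apply: eq_bigr => j _; rewrite !mxE.
rewrite {1}E.
have hj j : has_partials (fun y : V => y ord0 j + - m ord0 j) (fun i _ => (j == i)%:R + 0).
  by apply: has_partials_add; [exact: has_partials_coord|exact: has_partials_cst].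
apply: has_partials_eq.
  apply: (has_partials_comp (h := expR) (h' := expR) (@is_derive_expR R)); apply: has_partials_mul.
    exact: has_partials_cst.
  by apply: has_partials_sum => j; apply: has_partials_mul; exact: hj.
move=> i y /=; have := congr1 (fun F => F y) E => /= <-.
rewrite mulr0 addr0 (bigD1 i)//= eqxx addr0 !mulr1 big1 ?addr0; first by ring.
by move=> j /negPf ji; rewrite ji !addr0 !mulr0 addr0.
Qed.

Lemma gaussian_class_eq f g : gaussian_class f -> f =1 g -> gaussian_class g.
Proof. by move=> h /funext <-. Qed.

(** Differentiating the cosine shifts its phase by pi / 2, and differentiating the Gaussian brings
    down the factor y_i - m_i, a coordinate minus a constant; every constructor of the class is
    there to absorb one of these effects. *)
Lemma gaussian_class_partials f : gaussian_class f ->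
  exists2 df, has_partials f df & forall i, gaussian_class (df i).
Proof.
elim=> [b m x th b0|j {}f hf [df pf cf]|{}f g hf [df pf cf] hg [dg pg cg]|c {}f hf [df pf cf]].
- exists (fun i y => gaussian b (y - m) * (cos (dotp x y + (th + pi / 2)) * x ord0 i) +
     cos (dotp x y + th) * (- (2 * b) * (y ord0 i - m ord0 i) * gaussian b (y - m))).
    apply: has_partials_mul; first exact: has_partials_gaussian.
    apply: has_partials_eq.
      apply: (has_partials_comp (@is_derive_cos R)).
      by apply: has_partials_add; [exact: has_partials_dotp|exact: has_partials_cst].
    by move=> i y /=; rewrite addr0 addrA cosDpihalf.
  move=> i; pose f0 y := gaussian b (y - m) * cos (dotp x y + th).
  have cf0 : gaussian_class f0 by exact: GaussianCos.
  apply: gaussian_class_eq.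
    apply: GaussianAdd; first exact: (GaussianScale (x ord0 i) (GaussianCos m x (th + pi / 2) b0)).
    apply: GaussianAdd; first exact: (GaussianScale (- (2 * b)) (GaussianCoord i cf0)).
    exact: (GaussianScale (2 * b * m ord0 i) cf0).
  by move=> y /=; rewrite /f0; ring.
- exists (fun i y => y ord0 j * df i y + f y * (j == i)%:R).
    by apply: has_partials_mul => //; exact: has_partials_coord.
  move=> i; apply: GaussianAdd; first exact: GaussianCoord.
  by apply: (gaussian_class_eq (GaussianScale (j == i)%:R hf)) => y; rewrite mulrC.
- exists (fun i y => df i y + dg i y); first exact: has_partials_add.
  by move=> i; exact: GaussianAdd.
- exists (fun i y => c * df i y + f y * 0).
    by apply: has_partials_mul => //; exact: has_partials_cst.
  by move=> i; apply: (gaussian_class_eq (GaussianScale c (cf i))) => y; rewrite mulr0 addr0.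
Qed.

Lemma gaussian_class_differentiable f y : gaussian_class f -> differentiable f y.
Proof. by move=> /gaussian_class_partials[df hf _]; exact: (hf y).1. Qed.

Lemma gaussian_class_derive f i : gaussian_class f -> gaussian_class ('D_(delta_mx ord0 i) f).
Proof.
move=> /gaussian_class_partials[df hf cf].
by apply: (gaussian_class_eq (cf i)) => y; rewrite (hf y).2.
Qed.

Lemma enorm_ge0 y : 0 <= enorm y. Proof. exact: sqrtr_ge0. Qed.

Lemma enorm_sqr y : enorm y ^+ 2 = dotp y y.
Proof. by rewrite sqr_sqrtr// dotp_ge0. Qed.

Lemma coord_le_enorm y i : `|y ord0 i| <= enorm y.
Proof.
rewrite -sqrtr_sqr ler_wsqrtr// /dotp (bigD1 i)//= expr2 lerDl.
by apply: sumr_ge0 => j _; rewrite -expr2 sqr_ge0.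
Qed.

Lemma gaussian_class_bound f : gaussian_class f -> forall N : nat, exists M : R,
  forall y, (1 + enorm y) ^+ N * `|f y| <= M.
Proof.
have w0 y : 0 <= 1 + enorm y by rewrite addr_ge0// enorm_ge0.
elim=> [b m x th b0|j {}f hf IH|{}f g hf IHf hg IHg|c {}f hf IH] N.
(* The weight is at most expR (N r) with r = |y|. Completing the square gives N r <= b r^2 / 2 + N^2
   / (2 b), and r^2 / 2 is at most m . m + |m - y|^2. *)
- exists (expR (N%:R ^+ 2 / (2 * b) + b * dotp m m)) => y.
  rewrite normrM (ger0_norm (gaussian_ge0 _ _)).
  apply: (@le_trans _ _ ((1 + enorm y) ^+ N * gaussian b (y - m))).
    rewrite ler_wpM2l ?exprn_ge0// ler_piMr ?gaussian_ge0//; exact: normr_cos.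
  apply: (@le_trans _ _ (expR (enorm y * N%:R) * gaussian b (y - m))).
    rewrite ler_wpM2r ?gaussian_ge0// expRM_natr lerXn2r ?nnegrE ?expR_ge0//.
    exact: expR_ge1Dx.
  rewrite gaussianBC /gaussian -expRD ler_expR.
  have := dotp_splitl m y; rewrite -enorm_sqr.
  have := enorm_ge0 y; move: (enorm y) (dotp m m) (dotp (m - y) (m - y)) => r u v r0 h.
  have h1 : b * (r ^+ 2 / 2) <= b * (u + v) by rewrite ler_pM2l.
  have h2 : 0 <= (b * r - N%:R) ^+ 2 / (2 * b) by rewrite divr_ge0 ?sqr_ge0// mulr_ge0// ltW.
  have h3 : (b * r - N%:R) ^+ 2 / (2 * b) = b * (r ^+ 2 / 2) - r * N%:R + N%:R ^+ 2 / (2 * b).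
    by field; rewrite gt_eqF.
  by move: h1 h2; rewrite h3; lra.
(* A coordinate factor costs one power of the weight. *)
- have [M HM] := IH N.+1; exists M => y; apply: le_trans (HM y).
  rewrite normrM exprSr -!mulrA ler_wpM2l ?exprn_ge0// ler_wpM2r//.
  by rewrite (le_trans (coord_le_enorm y j))// lerDr.
- have [M1 H1] := IHf N; have [M2 H2] := IHg N; exists (M1 + M2) => y.
  apply: le_trans (lerD (H1 y) (H2 y)).
  by rewrite -mulrDr ler_wpM2l ?exprn_ge0// ler_normD.
- have [M HM] := IH N; exists (`|c| * M) => y.
  by rewrite normrM mulrCA ler_wpM2l.
Qed.

Lemma gaussian_class_pderiv alpha f : gaussian_class f -> gaussian_class (pderiv alpha f).
Proof. by elim: alpha => //= i s IH hf; apply: gaussian_class_derive; exact: IH. Qed.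

Lemma pderiv_rcons s i f : pderiv (rcons s i) f = pderiv s ('D_(delta_mx ord0 i) f).
Proof. by rewrite /pderiv foldr_rcons. Qed.

(** The number k of derivatives is decoupled from the exponent N: the induction removes the
    innermost derivative, the last entry of alpha, at fixed N and for all functions of the class. *)
Lemma gaussian_class_seminorm k N f : gaussian_class f -> exists M : R,
  forall alpha y, (size alpha <= k)%N -> (1 + enorm y) ^+ N * `|pderiv alpha f y| <= M.
Proof.
elim: k f => [|k IH] f hf.
  have [M HM] := gaussian_class_bound hf N; exists M => alpha y.
  by rewrite leqn0 size_eq0 => /eqP ->; exact: HM.
have [M0 HM0] := gaussian_class_bound hf N.
have /choice[M HM] : forall i : 'I_n, exists M, forall alpha y, (size alpha <= k)%N ->
    (1 + enorm y) ^+ N * `|pderiv alpha ('D_(delta_mx ord0 i) f) y| <= M.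
  by move=> i; apply: IH; exact: gaussian_class_derive.
exists (`|M0| + \sum_i `|M i|) => alpha y.
case/lastP: alpha => [_|s i]; first by rewrite (le_trans (HM0 y))// (le_trans (ler_norm _))// lerDl sumr_ge0.
rewrite size_rcons ltnS pderiv_rcons => ss; apply: le_trans (HM i s y ss) _.
rewrite (le_trans (ler_norm _))// (bigD1 i)//= addrCA lerDl addr_ge0//.
by rewrite sumr_ge0.
Qed.

Lemma normc_le (z : R[i]) : Normc.normc z <= `|complex.Re z| + `|complex.Im z|.
Proof.
case: z => a b /=; rewrite -(ger0_norm (addr_ge0 (normr_ge0 a) (normr_ge0 b))) -sqrtr_sqr.
apply: ler_wsqrtr; rewrite sqrrD -!normrX !(ger0_norm (sqr_ge0 _)).
by rewrite lerD2r lerDl mulrn_wge0// mulr_ge0.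
Qed.

Lemma schwartz_gaussian_class f g : gaussian_class f -> gaussian_class g ->
  schwartz (fun y => f y +i* g y).
Proof.
move=> hf hg; split.
- by move=> alpha y; apply: gaussian_class_differentiable; exact: gaussian_class_pderiv.
- by move=> alpha y; apply: gaussian_class_differentiable; exact: gaussian_class_pderiv.
- move=> N.
  have [M1 H1] := gaussian_class_seminorm N N hf.
  have [M2 H2] := gaussian_class_seminorm N N hg.
  exists (M1 + M2) => alpha y sN.
  apply: le_trans (lerD (H1 alpha y sN) (H2 alpha y sN)).
  rewrite -mulrDr ler_wpM2l ?exprn_ge0 ?addr_ge0 ?enorm_ge0//.
  exact: normc_le.
Qed.

(** The function exp (i x . xi) [gaussian] b xi of xi. Its transform is a Gaussian centred at x, so
    pairing with it evaluates a regularization at the point x. *)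
Definition modulated_gaussian (b : R) x (xi : V) : R[i] :=
  (gaussian b xi * cos (dotp x xi)) +i* (gaussian b xi * sin (dotp x xi)).

Lemma schwartz_modulated_gaussian b x : 0 < b -> schwartz (modulated_gaussian b x).
Proof.
move=> b0; apply: schwartz_gaussian_class.
  by apply: (gaussian_class_eq (GaussianCos 0 x 0 b0)) => y; rewrite subr0 addr0.
apply: (gaussian_class_eq (GaussianCos 0 x (- (pi / 2)) b0)) => y.
by rewrite subr0 cosBpihalf.
Qed.

Lemma schwartz_gaussian c a x : 0 < a -> schwartz (fun y => (c * gaussian a (x - y)) +i* 0).
Proof.
move=> a0; have h := GaussianCos x 0 0 a0.
have E y : cos (dotp (0 : V) y + 0) = 1 :> R.
  by rewrite addr0 /dotp big1 ?cos0// => i _; rewrite mxE mul0r.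
apply: schwartz_gaussian_class.
  by apply: (gaussian_class_eq (GaussianScale c h)) => y; rewrite E mulr1 gaussianBC.
by apply: (gaussian_class_eq (GaussianScale 0 h)) => y; rewrite mul0r.
Qed.

(** Both parts are cosine integrals of frequency x - y: with phase 0 for the real part, and with
    phase - pi / 2 for the imaginary part, where the factor cos th vanishes. *)
Lemma fourier_modulated_gaussian b x : 0 < b ->
  fourier (modulated_gaussian b x) =
  (fun y => (Num.sqrt (pi / b) ^+ n * gaussian (4 * b)^-1 (x - y)) +i* 0).
Proof.
move=> b0; apply/funext => y; rewrite /fourier /cintegral /expi /modulated_gaussian.
congr (_ +i* _).
  rewrite -[RHS]mul1r -{1}cos0 mulrA -(Rintegral_gaussian_cos 0 (x - y) b0).
  apply: eq_Rintegral => xi _ /=; rewrite addr0 dotpBl cosB cosN sinN.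
  by ring.
have := Rintegral_gaussian_cos (- (pi / 2)) (x - y) b0.
rewrite cosN cos_pihalf !mul0r => <-.
apply: eq_Rintegral => xi _ /=; rewrite cosBpihalf dotpBl sinB cosN sinN.
by ring.
Qed.

End gaussian_class.

(** * The symbol of the propagator *)

Section symbol_bound.
Context {R : realType}.

Lemma sin_le_norm (t : R) : `|sin t| <= `|t|.
Proof.
wlog t0 : t / 0 <= t.
  move=> H; have [/H//|/ltW t0] := leP 0 t.
  by have := H (- t); rewrite oppr_ge0 sinN !normrN; apply.
have [c _] := @MVT_segment R sin cos 0 t t0 (fun x _ => is_derive_sin x)
  (continuous_subspaceT (@continuous_sin R)).
rewrite sin0 !subr0 => ->; rewrite normrM ler_piMl//.
exact: normr_cos.
Qed.

Lemma expi_sub1_sqr (th : R) : Normc.normc (expi th - 1) ^+ 2 = 2 * (1 - cos th).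
Proof.
rewrite /expi /= sqr_sqrtr; last by rewrite addr_ge0// sqr_ge0.
by have := cos2Dsin2 th; rewrite oppr0 addr0; nra.
Qed.

Lemma expi_sub1_le4 (th : R) : Normc.normc (expi th - 1) ^+ 2 <= 4.
Proof. by rewrite expi_sub1_sqr; have := cos_geN1 th; lra. Qed.

(** By the half-angle formula the left-hand side is 4 sin^2 (th / 2), and |sin v| <= |v|. *)
Lemma expi_sub1_le_sqr (th : R) : Normc.normc (expi th - 1) ^+ 2 <= th ^+ 2.
Proof.
rewrite expi_sub1_sqr.
have -> : th = th / 2 + th / 2 by field.
have := ler_sqr_norm (sin_le_norm (th / 2)).
rewrite [`|_| ^+ 2]real_normK ?num_real// cosD.
move: (th / 2) => u; have := cos2Dsin2 u; nra.
Qed.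

(* The phase is small when P <= t^(-2/a); for larger P the trivial bound 4 is
   already dominated by the right-hand side. *)
Lemma symbol_bound_powR (k a s t r P v : R) :
  0 < t <= 1 -> 0 < a < 1 -> 0 < s <= 1 -> k <= 1 -> 1 <= P -> 0 <= r -> r ^+ 2 <= P ->
  0 <= v -> v <= 4 -> v <= (t `^ k * (r + r `^ a)) ^+ 2 ->
  v <= 4 * t `^ (2 * (k + (s - 1) / a)) * P `^ s.
Proof.
move=> /andP[t0 t1] /andP[a0 a1] /andP[s0 s1] k1 P1 r0 rP v0 v4 vle.
have tn0 : t != 0 by rewrite gt_eqF.
have P0 : 0 < P by lra.
have Ps0 : 0 <= P `^ s by exact: powR_ge0.
have [Pt|tP] := leP P (t `^ (- (2 / a))).
  have vP : v <= 4 * (t `^ k) ^+ 2 * P.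
    apply: le_trans vle _; rewrite exprMn.
    have -> : 4 * (t `^ k) ^+ 2 * P = (t `^ k) ^+ 2 * (P * 4) by ring.
    rewrite ler_wpM2l ?sqr_ge0//.
    (* As P >= 1 and a < 1, both r and its power r^a are at most the square root of P. *)
    have rs : r <= Num.sqrt P by rewrite -(ger0_norm r0) -sqrtr_sqr ler_wsqrtr.
    have S1 : 1 <= Num.sqrt P by rewrite -[leLHS]sqrtr1 ler_wsqrtr.
    have ras : r `^ a <= Num.sqrt P.
      apply: (@le_trans _ _ (Num.sqrt P `^ a)).
        by apply: ge0_ler_powR => //; rewrite ?nnegrE ?sqrtr_ge0// ltW.
      by apply: ler1_powR => //; rewrite ltW.
    have : (r + r `^ a) ^+ 2 <= (2 * Num.sqrt P) ^+ 2.
      by rewrite lerXn2r ?nnegrE ?addr_ge0 ?powR_ge0 ?mulr_ge0 ?sqrtr_ge0//; lra.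
    by rewrite exprMn sqr_sqrtr ?(ltW P0)// => h; apply: le_trans h _; rewrite mulrC; lra.
  apply: le_trans vP _; rewrite -(mulrA 4) -(mulrA 4) ler_wpM2l//.
  (* The second factor is the threshold raised to the power 1 - s; it dominates the part P^(1 - s)
     of P = P^(1 - s) P^s. *)
  have -> : t `^ (2 * (k + (s - 1) / a)) = (t `^ k) ^+ 2 * t `^ (- (2 / a) * (1 - s)).
    rewrite -powR_mulrn ?powR_ge0// -powRrM -powRD ?tn0 ?implybT//.
    by congr (_ `^ _); field; rewrite gt_eqF.
  rewrite -[leRHS]mulrA ler_wpM2l ?sqr_ge0//.
  rewrite [leLHS](_ : P = P `^ (1 - s) * P `^ s); last first.
    by rewrite -powRD ?(gt_eqF P0) ?implybT// subrK powRr1// ltW.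
  rewrite ler_wpM2r// [leRHS]powRrM.
  by apply: ge0_ler_powR; rewrite ?nnegrE ?powR_ge0 ?(ltW P0)//; lra.
apply: le_trans v4 _; rewrite -mulrA ler_peMr//.
(* With P replaced by the threshold, the powers of t on the right combine to t^(2 (k - 1 / a)), at
   least 1 because t <= 1 and k <= 1 <= 1 / a. *)
have h1 : 1 <= t `^ (2 * (k - a^-1)).
  rewrite -[leLHS](powRr0 t); apply: ger_powR; first by rewrite t0.
  have : 1 <= a^-1 by rewrite invf_ge1// ltW.
  lra.
apply: le_trans h1 _.
have -> : t `^ (2 * (k - a^-1)) = t `^ (2 * (k + (s - 1) / a)) * (t `^ (- (2 / a))) `^ s.
  rewrite -powRrM -powRD ?tn0 ?implybT//; congr (_ `^ _).
  by field; rewrite gt_eqF.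
rewrite ler_wpM2l ?powR_ge0//.
by apply: ge0_ler_powR; rewrite ?nnegrE ?powR_ge0 ?(ltW P0)// ltW.
Qed.

(** For t <= 1 both t^beta and t are at most t^k with k = min (beta, 1), and |mu . xi| <= |xi| by
    Cauchy-Schwarz, so one estimate with exponent k covers both ranges of beta. *)
Lemma symbol_bound n (beta a s t sigma : R) (mu xi : 'rV[R]_n) :
  enorm mu = 1 -> 0 < a < 1 -> 0 < s <= 1 ->
  (beta <= 1 -> 1 - a * beta < s) ->
  (1 < beta -> sigma = 1 + (s - 1) / a) ->
  (beta <= 1 -> sigma = beta + (s - 1) / a) ->
  0 <= t <= 1 ->
  Normc.normc (expi (t `^ beta * dotp mu xi + t * enorm xi `^ a) - 1) ^+ 2 <=
    4 * t `^ (2 * sigma) * (1 + enorm xi ^+ 2) `^ s.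
Proof.
move=> mu1 a01 s01 hb sg1 sg2 /andP[t0 t1].
suff bound (th : R) : th = t `^ beta * dotp mu xi + t * enorm xi `^ a ->
    Normc.normc (expi th - 1) ^+ 2 <= 4 * t `^ (2 * sigma) * (1 + enorm xi ^+ 2) `^ s.
  exact: (bound _ erefl).
move=> thE.
have r0 := enorm_ge0 xi.
move: t0; rewrite le_eqVlt => /predU1P[t0|t0].
  (* At base 0, [powR] is 0 for every nonzero exponent; beta = 0 is excluded because 1 - a * beta <
     s would then contradict s <= 1. *)
  have th0 : th = 0.
    rewrite thE -t0 mul0r addr0 powR0 ?mul0r//; apply/eqP => b0.
    by have := hb; rewrite b0; move: s01 => /andP[? ?]; lra.
  apply: le_trans (expi_sub1_le_sqr _) _.
  by rewrite th0 expr0n/= !mulr_ge0 ?powR_ge0.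
have t01 : 0 < t <= 1 by rewrite t0.
pose k := Num.min beta 1.
have k1 : k <= 1 by rewrite ge_min lexx orbT.
have kb : k <= beta by rewrite ge_min lexx.
have -> : sigma = k + (s - 1) / a.
  rewrite /k; have [b1|b1] := leP beta 1; first by rewrite sg2.
  by rewrite sg1.
apply: (@symbol_bound_powR k a s t (enorm xi)) => //.
- by rewrite lerDl sqr_ge0.
- by rewrite lerDr.
- by rewrite sqr_ge0.
- exact: expi_sub1_le4.
apply: le_trans (expi_sub1_le_sqr _) _.
have tb : t `^ beta <= t `^ k by exact: ger_powR.
have tt : t <= t `^ k by rewrite -{1}(powRr1 (ltW t0)); exact: ger_powR.
have hdot : `|dotp mu xi| <= enorm xi.
  rewrite -sqrtr_sqr; apply: ler_wsqrtr; apply: le_trans (dotp_sqr_le _ _) _.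
  by rewrite -[dotp mu mu]enorm_sqr mu1 expr1n mul1r.
apply: ler_sqr_norm; rewrite thE; apply: le_trans (ler_normD _ _) _.
rewrite !normrM (ger0_norm (powR_ge0 _ _)) (ger0_norm (ltW t0)) (ger0_norm (powR_ge0 _ _)) mulrDr.
by apply: lerD; apply: ler_pM; rewrite ?powR_ge0 ?(ltW t0).
Qed.

End symbol_bound.

(** * Almost everywhere convergence *)

Section gaussian_pairs.
Context {R : realType} (n : nat).
Local Notation leb := (@lebesgue_rV R).
Local Notation V := 'rV[R]_n.
Implicit Types (G h : V -> R[i]) (z w : R[i]).

Lemma complex_ReM z w :
  complex.Re (z * w) = complex.Re z * complex.Re w - complex.Im z * complex.Im w.
Proof. by case: z w => [a b] [c d]. Qed.

Lemma complex_ImM z w :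
  complex.Im (z * w) = complex.Re z * complex.Im w + complex.Im z * complex.Re w.
Proof. by case: z w => [a b] [c d]. Qed.

Lemma complex_ReB z w : complex.Re (z - w) = complex.Re z - complex.Re w.
Proof. by case: z w => [a b] [c d]. Qed.

Lemma complex_ImB z w : complex.Im (z - w) = complex.Im z - complex.Im w.
Proof. by case: z w => [a b] [c d]. Qed.

Lemma normc_sqr z : Normc.normc z ^+ 2 = complex.Re z ^+ 2 + complex.Im z ^+ 2.
Proof. by case: z => a b /=; rewrite sqr_sqrtr// addr_ge0 ?sqr_ge0. Qed.

Lemma cmeasurableB G h : cmeasurable G -> cmeasurable h -> cmeasurable (fun x => G x - h x).
Proof.
move=> [g1 g2] [h1 h2]; split.
  by under eq_fun do rewrite complex_ReB; exact: measurable_funB.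
by under eq_fun do rewrite complex_ImB; exact: measurable_funB.
Qed.

Lemma cmeasurableM G h : cmeasurable G -> cmeasurable h -> cmeasurable (fun x => G x * h x).
Proof.
move=> [g1 g2] [h1 h2]; split.
  by under eq_fun do rewrite complex_ReM; apply: measurable_funB; exact: measurable_funM.
by under eq_fun do rewrite complex_ImM; apply: measurable_funD; exact: measurable_funM.
Qed.

Lemma cintegrableB G h : cintegrable G -> cintegrable h -> cintegrable (fun x => G x - h x).
Proof.
move=> [g1 g2] [h1 h2]; split.
  have := integrableB measurableT g1 h1.
  by apply: eq_integrable => // x _; rewrite /= complex_ReB.
have := integrableB measurableT g2 h2.
by apply: eq_integrable => // x _; rewrite /= complex_ImB.
Qed.

Lemma cintegralB G h : cintegrable G -> cintegrable h ->
  cintegral (fun x => G x - h x) = cintegral G - cintegral h.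
Proof.
move=> [g1 g2] [h1 h2]; apply/eqP; rewrite eq_complex complex_ReB complex_ImB /=.
apply/andP; split; apply/eqP.
  by rewrite -(RintegralB measurableT g1 h1); apply: eq_Rintegral => x _; rewrite complex_ReB.
by rewrite -(RintegralB measurableT g2 h2); apply: eq_Rintegral => x _; rewrite complex_ImB.
Qed.

(* The identity "h is the Fourier transform of G", tested on modulated Gaussians
   only: this is all that is needed, and it makes sense for G locally integrable
   of moderate growth without invoking Plancherel's theorem. *)
Definition gaussian_pair G h := forall (b : R) (x : V), 0 < b ->
  [/\ cintegrable (fun y => G y * fourier (modulated_gaussian b x) y),
      cintegrable (fun xi => h xi * modulated_gaussian b x xi) &
      cintegral (fun y => G y * fourier (modulated_gaussian b x) y) =
      cintegral (fun xi => h xi * modulated_gaussian b x xi)].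

Lemma gaussian_pairB G1 h1 G2 h2 : gaussian_pair G1 h1 -> gaussian_pair G2 h2 ->
  gaussian_pair (fun y => G1 y - G2 y) (fun xi => h1 xi - h2 xi).
Proof.
move=> H1 H2 b x b0; have [a1 a2 a3] := H1 b x b0; have [c1 c2 c3] := H2 b x b0.
rewrite (_ : (fun y => (G1 y - G2 y) * _) = (fun y => G1 y * fourier (modulated_gaussian b x) y
  - G2 y * fourier (modulated_gaussian b x) y)); last by apply/funext => y; rewrite mulrBl.
rewrite (_ : (fun xi => (h1 xi - h2 xi) * _) = (fun xi => h1 xi * modulated_gaussian b x xi
  - h2 xi * modulated_gaussian b x xi)); last by apply/funext => y; rewrite mulrBl.
split; [exact: cintegrableB|exact: cintegrableB|].
by rewrite !cintegralB// a3 c3.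
Qed.

Lemma schwartz_fourier_modulated_gaussian b (x : V) : 0 < b ->
  schwartz (fourier (modulated_gaussian b x)).
Proof.
move=> b0; rewrite fourier_modulated_gaussian//; apply: schwartz_gaussian.
by rewrite invr_gt0 mulr_gt0.
Qed.

(** The value of u at the transform of a modulated Gaussian can be read in two ways: through f, as
    this transform is again Schwartz, and through uhat. *)
Lemma represents_gaussian_pair u f uhat :
  represents u f -> represents (distr_fourier u) uhat -> gaussian_pair f uhat.
Proof.
move=> [_ Hf] [_ Hh] b x b0.
have [i1 e1] := Hf _ (schwartz_fourier_modulated_gaussian x b0).
have [i2 e2] := Hh _ (schwartz_modulated_gaussian x b0).
by split => //; rewrite -/(distr_of f _) -e1 -/(distr_of uhat _) -e2.
Qed.

Lemma integrable_sqr_gaussian (k : V -> R) a (x : V) : 0 < a -> measurable_fun setT k ->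
  (leb n).-integrable setT (EFin \o (fun y => k y ^+ 2)) ->
  (leb n).-integrable setT (EFin \o (fun y => k y * gaussian a (x - y))).
Proof.
move=> a0 mk ik.
have a20 : 0 < a + a by rewrite addr_gt0.
apply: (@le_integrableR _ _ _ (leb n) (fun y => k y * gaussian a (x - y))
  (fun y => gaussian (a + a) (y - x) + k y ^+ 2)).
- by apply: measurable_funM => //; apply: measurable_gaussian; exact: measurable_fun_subrV.
- move=> y; rewrite -gaussianM gaussianBC normrM (ger0_norm (gaussian_ge0 _ _)).
  rewrite -[k y ^+ 2]real_normK ?num_real//.
  move: (gaussian a (y - x)) `|k y| (gaussian_ge0 a (y - x)) (normr_ge0 (k y)) => p q p0 q0.
  have := sqr_ge0 (p - q); nra.
- have := integrableD measurableT (integrable_gaussian x a20) ik.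
  by apply: eq_integrable.
Qed.

Lemma integrable_sqr_part (G : V -> R[i]) (k : V -> R) : square_integrable G ->
  measurable_fun setT k -> (forall x, k x ^+ 2 <= Normc.normc (G x) ^+ 2) ->
  (leb n).-integrable setT (EFin \o (fun y => k y ^+ 2)).
Proof.
move=> [[m1 m2] iG] mk kG.
apply: (@le_integrableR _ _ _ (leb n) (fun y => k y ^+ 2) (fun y => Normc.normc (G y) ^+ 2)).
- exact: measurable_funX.
- by move=> y; rewrite ger0_norm ?sqr_ge0.
- apply/integrableP; split.
    apply/measurable_EFinP; under eq_fun do rewrite normc_sqr.
    by apply: measurable_funD; exact: measurable_funX.
  apply: le_lt_trans iG; rewrite le_eqVlt; apply/orP; left; apply/eqP.
  by apply: eq_integral => y _ /=; rewrite ger0_norm ?sqr_ge0.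
Qed.

(** Here the distribution is defined by g itself, so the equality of pairings is immediate; the
    integrability of g against a Gaussian comes from the product of two square integrable
    functions. *)
Lemma square_integrable_gaussian_pair g h :
  square_integrable g -> represents (distr_fourier (distr_of g)) h -> gaussian_pair g h.
Proof.
move=> sg [_ Hh] b x b0.
have [i2 e2] := Hh _ (schwartz_modulated_gaussian x b0).
split => //; have a0 : 0 < (4 * b)^-1 by rewrite invr_gt0 mulr_gt0.
have [[m1 m2] _] := sg.
have j1 : (leb n).-integrable setT (EFin \o (fun y => complex.Re (g y) ^+ 2)).
  apply: (integrable_sqr_part sg) => // y.
  by rewrite normc_sqr lerDl sqr_ge0.
have j2 : (leb n).-integrable setT (EFin \o (fun y => complex.Im (g y) ^+ 2)).
  apply: (integrable_sqr_part sg) => // y.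
  by rewrite normc_sqr lerDr sqr_ge0.
rewrite fourier_modulated_gaussian//; set c := _ ^+ n; split.
  have := integrableZl measurableT c (integrable_sqr_gaussian x a0 m1 j1).
  by apply: eq_integrable => // y _; rewrite complex_ReM /= mulr0 subr0 -EFinM mulrCA.
have := integrableZl measurableT c (integrable_sqr_gaussian x a0 m2 j2).
by apply: eq_integrable => // y _; rewrite complex_ImM /= mulr0 add0r -EFinM mulrCA.
Qed.

Lemma ae_eq_integrable (p q : V -> R) : {ae leb n, forall x, p x = q x} ->
  measurable_fun setT q -> (leb n).-integrable setT (EFin \o p) ->
  (leb n).-integrable setT (EFin \o q) /\ \int[leb n]_x p x = \int[leb n]_x q x.
Proof.
move=> pq mq ip.
have mp : measurable_fun setT (EFin \o p) := measurable_int _ ip.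
have mq' : measurable_fun setT (EFin \o q) by exact/measurable_EFinP.
split.
  apply/integrableP; split => //.
  have /integrableP[_] := ip; apply: le_lt_trans; rewrite le_eqVlt; apply/orP; left; apply/eqP.
  apply: ae_eq_integral => //; [exact: measurableT_comp|exact: measurableT_comp|].
  by apply: filterS pq => x pqx _ /=; rewrite pqx.
rewrite /Rintegral; congr fine; apply: ae_eq_integral => //.
by apply: filterS pq => x pqx _ /=; rewrite pqx.
Qed.

Lemma cmeasurable_modulated_gaussian b (x : V) : cmeasurable (modulated_gaussian b x).
Proof.
split; apply: measurable_funM; [exact: measurable_gaussian| |exact: measurable_gaussian|].
  exact: measurable_cos_dotp.
exact: measurable_sin_dotp.
Qed.

Lemma gaussian_pair_ae G h h' : gaussian_pair G h -> cmeasurable h' ->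
  {ae leb n, forall xi, h xi = h' xi} -> gaussian_pair G h'.
Proof.
move=> H mh' hh' b x b0; have [i1 [i2 i2'] e] := H b x b0.
have [m1 m2] := cmeasurableM mh' (cmeasurable_modulated_gaussian b x).
have [j1 e1] : (leb n).-integrable setT (EFin \o (fun xi => complex.Re (h' xi * modulated_gaussian b x xi))) /\
    \int[leb n]_xi complex.Re (h xi * modulated_gaussian b x xi) = \int[leb n]_xi complex.Re (h' xi * modulated_gaussian b x xi).
  by apply: ae_eq_integrable => //; apply: filterS hh' => xi ->.
have [j2 e2] : (leb n).-integrable setT (EFin \o (fun xi => complex.Im (h' xi * modulated_gaussian b x xi))) /\
    \int[leb n]_xi complex.Im (h xi * modulated_gaussian b x xi) = \int[leb n]_xi complex.Im (h' xi * modulated_gaussian b x xi).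
  by apply: ae_eq_integrable => //; apply: filterS hh' => xi ->.
split => //; rewrite e /cintegral; by rewrite e1 e2.
Qed.

(** Equal to (2 pi)^-n, the constant of Fourier inversion, in a form that multiplies directly with
    the Gaussian masses. *)
Definition inversion_const : R := Num.sqrt (4 * pi ^+ 2)^-1 ^+ n.

Lemma inversion_const_ge0 : 0 <= inversion_const.
Proof. by rewrite exprn_ge0// sqrtr_ge0. Qed.

(** The scale a drops out when the kernel is traded for its dual Gaussian, so the constant c of
    [weak_type] can be the same for all a. *)
Lemma peak_inversion_const a : 0 < a ->
  peak n a = inversion_const * Num.sqrt (pi / (4 * a)^-1) ^+ n.
Proof.
move=> a0; rewrite /peak /inversion_const -exprMn -sqrtrM; last first.
  by rewrite invr_ge0 mulr_ge0// sqr_ge0.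
congr (Num.sqrt _ ^+ n); rewrite invrK.
have pn0 : pi != 0 :> R by rewrite gt_eqF// pi_gt0.
have an0 : a != 0 by rewrite gt_eqF.
by move: (pi : R) pn0 => p pn0; field.
Qed.

(** For b = (4 a)^-1 the transform of the modulated Gaussian is a multiple of [gaussian a (x - y)].
    Taking real and imaginary parts of the pairing yields the identities that [weak_type] takes as
    hypothesis [Wpq]. *)
Lemma gaussian_pair_parts G h a (x : V) : gaussian_pair G h -> 0 < a ->
  [/\ (leb n).-integrable setT (EFin \o (fun y => complex.Re (G y) * gaussian a (x - y))),
      (leb n).-integrable setT (EFin \o (fun y => complex.Im (G y) * gaussian a (x - y))),
      peak n a * \int[leb n]_y (complex.Re (G y) * gaussian a (x - y)) =
      inversion_const * \int[leb n]_xi (gaussian (4 * a)^-1 xi *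
        (complex.Re (h xi) * cos (dotp x xi) + - complex.Im (h xi) * sin (dotp x xi))) &
      peak n a * \int[leb n]_y (complex.Im (G y) * gaussian a (x - y)) =
      inversion_const * \int[leb n]_xi (gaussian (4 * a)^-1 xi *
        (complex.Im (h xi) * cos (dotp x xi) + complex.Re (h xi) * sin (dotp x xi)))].
Proof.
move=> H a0; have b0 : 0 < (4 * a)^-1 by rewrite invr_gt0 mulr_gt0.
have [[i1 i2] _] := H (4 * a)^-1 x b0.
rewrite fourier_modulated_gaussian// in i1 i2 *.
have E : (4 * (4 * a)^-1)^-1 = a by field; rewrite gt_eqF.
rewrite E in i1 i2 *; set k := Num.sqrt (pi / (4 * a)^-1) ^+ n in i1 i2 *.
have k0 : k != 0.
  rewrite expf_neq0// gt_eqF// sqrtr_gt0 divr_gt0// pi_gt0//.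
have j1 : (leb n).-integrable setT (EFin \o (fun y => complex.Re (G y) * gaussian a (x - y))).
  have := integrableZl measurableT k^-1 i1; apply: eq_integrable => // y _.
  rewrite /= -EFinM; congr EFin.
  rewrite complex_ReM /= mulr0 subr0 (mulrCA _ k); exact: mulKf.
have j2 : (leb n).-integrable setT (EFin \o (fun y => complex.Im (G y) * gaussian a (x - y))).
  have := integrableZl measurableT k^-1 i2; apply: eq_integrable => // y _.
  rewrite /= -EFinM; congr EFin.
  rewrite complex_ImM /= mulr0 add0r (mulrCA _ k); exact: mulKf.
move=> /eqP; rewrite eq_complex /= => /andP[/eqP e1 /eqP e2].
split => //; rewrite peak_inversion_const// -/k -mulrA; congr (_ * _).
  rewrite -(RintegralZl k measurableT j1).
  transitivity (\int[leb n]_y complex.Re (G y * ((k * gaussian a (x - y)) +i* 0))).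
    by apply: eq_Rintegral => y _; rewrite complex_ReM /= mulr0 subr0 mulrCA.
  by rewrite e1; apply: eq_Rintegral => xi _; rewrite complex_ReM /=; ring.
rewrite -(RintegralZl k measurableT j2).
transitivity (\int[leb n]_y complex.Im (G y * ((k * gaussian a (x - y)) +i* 0))).
  by apply: eq_Rintegral => y _; rewrite complex_ImM /= mulr0 add0r mulrCA.
by rewrite e2; apply: eq_Rintegral => xi _; rewrite complex_ImM /=; ring.
Qed.

(** The constant 8 * (B + 1) of [weak_type] at c = [inversion_const], times the factor c contained
    in D; as B is then 1, its value is 16 (2 pi)^-n. *)
Definition weak_type_const : R :=
  8 * (inversion_const * Num.sqrt (4 * pi ^+ 2) ^+ n + 1) * inversion_const.

Lemma gaussian_pair_weak_type G h lam : gaussian_pair G h -> cmeasurable G -> cmeasurable h ->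
  (leb n).-integrable setT (EFin \o (fun xi => complex.Re (h xi) ^+ 2)) ->
  (leb n).-integrable setT (EFin \o (fun xi => complex.Im (h xi) ^+ 2)) -> 0 < lam ->
  let N := \int[leb n]_xi (complex.Re (h xi) ^+ 2) + \int[leb n]_xi (complex.Im (h xi) ^+ 2) in
  \int[leb n]_(x in [set x | lam <= `|complex.Re (G x)|]) gaussian 1 x <=
    weak_type_const * N / lam ^+ 2 /\
  \int[leb n]_(x in [set x | lam <= `|complex.Im (G x)|]) gaussian 1 x <=
    weak_type_const * N / lam ^+ 2.
Proof.
move=> H [mG1 mG2] [mh1 mh2] i1 i2 lam0 N.
have h0 : 0 < 2^-1 :> R by rewrite invr_gt0.
have [jr ji _ _] := gaussian_pair_parts 0 H h0.
have jr' : (leb n).-integrable setT (fun y => (complex.Re (G y) * gaussian 2^-1 y)%:E).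
  by move: jr; apply: eq_integrable => // y _ /=; rewrite gaussianBC subr0.
have ji' : (leb n).-integrable setT (fun y => (complex.Im (G y) * gaussian 2^-1 y)%:E).
  by move: ji; apply: eq_integrable => // y _ /=; rewrite gaussianBC subr0.
have mN2 : measurable_fun setT (fun xi => - complex.Im (h xi)) by exact: measurableT_comp.
have i2' : (leb n).-integrable setT (fun xi => ((- complex.Im (h xi)) ^+ 2)%:E).
  by move: i2; apply: eq_integrable => // y _ /=; rewrite sqrrN.
have EN : \int[leb n]_xi ((- complex.Im (h xi)) ^+ 2) = \int[leb n]_xi (complex.Im (h xi) ^+ 2).
  by apply: eq_Rintegral => xi _; rewrite sqrrN.
split.
  have := @weak_type R n _ _ _ inversion_const mG1 jr' mh1 mN2 i1 i2' inversion_const_ge0 _ lam lam0.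
  rewrite EN /weak_type_const -/N !mulrA; apply => a x a4.
  by have [_ _ -> _] := gaussian_pair_parts x H (lt_le_trans (ltr0n _ 4) a4).
have := @weak_type R n _ _ _ inversion_const mG2 ji' mh2 mh1 i2 i1 inversion_const_ge0 _ lam lam0.
have -> : \int[leb n]_x (complex.Im (h x) ^+ 2) + \int[leb n]_x (complex.Re (h x) ^+ 2) = N.
  by rewrite addrC.
rewrite /weak_type_const !mulrA; apply => a x a4.
by have [_ _ _ ->] := gaussian_pair_parts x H (lt_le_trans (ltr0n _ 4) a4).
Qed.

End gaussian_pairs.

(** * Null sets and Borel-Cantelli through the Gaussian measure *)

Section null_sets.
Context {R : realType} (n : nat).
Local Notation leb := (@lebesgue_rV R).
Local Notation V := 'rV[R]_n.

Lemma Rintegral0 : \int[leb n]_x (0 : R) = 0.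
Proof. by rewrite /Rintegral integral0. Qed.

Lemma measurable_ge_norm (p : V -> R) (lam : R) : measurable_fun setT p ->
  measurable [set x | lam <= `|p x|].
Proof.
move=> mp; have -> : [set x | lam <= `|p x|] = (fun x => `|p x|) @^-1` `[lam, +oo[.
  by apply/seteqP; split => x /=; rewrite in_itv/= andbT.
rewrite -[X in measurable X]setTI.
by apply: (measurableT_comp (@normr_measurable R setT) mp) => //; exact: measurable_itv.
Qed.

(** The Gaussian density is positive everywhere, so statements that hold almost everywhere transfer
    from the Gaussian to Lebesgue measure. *)
Lemma gaussian_null (A : set V) : measurable A ->
  \int[leb n]_(x in A) gaussian 1 x <= 0 -> leb n A = 0%E.
Proof.
move=> mA h.
have iA : (leb n).-integrable A (EFin \o (fun x => gaussian 1 x)).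
  apply: (@integrableS _ _ _ _ setT) => //.
  exact: (integrable_gaussian0 n (@ltr01 R)).
have fin := integrable_fin_num mA iA.
have E0 : (\int[leb n]_(x in A) `|(gaussian 1 x)%:E| = 0)%E.
  under eq_integral do rewrite gee0_abs ?lee_fin ?gaussian_ge0//.
  apply/eqP; rewrite eq_le integral_ge0 ?andbT; last first.
    by move=> x _; rewrite lee_fin gaussian_ge0.
  by rewrite -(fineK fin) lee_fin.
have mg : measurable_fun A (EFin \o (fun x : V => gaussian 1 x)) := measurable_int _ iA.
have [N [mN N0 AN]] := (ae_eq_integral_abs (leb n) mA mg).1 E0.
apply/eqP; rewrite eq_le measure_ge0 andbT -N0; apply: le_measure; rewrite ?inE//.
apply: subset_trans AN => x Ax /= /(_ Ax) [] /eqP.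
by rewrite gt_eqF// expR_gt0.
Qed.

(** The weak-type inequality applies with p = q = 0, and then every superlevel set of |W| has
    Gaussian measure zero. This is the uniqueness principle behind representatives of
    distributions. *)
Lemma gaussian_orthogonal_ae0 (W : V -> R) : measurable_fun setT W ->
  (forall a x, 0 < a -> (leb n).-integrable setT (EFin \o (fun y => W y * gaussian a (x - y)))) ->
  (forall a x, 0 < a -> \int[leb n]_y (W y * gaussian a (x - y)) = 0) ->
  {ae leb n, forall x, W x = 0}.
Proof.
move=> mW iW W0.
have h0 : 0 < 2^-1 :> R by rewrite invr_gt0.
have iW' : (leb n).-integrable setT (fun y => (W y * gaussian 2^-1 y)%:E).
  by have := iW _ 0 h0; apply: eq_integrable => // y _ /=; rewrite gaussianBC subr0.
have m0 : measurable_fun setT (fun _ : V => 0 : R) by [].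
have i0 : (leb n).-integrable setT (fun _ : V => ((0 : R) ^+ 2)%:E).
  by rewrite expr0n; exact: integrable0.
have nul (k : nat) : leb n [set x | k.+1%:R^-1 <= `|W x|] = 0%E.
  apply: gaussian_null; first exact: measurable_ge_norm.
  have k0 : 0 < k.+1%:R^-1 :> R by rewrite invr_gt0.
  have := @weak_type R n W (fun=> 0) (fun=> 0) 1 mW iW' m0 m0 i0 i0 ler01 _ _ k0.
  have -> : \int[leb n]_x ((0 : R) ^+ 2) = 0 by rewrite expr0n /= Rintegral0.
  rewrite addr0 !mulr0 mul0r; apply => a x a4.
  rewrite W0 ?(lt_le_trans (ltr0n _ 4) a4)// mulr0.
  under eq_Rintegral do rewrite !mul0r addr0 mulr0.
  by rewrite Rintegral0 mulr0.
have [|N [mN N0 UN]] := @negligible_bigcup _ _ _ (leb n) (fun k => [set x : V | k.+1%:R^-1 <= `|W x|]).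
  move=> k; exists [set x | k.+1%:R^-1 <= `|W x|]; split => //; last exact: nul.
  exact: measurable_ge_norm.
exists N; split => // x /= Wx; apply: UN.
have Wx0 : 0 < `|W x| by rewrite normr_gt0; apply/eqP.
exists (Num.truncn `|W x|^-1) => //=.
rewrite -[leRHS]invrK lef_pV2 ?posrE ?invr_gt0//; apply: ltW; exact: truncnS_gt.
Qed.

(** The sum of the indicators weighted by the Gaussian is integrable, hence finite almost
    everywhere. Where it is finite its tails tend to 0, and a tail below [gaussian 1 x] contains no
    index k with [A k x], since that term alone equals [gaussian 1 x]. *)
Lemma gaussian_borel_cantelli (A : (set V)^nat) (tau : nat -> R) :
  (forall k, measurable (A k)) -> (forall k, 0 <= tau k) ->
  (forall k, \int[leb n]_(x in A k) gaussian 1 x <= tau k) ->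
  (\sum_(k <oo) (tau k)%:E < +oo)%E ->
  {ae leb n, forall x, \forall k \near \oo, ~ A k x}.
Proof.
move=> mA tau0 Atau stau.
pose f k (x : V) : \bar R := ((gaussian 1 x)%:E * (\1_(A k) x)%:E)%E.
have f0 k x : (0 <= f k x)%E by rewrite mule_ge0// lee_fin gaussian_ge0.
have mf k : measurable_fun setT (f k).
  apply: emeasurable_funM; apply/measurable_EFinP; first exact: measurable_gaussian.
  exact: measurable_indic.
have intf k : (\int[leb n]_x f k x <= (tau k)%:E)%E.
  have iA : (leb n).-integrable (A k) (EFin \o (fun x => gaussian 1 x)).
    apply: (@integrableS _ _ _ _ setT) => //.
    exact: (integrable_gaussian0 n (@ltr01 R)).
  have fin : (\int[leb n]_(x in A k) (gaussian 1 x)%:E)%E \is a fin_num.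
    exact: (integrable_fin_num (mA k) iA).
  have -> : (\int[leb n]_x f k x = \int[leb n]_(x in A k) (gaussian 1 x)%:E)%E.
    rewrite [RHS]integral_mkcond; apply: eq_integral => x _.
    by rewrite /f patchE indicE; case: ifPn; rewrite ?mule1 ?mule0.
  by rewrite -(fineK fin) lee_fin; exact: Atau.
have ifs : (leb n).-integrable setT (fun x => \sum_(k <oo) f k x)%E.
  apply/integrableP; split; first exact: ge0_emeasurable_sum.
  under eq_integral do rewrite gee0_abs ?nneseries_ge0//.
  rewrite integral_nneseries//; apply: le_lt_trans stau.
  by apply: lee_nneseries => // k _ _; exact: integral_ge0.
have := integrable_ae measurableT ifs; apply: filterS => x /(_ I) fin.
have fx : (\sum_(k <oo) f k x < +oo)%E by rewrite ltey_eq fin.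
have tl := nneseries_tail_cvg fx (fun k _ => f0 k x).
have g0 : (0 < (gaussian 1 x)%:E)%E by rewrite lte_fin expR_gt0.
have : \forall N \near \oo, (\sum_(N <= k <oo) f k x < (gaussian 1 x)%:E)%E.
  have /fine_cvgP[h1 /cvgr_lt h2] := tl.
  have h3 := h2 (gaussian 1 x) (expR_gt0 _).
  by near=> N; rewrite -[X in (X < _)%E]fineK ?lte_fin; near: N.
apply: filterS => k hk Akx; move: hk; apply/negP; rewrite -leNgt.
apply: (@le_trans _ _ (f k x)).
  by rewrite /f indicE mem_set// mule1.
have := @nneseries_lim_ge R (fun k => f k x) xpredT k k.+1 (fun k _ _ => f0 k x).
by rewrite big_nat1.
Unshelve. all: by end_near. Qed.

End null_sets.

(** * Uniqueness of representatives and summation of the bounds *)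

Section convergence.
Context {R : realType} (n : nat).
Local Notation leb := (@lebesgue_rV R).
Local Notation V := 'rV[R]_n.

(** The difference of two representatives is orthogonal to all translated Gaussians. The lemma
    identifies the transforms of u that [sobolev] and [propagated] provide separately. *)
Lemma represents_ae_eq (U : distr R n) (h h' : V -> R[i]) :
  represents U h -> represents U h' -> {ae leb n, forall x, h x = h' x}.
Proof.
move=> [mh Hh] [mh' Hh'].
have [mB1 mB2] := cmeasurableB mh mh'.
have D a x : 0 < a ->
    [/\ (leb n).-integrable setT (EFin \o (fun y => complex.Re (h y - h' y) * gaussian a (x - y))),
        (leb n).-integrable setT (EFin \o (fun y => complex.Im (h y - h' y) * gaussian a (x - y))),
        \int[leb n]_y (complex.Re (h y - h' y) * gaussian a (x - y)) = 0 &
        \int[leb n]_y (complex.Im (h y - h' y) * gaussian a (x - y)) = 0].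
  move=> a0; have sg := schwartz_gaussian 1 x a0.
  have [i1 e1] := Hh _ sg; have [i2 e2] := Hh' _ sg.
  have [j1 j2] := cintegrableB i1 i2.
  have e := cintegralB i1 i2.
  rewrite -/(distr_of h _) -e1 -/(distr_of h' _) -e2 subrr in e.
  move/eqP: e; rewrite eq_complex => /andP[/eqP e3 /eqP e4].
  split.
  - by move: j1; apply: eq_integrable => // y _; rewrite -mulrBl complex_ReM /= mulr0 subr0 mul1r.
  - by move: j2; apply: eq_integrable => // y _; rewrite -mulrBl complex_ImM /= mulr0 add0r mul1r.
  - by rewrite -[RHS]e3; apply: eq_Rintegral => y _; rewrite -mulrBl complex_ReM /= mulr0 subr0 mul1r.
  - by rewrite -[RHS]e4; apply: eq_Rintegral => y _; rewrite -mulrBl complex_ImM /= mulr0 add0r mul1r.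
have r0 : {ae leb n, forall x, complex.Re (h x - h' x) = 0}.
  by apply: gaussian_orthogonal_ae0 => // a x a0; have [] := D a x a0.
have i0 : {ae leb n, forall x, complex.Im (h x - h' x) = 0}.
  by apply: gaussian_orthogonal_ae0 => // a x a0; have [] := D a x a0.
apply: filterS2 r0 i0 => x; rewrite complex_ReB complex_ImB => /subr0_eq er /subr0_eq ei.
by apply/eqP; rewrite eq_complex er ei !eqxx.
Qed.

Lemma measurable_enorm : measurable_fun setT (@enorm R n).
Proof.
have ms : measurable_fun setT (Num.sqrt : R -> R).
  by apply: continuous_measurable_fun; exact: sqrt_continuous.
by apply: (measurableT_comp ms); exact: measurable_fun_dotp.
Qed.

Lemma cmeasurable_expi (th : V -> R) : measurable_fun setT th -> cmeasurable (fun xi => expi (th xi)).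
Proof.
move=> mth; split => /=; (apply: measurableT_comp mth; apply: continuous_measurable_fun).
  exact: continuous_cos.
exact: continuous_sin.
Qed.

Lemma measurable_normc_sqr (h : V -> R[i]) : cmeasurable h ->
  measurable_fun setT (fun x => Normc.normc (h x) ^+ 2).
Proof.
move=> [m1 m2]; under eq_fun do rewrite normc_sqr.
by apply: measurable_funD; exact: measurable_funX.
Qed.

Lemma sobolev_norm_integrable s (uhat : V -> R[i]) : cmeasurable uhat ->
  (sobolev_norm s uhat < +oo)%E ->
  (leb n).-integrable setT (EFin \o (fun xi => (1 + enorm xi ^+ 2) `^ s * Normc.normc (uhat xi) ^+ 2)).
Proof.
move=> mu fin; apply/integrableP; split.
  apply/measurable_EFinP; apply: measurable_funM; last exact: measurable_normc_sqr.
  apply: (measurableT_comp (measurable_powR s)); apply: measurable_funD => //.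
  by apply: measurable_funX; exact: measurable_enorm.
rewrite (eq_integral (fun xi => ((1 + enorm xi ^+ 2) `^ s * Normc.normc (uhat xi) ^+ 2)%:E)); last first.
  by move=> xi _ /=; rewrite ger0_norm// mulr_ge0 ?powR_ge0 ?sqr_ge0.
rewrite ltey; apply/eqP => E; move: fin; rewrite /sobolev_norm E poweRyr//.
Qed.

Lemma multiplier_sqr_integral_le (m uhat : V -> R[i]) (E : V -> R) (c : R) :
  cmeasurable m -> cmeasurable uhat -> 
  (forall xi, Normc.normc (m xi) ^+ 2 <= c * E xi) ->
  (leb n).-integrable setT (EFin \o (fun xi => E xi * Normc.normc (uhat xi) ^+ 2)) ->
  [/\ (leb n).-integrable setT (EFin \o (fun xi => complex.Re (m xi * uhat xi) ^+ 2)),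
      (leb n).-integrable setT (EFin \o (fun xi => complex.Im (m xi * uhat xi) ^+ 2)) &
      \int[leb n]_xi (complex.Re (m xi * uhat xi) ^+ 2) + \int[leb n]_xi (complex.Im (m xi * uhat xi) ^+ 2)
      <= c * \int[leb n]_xi (E xi * Normc.normc (uhat xi) ^+ 2)].
Proof.
move=> mm mu mE iE; have [m1 m2] := cmeasurableM mm mu.
have le xi : Normc.normc (m xi * uhat xi) ^+ 2 <= c * (E xi * Normc.normc (uhat xi) ^+ 2).
  by rewrite Normc.normcM exprMn mulrA ler_wpM2r// sqr_ge0.
have icE : (leb n).-integrable setT (EFin \o (fun xi => c * (E xi * Normc.normc (uhat xi) ^+ 2))).
  have := integrableZl measurableT c iE.
  by apply: eq_integrable => // y _; rewrite /= EFinM.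
have i1 : (leb n).-integrable setT (EFin \o (fun xi => complex.Re (m xi * uhat xi) ^+ 2)).
  apply: le_integrableR icE; first exact: measurable_funX.
  move=> xi; rewrite ger0_norm ?sqr_ge0//; apply: le_trans (le xi).
  by rewrite normc_sqr lerDl sqr_ge0.
have i2 : (leb n).-integrable setT (EFin \o (fun xi => complex.Im (m xi * uhat xi) ^+ 2)).
  apply: le_integrableR icE; first exact: measurable_funX.
  move=> xi; rewrite ger0_norm ?sqr_ge0//; apply: le_trans (le xi).
  by rewrite normc_sqr lerDr sqr_ge0.
split => //; rewrite -(RintegralD measurableT i1 i2) -(RintegralZl c measurableT iE).
apply: le_Rintegral => //.
  have := integrableD measurableT i1 i2; exact: eq_integrable.
by move=> xi _ /=; rewrite -normc_sqr.
Qed.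

(** At a fixed threshold the measures of the exceptional sets are summable and Borel-Cantelli
    applies; the countably many thresholds 1 / (m + 1) are then intersected. *)
Lemma weak_type_ae_small (p : nat -> V -> R) (good : pred nat) (tau : nat -> R) :
  (forall k, measurable_fun setT (p k)) -> (\forall k \near \oo, good k) ->
  (forall k, 0 <= tau k) -> (\sum_(k <oo) (tau k)%:E < +oo)%E ->
  (forall k lam, good k -> 0 < lam ->
    \int[leb n]_(x in [set x | lam <= `|p k x|]) gaussian 1 x <= tau k / lam ^+ 2) ->
  {ae leb n, forall x, forall m, \forall k \near \oo, `|p k x| < m.+1%:R^-1}.
Proof.
move=> mp G tau0 stau H; apply: ae_foralln => m.
have l0 : 0 < m.+1%:R^-1 :> R by rewrite invr_gt0.
(* The estimate is given only for good k; the empty set at the finitely many other indices keeps the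
   sum finite and does not change the eventual behaviour. *)
pose A k := if good k then [set x | m.+1%:R^-1 <= `|p k x|] else set0.
pose l2 : R := (m.+1%:R^-1 ^+ 2)^-1.
have l20 : 0 <= l2 by rewrite invr_ge0 sqr_ge0.
have mA k : measurable (A k).
  by rewrite /A; case: ifP => // _; exact: measurable_ge_norm.
have At k : \int[leb n]_(x in A k) gaussian 1 x <= l2 * tau k.
  rewrite /A; case: ifP => gk; first by rewrite mulrC; exact: H.
  by rewrite Rintegral_set0 mulr_ge0.
have st : (\sum_(k <oo) (l2 * tau k)%:E < +oo)%E.
  under eq_eseriesr do rewrite EFinM.
  rewrite nneseriesZl => [|k _]; last by rewrite lee_fin.
  by rewrite lte_mul_pinfty.
have := gaussian_borel_cantelli mA (fun k => mulr_ge0 l20 (tau0 k)) At st.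
apply: filterS => x; apply: filterS2 G => k gk.
by rewrite /A gk /= => /negP; rewrite -ltNge.
Qed.

Lemma cvg_complex (w : nat -> R[i]) (z : R[i]) :
  (forall m, \forall k \near \oo, `|complex.Re (w k - z)| < m.+1%:R^-1) ->
  (forall m, \forall k \near \oo, `|complex.Im (w k - z)| < m.+1%:R^-1) ->
  (fun k => w k : R[i]^o) @ \oo --> (z : R[i]^o).
Proof.
move=> H1 H2; apply/cvgrPdist_lt => e e0.
(* The norm on complex numbers takes its values in [R[i]], where a positive element is real. *)
have [r er] : exists r : R, e = r%:C.
  by apply/complex_realP; exact: gtr0_real.
have r0 : 0 < r by move: e0; rewrite er ltcR.
have [m mr] : exists m : nat, m.+1%:R^-1 + m.+1%:R^-1 <= r.
  exists (Num.truncn (2 / r)).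
  have := truncnS_gt (2 / r); set q := _.+1%:R => h.
  have q0 : 0 < q by rewrite ltr0n.
  by rewrite -mulr2n -[_ *+ 2]mulr_natl ler_pdivrMr// mulrC -ler_pdivrMr// ltW.
apply: filterS2 (H1 m) (H2 m) => k h1 h2.
rewrite distrC er -[`|_|]/((Normc.normc (w k - z))%:C) ltcR.
exact: le_lt_trans (normc_le _) (lt_le_trans (ltrD h1 h2) mr).
Qed.

End convergence.

Theorem theorem1p3 (R : realType) (n : nat) (mu : 'rV[R]_n) (beta a s : R)
    (t : nat -> R) (u : distr R n) (f : 'rV[R]_n -> R[i])
    (Sf : nat -> 'rV[R]_n -> R[i]) :
  (1 <= n)%N ->
  enorm mu = 1 ->
  0 < a < 1 ->
  0 < s <= 1 ->
  (1 < beta -> 1 - a < s) ->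
  (beta <= 1 -> 1 - a * beta < s) ->
  (forall k, 0 <= t k) ->
  t @ \oo --> (0 : R) ->
  (1 < beta ->
    (\sum_(k <oo) (t k `^ (2 * (1 + (s - 1) / a)))%:E < +oo)%E) ->
  (beta <= 1 ->
    (\sum_(k <oo) (t k `^ (2 * (beta + (s - 1) / a)))%:E < +oo)%E) ->
  sobolev s u ->
  represents u f ->
  (forall k, propagated (t k) a beta mu u (Sf k)) ->
  {ae @lebesgue_rV R n, forall x,
    (fun k => ((2 * pi) ^- n)%:C * Sf k x : R[i]^o) @ \oo --> (f x : R[i]^o)}.
Proof.
move=> _ mu1 a01 s01 _ ab t0 tcvg sum1 sum2 [_ [uhat Ru fin]] Rf prop.
pose g k x : R[i] := ((2 * pi) ^- n)%:C * Sf k x.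
pose sigma : R := if beta <= 1 then beta + (s - 1) / a else 1 + (s - 1) / a.
have sig1 : 1 < beta -> sigma = 1 + (s - 1) / a by move=> b1; rewrite /sigma leNgt b1.
have sig2 : beta <= 1 -> sigma = beta + (s - 1) / a by move=> b1; rewrite /sigma b1.
have sumt : (\sum_(k <oo) (t k `^ (2 * sigma))%:E < +oo)%E.
  case: (leP beta 1) => b1.
    by rewrite (sig2 b1); exact: sum2.
  by rewrite (sig1 b1); exact: sum1.
clearbody sigma.
pose th k (xi : 'rV[R]_n) := t k `^ beta * dotp mu xi + t k * enorm xi `^ a.
have mth k : measurable_fun setT (th k).
  apply: measurable_funD; apply: measurable_funM => //.
    by apply: measurable_fun_dotp.
  by apply: (measurableT_comp (measurable_powR a)); exact: measurable_enorm.
pose m k xi : R[i] := expi (th k xi) - 1.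
have mm k : cmeasurable (m k).
  by apply: cmeasurableB; [exact: cmeasurable_expi|split; exact: measurable_cst].
have mg k : cmeasurable (g k) by have [[]] := prop k.
have mw k : cmeasurable (fun x => g k x - f x).
  by apply: cmeasurableB => //; case: Rf.
have mu_ : cmeasurable uhat by case: Ru.
have pair k : gaussian_pair (fun x => g k x - f x) (fun xi => m k xi * uhat xi).
  have [sg [v Rv Rg]] := prop k.
  have p1 := square_integrable_gaussian_pair sg Rg.
  have p2 := represents_gaussian_pair Rf Ru.
  have := gaussian_pairB p1 p2; move/gaussian_pair_ae; apply; first exact: cmeasurableM.
  have := represents_ae_eq Rv Ru; apply: filterS => xi ->.
  by rewrite /m mulrBl mul1r.
pose W (xi : 'rV[R]_n) : R := (1 + enorm xi ^+ 2) `^ s.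
have iE := sobolev_norm_integrable mu_ fin.
pose N := \int[@lebesgue_rV R n]_xi (W xi * Normc.normc (uhat xi) ^+ 2).
have N0 : 0 <= N.
  by apply: Rintegral_ge0 => xi _; rewrite mulr_ge0 ?powR_ge0 ?sqr_ge0.
(* The symbol bound needs t k <= 1, which convergence to 0 ensures for all but finitely many k. *)
pose good k := t k <= 1.
have parts k : good k -> _ :=
  fun gk => multiplier_sqr_integral_le (mm k) mu_ (fun xi =>
    symbol_bound xi mu1 a01 s01 ab sig1 sig2 (introT andP (conj (t0 k) gk))) iE.
have Wc0 : 0 <= @weak_type_const R n.
  by rewrite /weak_type_const !mulr_ge0 ?addr_ge0 ?mulr_ge0 ?exprn_ge0 ?sqrtr_ge0 ?inversion_const_ge0.
(* The factor 4 comes from the symbol bound, and N is the square of the Sobolev norm. *)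
pose tau k := @weak_type_const R n * 4 * N * t k `^ (2 * sigma).
have c0 : 0 <= @weak_type_const R n * 4 * N := mulr_ge0 (mulr_ge0 Wc0 (ler0n _ 4)) N0.
have tau0 k : 0 <= tau k by rewrite mulr_ge0 ?powR_ge0.
have stau : (\sum_(k <oo) (tau k)%:E < +oo)%E.
  under eq_eseriesr do rewrite EFinM.
  rewrite nneseriesZl => [|k _]; last by rewrite lee_fin powR_ge0.
  by rewrite lte_mul_pinfty.
have ngood : \forall k \near \oo, good k.
  have /cvgrPdist_lt /(_ 1 ltr01) := tcvg; apply: filterS => k.
  by rewrite sub0r normrN ger0_norm// => /ltW.
have weak k lam : good k -> 0 < lam ->
    \int[lebesgue_rV R n]_(x in [set x | lam <= `|complex.Re (g k x - f x)|]) gaussian 1 x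
      <= tau k / lam ^+ 2 /\
    \int[lebesgue_rV R n]_(x in [set x | lam <= `|complex.Im (g k x - f x)|]) gaussian 1 x
      <= tau k / lam ^+ 2.
  move=> gk lam0; have [i1 i2 le] := parts k gk.
  have [h1 h2] := gaussian_pair_weak_type (pair k) (mw k) (cmeasurableM (mm k) mu_) i1 i2 lam0.
  have l0 : 0 <= (lam ^+ 2)^-1 by rewrite invr_ge0 sqr_ge0.
  have le' : @weak_type_const R n * (\int[@lebesgue_rV R n]_xi (complex.Re (m k xi * uhat xi) ^+ 2)
     + \int[@lebesgue_rV R n]_xi (complex.Im (m k xi * uhat xi) ^+ 2)) / lam ^+ 2 <= tau k / lam ^+ 2.
    apply: ler_wpM2r => //; apply: le_trans (ler_wpM2l Wc0 le) _.
    by rewrite /tau -/N !mulrA [leRHS]mulrAC lexx.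
  by split; [apply: le_trans h1 le'|apply: le_trans h2 le'].
have RE := weak_type_ae_small (fun k => (mw k).1) ngood tau0 stau (fun k lam gk l0 => (weak k lam gk l0).1).
have IM := weak_type_ae_small (fun k => (mw k).2) ngood tau0 stau (fun k lam gk l0 => (weak k lam gk l0).2).
by apply: filterS2 RE IM => x; exact: cvg_complex.
Qed.
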